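(* Let $\Gamma=\Gamma_1\cup\dots\cup\Gamma_n$ be a reducible spectral curve with data $P,Q,R,\gamma,k_j^{-1},d_j,\lambda_{ab}$, involutions $\sigma$ and $\tau$, $1$-form $\Omega$ and Baker--Akhiezer section $\psi(u,\cdot)$, $u=(u^1,\dots,u^n)$ in a domain of $\mathbb R^n$, as described in the context. Suppose that each component $\Gamma_j$ is isomorphic to $\mathbb CP^1$, that $k_j=z_j$ is an affine coordinate on $\Gamma_j$, and that each component $\Gamma_j$, $j=1,\dots,n$, contains the points $P_j=\infty$ and $Q_j=0$. Let $\Omega$ have near $P_j$ the decomposition $$\Omega=\left(\frac{\varepsilon_j^2}{k_j}+O\!\left(\frac1{k_j^2}\right)\right)dk_j^{-1}.$$ Assume that each intersection point $q\in\Gamma_i\cap\Gamma_j$ has the same coordinates on each of the components $\Gamma_i$ and $\Gamma_j$: $$z_i(q)=z_j(q).$$ Then, with $x^j(u)=\psi(u,Q_j)$, the flat metric $ds^2=(dx^1)^2+\dots+(dx^n)^2$ has in the coordinates $u^1,\dots,u^n$ the form $$ds^2=\varepsilon_1^2h_1^2(u)(du^1)^2+\dots+\varepsilon_n^2h_n^2(u)(du^n)^2,$$ where $h_j(u)$ is the leading coefficient in the expansion of $\psi$ at $P_j$, and it is a Darboux--Egorov metric.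
   Context: **Spectral curve.** $\Gamma$ is a compact reducible complex curve which is a union of nonsingular irreducible components $\Gamma_1,\dots,\Gamma_n$ intersecting only at double points: each intersection point is obtained by identifying one point $a\in\Gamma_p$ with one point $b\in\Gamma_q$, $p\ne q$. The normalization $\Gamma_{\mathrm{nm}}$ is the disjoint union of the $\Gamma_j$. If $N$ is the number of intersection points, the arithmetic genus is $g_a=\sum_j g(\Gamma_j)+N-n+1$. Divisors and residues are computed on $\Gamma_{\mathrm{nm}}$; involutions of $\Gamma$ are regarded as acting on $\Gamma_{\mathrm{nm}}$. **Data.** $P=P_1+\dots+P_n$, $Q=Q_1+\dots+Q_n$, $R=R_1+\dots+R_l$, $\gamma=\gamma_1+\dots+\gamma_{g_a+l-1}$ are divisors of pairwise distinct nonsingular points of $\Gamma$ (i.e. not intersection points); $k_j^{-1}$ is a local parameter near $P_j$ (vanishing at $P_j$); $d_1,\dots,d_l\in\mathbb C$ are constants, not all $0$. For each intersection point ($a\in\Gamma_p$ identified with $b\in\Gamma_q$) a non-zero gluing constant $\lambda_{ab}\in\mathbb C$ is given, with $\lambda_{ba}=\lambda_{ab}^{-1}$. **Baker--Akhiezer section.** For $u$ in a domain of $\mathbb R^n$, $\psi(u,\cdot)$ is a collection of functions $\psi_j(u,\cdot)$ on the components $\Gamma_j$ such that: 1. near $P_j$, $\psi=e^{k_ju^j}\left(h_j(u)+\frac{\xi_j(u)}{k_j}+\dots\right)$, i.e. $e^{-k_ju^j}\psi$ extends holomorphically across $P_j$; 2. away from the points $P_1,\dots,P_n$, $\psi$ is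 meromorphic with at most simple poles, located at the points of $\gamma$; 3. $\psi(u,R_j)=d_j$, $j=1,\dots,l$; 4. at each intersection point ($a\in\Gamma_p$ identified with $b\in\Gamma_q$), $\psi_p(u,a)=\lambda_{ab}\,\psi_q(u,b)$. Standing assumptions: for every $u$ in the domain there is exactly one $\psi(u,\cdot)$ with these properties, it depends smoothly on $u$ (so that $e^{-k_ju^j}\psi$ near $P_j$, and $\psi$ away from $P\cup\gamma$, are jointly smooth, and $\partial_{u^i}\psi$ again has at most simple poles at $\gamma$), and $h_j(u)\ne0$ for all $j$ on the domain. **Involution $\sigma$ and form $\Omega$.** $\sigma:\Gamma\to\Gamma$ is a holomorphic involution mapping components to components, $\sigma(\Gamma_s)=\Gamma_{\sigma(s)}$, fixing all $P_j$ and $Q_j$, with $k_j\circ\sigma=-k_j$ near $P_j$. $\Omega$ is a meromorphic $1$-form on $\Gamma$, given by meromorphic $1$-forms $\Omega_j$ on $\Gamma_j$, with divisor of zeros $P_1+\dots+P_n+\gamma+\sigma\gamma$; away from intersection points its divisor of poles is $Q_1+\dots+Q_n+R+\sigma R$; at the intersection points the $\Omega_j$ have at most simple poles, and with $\lambda=\lambda_{ab}$, $\lambda_\sigma=\lambda_{\sigma(a)\sigma(b)}$, $$\lambda\lambda_\sigma\operatorname{Res}_a\Omega_p+\operatorname{Res}_b\Omega_q=0,\qquad \lambda\lambda_\sigma\operatorname{Res}_{\sigma(a)}\Omega_{\sigma(p)}+\operatorname{Res}_{\sigma(b)}\Omega_{\sigma(q)}=0$$ at each intersection point ($a\in\Gamma_p$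 identified with $b\in\Gamma_q$); and $\operatorname{Res}_{Q_1}\Omega=\dots=\operatorname{Res}_{Q_n}\Omega=1$. **Reality data.** $\tau:\Gamma\to\Gamma$ is an antiholomorphic involution mapping components to components, $\tau(\Gamma_j)=\Gamma_{\tau(j)}$, with $\tau(P_j)=P_j$, $\tau(Q_j)=Q_j$, $k_j^{-1}\circ\tau=\overline{k_j^{-1}}$ near $P_j$, $\tau^*\Omega=\overline\Omega$, $\tau(\gamma)=\gamma$ and $\tau(R)=R$ as divisors; writing $\tau(R_j)=R_{\tau(j)}$, $\overline{d_j}=d_{\tau(j)}$; and $\overline{\lambda_{ab}}=\lambda_{\tau(a)\tau(b)}$ at each intersection point. (These conditions are the ones imposed so that the $x^j(u)$ are real-valued.) **Darboux--Egorov metric.** A diagonal flat metric $ds^2=H_1^2(u)(du^1)^2+\dots+H_n^2(u)(du^n)^2$ in a domain of Euclidean space is called a Darboux--Egorov metric if its rotation coefficients $\beta_{ij}=\dfrac{\partial_{u^i}H_j}{H_i}$, $i\ne j$, are symmetric: $\beta_{ij}=\beta_{ji}$. Here $H_j=\varepsilon_jh_j$. *)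

(* Defs.v *)
From HB Require Import structures.
From mathcomp Require Import all_boot all_order all_algebra.
From mathcomp Require Import complex.
From mathcomp Require Import all_classical all_reals all_analysis.
Import Order.TTheory GRing.Theory Num.Theory.
Import numFieldNormedType.Exports.

Set Implicit Arguments.
Unset Strict Implicit.
Unset Printing Implicit Defensive.

Local Open Scope classical_set_scope.
Local Open Scope ring_scope.

(* R[i] carries no topology of its own; packed as a numFieldType it gets the
   canonical normed-module structure over itself, so that [derivable f z 1]
   for f : cplx R -> cplx R is complex differentiability. *)
Definition cplx (R : realType) : numFieldType := complex R.

Section ComplexAnalysis.
Context {R : realType}.
Local Notation C := (cplx R).
Implicit Types (f g : C -> C) (a z t : C).

Definition mkC (x y : R) : C := Complex x y.
Definition reC (z : C) : R := complex.Re (z : complex R).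
Definition imC (z : C) : R := complex.Im (z : complex R).
Definition cconj (z : C) : C := conjc (z : complex R).
Definition ofR (x : R) : C := mkC x 0.
Definition expC (z : C) : C :=
  mkC (expR (reC z) * cos (imC z)) (expR (reC z) * sin (imC z)).

Definition holomorphic_at f a : Prop := \forall z \near a, derivable f z 1.

(* The next four predicates only see the germ of f on a punctured
   neighbourhood of 0, so the value f 0 is irrelevant. *)
Definition extends_holomorphically f g : Prop :=
  holomorphic_at g 0 /\ \forall t \near 0^', f t = g t.

Definition at_most_simple_pole f : Prop :=
  exists2 g, holomorphic_at g 0 & \forall t \near 0^', f t = g t / t.

Definition has_order f (m : int) : Prop :=
  exists2 g, holomorphic_at g 0 /\ g 0 != 0
    & \forall t \near 0^', f t = g t * t ^ m.

(* r is the coefficient of t^-1 in the Laurent expansion: the principal part is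
   r / t + c_0 / t^2 + ... + c_(m-1) / t^(m+1). *)
Definition is_residue f (r : C) : Prop :=
  exists (m : nat) (c : nat -> C) g, holomorphic_at g 0 /\
    \forall t \near 0^', f t = r / t + \sum_(k < m) c k / t ^+ k.+2 + g t.

Definition residue f : C := xget 0 [set r | is_residue f r].

End ComplexAnalysis.

(* The Riemann sphere: [Some z] is the point of affine coordinate z, [None] is
   the point at infinity. *)
Definition CP1 (R : realType) := one_point_compactification (cplx R).

Section Sphere.
Context {R : realType}.
Local Notation C := (cplx R).
Local Notation CP1 := (CP1 R).
Implicit Types (p q : CP1) (F : CP1 -> CP1).

Definition pt_fin (z : C) : CP1 := Some z.
Definition pt_inf : CP1 := None.

(* Inverse of the local coordinate centred at p: z - a at p = a, 1 / z at
   infinity. *)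
Definition par p (t : C) : CP1 :=
  if p is Some a then pt_fin (a + t)
  else if t == 0 then pt_inf else pt_fin t^-1.

(* The local coordinate centred at p; meaningful for q close to p only (for p
   finite the value at infinity is junk, for p infinite the value at 0 is). *)
Definition loc p q : C :=
  match p, q with
  | Some a, Some z => z - a
  | None, Some z => z^-1
  | _, None => 0
  end.

(* The affine coordinate, with junk value 0 at infinity. *)
Definition coord p : C := odflt 0 p.

Definition conjCP1 p : CP1 := omap cconj p.

Definition holomorphic_map F : Prop :=
  continuous F /\
  forall p, holomorphic_at (fun t => loc (F p) (F (par p t))) 0.

Definition antiholomorphic_map F : Prop := holomorphic_map (conjCP1 \o F).

End Sphere.

Section RealCalculus.
Context {R : realType}.
Local Notation C := (cplx R).

Definition basis_vec m (i : 'I_m) : 'rV[R]_m := delta_mx 0 i.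

Definition partial m (i : 'I_m) (f : 'rV[R]_m -> R) : 'rV[R]_m -> R :=
  fun v => 'D_(basis_vec i) f v.

Definition partialC m (i : 'I_m) (F : 'rV[R]_m -> C) : 'rV[R]_m -> C :=
  fun v => mkC (partial i (reC \o F) v) (partial i (imC \o F) v).

Definition smooth_on m (U : set 'rV[R]_m) (f : 'rV[R]_m -> R) : Prop :=
  forall (s : seq 'I_m) v, U v ->
    let fs := foldr (@partial m) f s in
    {for v, continuous fs} /\ forall i, derivable fs v (basis_vec i).

Definition smoothC_on m (U : set 'rV[R]_m) (F : 'rV[R]_m -> C) : Prop :=
  smooth_on U (reC \o F) /\ smooth_on U (imC \o F).

(* R^n x C is identified with R^(n + 2). *)
Definition upart n (v : 'rV[R]_(n + 2)) : 'rV[R]_n := lsubmx v.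
Definition zpart n (v : 'rV[R]_(n + 2)) : C :=
  mkC (v 0 (rshift n ord0)) (v 0 (rshift n ord_max)).
Definition joint n (F : 'rV[R]_n -> C -> C) : 'rV[R]_(n + 2) -> C :=
  fun v => F (upart v) (zpart v).

End RealCalculus.

(* The normalization of a curve with n components, all of them Riemann spheres
   with the affine coordinates z_1, ..., z_n. *)
Definition curve_point (R : realType) (n : nat) := ('I_n * CP1 R)%type.

Section Normalization.
Context {R : realType} {n : nat}.
Local Notation C := (cplx R).
Local Notation point := (curve_point R n).

Definition Ppt (j : 'I_n) : point := (j, pt_inf).
Definition Qpt (j : 'I_n) : point := (j, pt_fin 0).

Definition lpar (x : point) (t : C) : point := (x.1, par x.2 t).

Definition component_map (f : point -> point) (j : 'I_n) : CP1 R -> CP1 R :=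
  fun p => (f (j, p)).2.

(* A meromorphic 1-form is given by its coefficients omega with respect to
   d z_j (only their values off the poles and off infinity matter); form_at is
   its coefficient with respect to dt, t being the local coordinate at x: at
   infinity z = 1 / t and dz = - dt / t^2. *)
Definition form_at (omega : point -> C) (x : point) (t : C) : C :=
  if x.2 is Some a then omega (x.1, pt_fin (a + t))
  else - omega (x.1, pt_fin t^-1) / t ^+ 2.

End Normalization.

Section Gluing.
Context {R : realType} {n N : nat}.
Variable node : 'I_N -> curve_point R n * curve_point R n.

(* The unordered pair {a, b} is one of the N pairs of identified points. *)
Definition glued (a b : curve_point R n) : bool :=
  [exists s, (node s == (a, b)) || (node s == (b, a))].

Definition singular (x : curve_point R n) : bool :=
  [exists s, (x == (node s).1) || (x == (node s).2)].

End Gluing.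

(* N - n + 1, since all components have genus 0. *)
Definition arith_genus (n N : nat) : int := N%:Z - n%:Z + 1.

(* A curve whose n components are Riemann spheres, with k_j = z_j, P_j = infinity
   and Q_j = 0, together with R, gamma, d and the gluing constants lambda; only
   the values of lam at pairs of identified points matter. *)
Record spectral_data (R : realType) (n : nat) := SpectralData {
  nb_nodes : nat;
  nb_R : nat;
  nb_gam : nat;
  node : 'I_nb_nodes -> curve_point R n * curve_point R n;
  Rpt : 'I_nb_R -> curve_point R n;
  gam : 'I_nb_gam -> curve_point R n;
  dcst : 'I_nb_R -> cplx R;
  lam : curve_point R n -> curve_point R n -> cplx R;
  node_components : forall s, (node s).1.1 != (node s).2.1;
  node_double : uniq (codom (fst \o node) ++ codom (snd \o node));
  gam_degree : nb_gam%:Z = arith_genus n nb_nodes + nb_R%:Z - 1;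
  points_distinct : uniq (codom Ppt ++ codom Qpt ++ codom Rpt ++ codom gam);
  points_nonsingular : forall x,
    x \in codom Ppt ++ codom Qpt ++ codom Rpt ++ codom gam ->
    ~~ singular node x;
  dcst_neq0 : exists i, dcst i != 0;
  lam_neq0 : forall a b, glued node a b -> lam a b != 0;
  lam_sym : forall a b, glued node a b -> lam b a = (lam a b)^-1
}.

Arguments nb_nodes {R n} S : rename.
Arguments nb_R {R n} S : rename.
Arguments nb_gam {R n} S : rename.
Arguments node {R n} S _ : rename.
Arguments Rpt {R n} S _ : rename.
Arguments gam {R n} S _ : rename.
Arguments dcst {R n} S _ : rename.
Arguments lam {R n} S _ _ : rename.

Section BakerAkhiezer.
Context {R : realType} {n : nat}.
Variable S : spectral_data R n.
Local Notation C := (cplx R).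
Local Notation point := (curve_point R n).
Local Notation glued := (glued (node S)).
Local Notation singular := (singular (node S)).

Definition same_coordinates : Prop := forall a b, glued a b -> a.2 = b.2.

(* e^(-k_j u^j) phi near P_j, in the local parameter w = k_j^-1. *)
Definition normalized (u : 'rV[R]_n) (phi : point -> C) (j : 'I_n) (w : C) : C :=
  expC (- ofR (u 0 j) / w) * phi (j, pt_fin w^-1).

(* phi is a Baker-Akhiezer section at u with leading coefficients c_j at P_j;
   its values at the points of P and gamma are irrelevant. *)
Record is_BA (u : 'rV[R]_n) (phi : point -> C) (c : 'I_n -> C) : Prop := IsBA {
  BA_essential : forall j, exists2 g, g 0 = c j
    & extends_holomorphically (normalized u phi j) g;
  BA_pole : forall x, x \in codom (gam S) ->
    at_most_simple_pole (phi \o lpar x);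
  BA_regular : forall x, x \notin codom Ppt ++ codom (gam S) ->
    holomorphic_at (phi \o lpar x) 0;
  BA_normalization : forall i, phi (Rpt S i) = dcst S i;
  BA_gluing : forall a b, glued a b -> phi a = lam S a b * phi b
}.

Record BA_family (D : set 'rV[R]_n) (psi : 'rV[R]_n -> point -> C)
    (h : 'rV[R]_n -> 'I_n -> C) : Prop := BAFamily {
  BAF_section : forall u, D u -> is_BA u (psi u) (h u);
  BAF_unique : forall u phi c, D u -> is_BA u phi c ->
    forall x, x \notin codom Ppt ++ codom (gam S) -> phi x = psi u x;
  BAF_smooth : forall j,
    smoothC_on
      [set v | D (upart v) /\ (j, pt_fin (zpart v)) \notin codom (gam S)]
      (joint (fun u z => psi u (j, pt_fin z)));
  BAF_smooth_P : forall j, exists2 U : set 'rV[R]_(n + 2),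
    open U /\ (forall u, D u -> U (row_mx u 0))
    & smoothC_on U
        (joint (fun u w => if w == 0 then h u j else normalized u (psi u) j w));
  BAF_derivative_pole : forall u i k, D u ->
    at_most_simple_pole
      (fun t => partialC i (fun u' => psi u' (lpar (gam S k) t)) u);
  BAF_h_neq0 : forall u j, D u -> h u j != 0
}.

(* A map of the normalization induced by an involution of the curve that maps
   components to components. *)
Record curve_involution (f : point -> point) : Prop := CurveInvolution {
  inv_involutive : involutive f;
  inv_components : exists s : 'I_n -> 'I_n, forall x, (f x).1 = s x.1;
  inv_glued : forall a b, glued a b -> glued (f a) (f b)
}.

Record sigma_data (sigma : point -> point) : Prop := SigmaData {
  sigma_involution : curve_involution sigma;
  sigma_holomorphic : forall j, holomorphic_map (component_map sigma j);
  sigma_P : forall j, sigma (Ppt j) = Ppt j;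
  sigma_Q : forall j, sigma (Qpt j) = Qpt j;
  sigma_k : forall j, \forall w \near (0 : C)^',
    sigma (j, pt_fin w^-1) = (j, pt_fin (- w^-1))
}.

Definition zero_divisor (sigma : point -> point) : seq point :=
  codom Ppt ++ codom (gam S) ++ codom (sigma \o gam S).

Definition pole_divisor (sigma : point -> point) : seq point :=
  codom Qpt ++ codom (Rpt S) ++ codom (sigma \o Rpt S).

Definition Res (omega : point -> C) (x : point) : C :=
  residue (form_at omega x).

Record Omega_data (sigma : point -> point) (omega : point -> C) : Prop :=
    OmegaData {
  (* positive and negative parts of the order are the multiplicities in the
     divisors of zeros and poles *)
  Omega_order : forall x, exists2 k : int, has_order (form_at omega x) k
    & [/\ Num.max k 0 = (count_mem x (zero_divisor sigma))%:Z,
          ~~ singular x ->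
            Num.max (- k) 0 = (count_mem x (pole_divisor sigma))%:Z
        & singular x -> -1 <= k];
  Omega_residue : forall a b, glued a b ->
    let mu := lam S a b * lam S (sigma a) (sigma b) in
    mu * Res omega a + Res omega b = 0 /\
    mu * Res omega (sigma a) + Res omega (sigma b) = 0;
  Omega_residue_Q : forall j, Res omega (Qpt j) = 1
}.

(* Omega = (eps_j^2 / k_j + O(1 / k_j^2)) d(k_j^-1) near P_j; w = k_j^-1. *)
Definition Omega_expansion (omega : point -> C) (eps : 'I_n -> C) : Prop :=
  forall j, (fun w => form_at omega (Ppt j) w - eps j ^+ 2 * w)
              =O_ ((0 : C)^') (fun w => w ^+ 2).

Record tau_data (omega : point -> C) (tau : point -> point) : Prop := TauData {
  tau_involution : curve_involution tau;
  tau_antiholomorphic : forall j, antiholomorphic_map (component_map tau j);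
  tau_P : forall j, tau (Ppt j) = Ppt j;
  tau_Q : forall j, tau (Qpt j) = Qpt j;
  tau_k : forall j, \forall w \near (0 : C)^',
    tau (j, pt_fin w^-1) = (j, pt_fin (cconj w)^-1);
  (* tau^* Omega = conj Omega: if the coordinate of tau (j, z) is conj (g z),
     with g holomorphic, then tau^* dz = conj (g' z) d(conj z) *)
  tau_Omega : forall j (a : C), \forall z \near a^',
    omega (tau (j, pt_fin z)) *
      cconj ('D_1 (fun s : C => cconj (coord (tau (j, pt_fin s)).2)) z)
    = cconj (omega (j, pt_fin z));
  tau_gam : perm_eq (codom (tau \o gam S)) (codom (gam S));
  tau_R : perm_eq (codom (tau \o Rpt S)) (codom (Rpt S));
  tau_d : forall i k, tau (Rpt S i) = Rpt S k -> cconj (dcst S i) = dcst S k;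
  tau_lam : forall a b, glued a b ->
    cconj (lam S a b) = lam S (tau a) (tau b)
}.

End BakerAkhiezer.

Section Metric.
Context {R : realType} {n : nat}.
Variable D : set 'rV[R]_n.

(* The metric (dx^1)^2 + ... + (dx^n)^2 is H_1^2 (du^1)^2 + ... + H_n^2 (du^n)^2
   in the coordinates u on D. *)
Record diagonal_flat_metric (x H : 'I_n -> 'rV[R]_n -> R) : Prop :=
    DiagonalFlatMetric {
  flat_smooth : forall k, smooth_on D (x k);
  lame_smooth : forall j, smooth_on D (H j);
  lame_neq0 : forall u j, D u -> H j u != 0;
  metric_diagonal : forall u i j, D u ->
    \sum_(k < n) partial i (x k) u * partial j (x k) u
    = if i == j then H i u ^+ 2 else 0
}.

Definition rotation_coef (H : 'I_n -> 'rV[R]_n -> R) (i j : 'I_n) u : R :=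
  partial i (H j) u / H i u.

Definition Darboux_Egorov (x H : 'I_n -> 'rV[R]_n -> R) : Prop :=
  diagonal_flat_metric x H /\
  forall u i j, D u -> i != j -> rotation_coef H i j u = rotation_coef H j i u.

End Metric.

Definition domain (R : realType) (n : nat) (D : set 'rV[R]_n) : Prop :=
  [/\ D !=set0, open D & connected D].

(* Main.v *)
(* All residue computations are global statements on the spheres Gamma_j, deduced
   from one form of Liouville's theorem: a function on the sphere whose only
   singularities are removable is constant. It follows from the fact that the mean
   of the function over a circle about a does not depend on the radius, by
   Goursat's theorem in the coordinate log (z - a).

   Liouville gives sigma(z) = -z and tau(z) = conj z on each component, the partial
   fraction expansion psi_j = e^(u_j z) (h_j + sum_m r_m / (z - a_m)), and the
   rationality of Omega. On every component the forms
     z^s (d_i psi)(z) (d_k psi)(-z) Omega    (s = 0, 1)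
   then have simple poles only at the nodes, at Q_j (for s = 0) and at P_j. The
   contributions of the two points of a node cancel; this uses the equality of
   their coordinates. Summing the residues over all components gives, for s = 0,
     sum_j (d_i x^j) (d_k x^j) = delta_ik eps_i^2 h_i^2
   and, for s = 1 and i <> k,
     eps_i^2 h_i (d_k h_i) = eps_k^2 h_k (d_i h_k),
   which is the symmetry of the rotation coefficients. Reality of x^j and h_j comes
   from the uniqueness of psi, and the first identity then shows eps_i^2 >= 0. *)

Require Import Defs.
From HB Require Import structures.
From mathcomp Require Import all_boot all_order all_algebra.
From mathcomp Require Import complex ring lra.
From mathcomp Require Import all_classical all_reals all_analysis.
Import Order.TTheory GRing.Theory Num.Theory.
Import numFieldNormedType.Exports.
Set Implicit Arguments.
Unset Strict Implicit.
Unset Printing Implicit Defensive.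
Local Open Scope classical_set_scope.
Local Open Scope ring_scope.

(** * The complex plane *)

(** Holomorphy means only complex differentiability near a point, and the sole source of rigidity is
    Liouville's theorem. This shapes the notion of pole: [simple_pole f a r] writes f (a + t) as g t
    / t, so that the regular part has a limit at a, namely the derivative of g, and limits are all
    that Liouville asks for at exceptional points. Where an expansion is needed, the function is
    rational and the expansion explicit. The powers of z are dictated by infinity. There Omega is
    like -eps_j^2 z^-3 dz, and d_i psi_j, stripped of its exponential, is like delta_ij h_j z +
    O(1). Two factors growing like z against z^-3 leave a residue; for i <> k at most one factor
    grows on a given component, which makes room for one extra z. The exponentials cancel because
    sigma z = -z. The zeros of Omega absorb the poles along gamma and sigma gamma; its poles along R
    and sigma R are absorbed by zeros of d_i psi, since psi is constant in u at the points of R.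
    Differentiating the partial fractions in u requires differentiable coefficients; these are
    recovered linearly from values of psi off gamma. *)

Section ComplexPlane.
Context {R : realType}.
Local Notation C := (cplx R).
Implicit Types (f g : C -> C) (a z w t : C).

(** The norm of [cplx R] takes values in [cplx R], whose order is partial; estimates are carried out
    with this real-valued modulus. *)
Definition nrm z : R := Normc.normc (z : complex R).

Lemma normCE z : `|z| = ofR (nrm z). Proof. by []. Qed.
Lemma ltr_ofR (x y : R) : (ofR x < ofR y) = (x < y). Proof. exact: ltcR. Qed.
Lemma ler_ofR (x y : R) : (ofR x <= ofR y) = (x <= y). Proof. exact: lecR. Qed.
Lemma ofR_inj : injective (@ofR R). Proof. by move=> x y []. Qed.
Lemma ofRD x y : ofR (x + y) = ofR x + ofR y :> C.
Proof. by rewrite /ofR /mkC; congr Complex => /=; rewrite addr0. Qed.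
Lemma ofRN x : ofR (- x) = - ofR x :> C.
Proof. by rewrite /ofR /mkC; congr Complex => /=; rewrite oppr0. Qed.
Lemma ofRM x y : ofR (x * y) = ofR x * ofR y :> C.
Proof. exact: (rmorphM (real_complex R)). Qed.
Lemma ofR0 : ofR 0 = 0 :> C. Proof. by []. Qed.

Lemma nrm_ge0 z : 0 <= nrm z.
Proof. by rewrite -ler_ofR -normCE normr_ge0. Qed.
Lemma nrm0 : nrm 0 = 0. Proof. by apply: ofR_inj; rewrite -normCE normr0. Qed.
Lemma nrm_eq0 z : (nrm z == 0) = (z == 0).
Proof. by rewrite -(inj_eq ofR_inj) -normCE normr_eq0. Qed.
Lemma nrm_gt0 z : (0 < nrm z) = (z != 0).
Proof. by rewrite -ltr_ofR -normCE normr_gt0. Qed.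
Lemma nrmM z w : nrm (z * w) = nrm z * nrm w. Proof. exact: Normc.normcM. Qed.
Lemma nrmD z w : nrm (z + w) <= nrm z + nrm w. Proof. exact: le_normcD. Qed.
Lemma nrmN z : nrm (- z) = nrm z. Proof. exact: normcN. Qed.
Lemma nrmV z : nrm z^-1 = (nrm z)^-1. Proof. exact: Normc.normcV. Qed.
Lemma nrm_ofR x : nrm (ofR x) = `|x|.
Proof. by rewrite /nrm /= expr0n addr0 sqrtr_sqr. Qed.
Lemma nrmB z w : nrm (z - w) <= nrm z + nrm w.
Proof. by rewrite -(nrmN w) nrmD. Qed.
Lemma nrm_distC z w : nrm (z - w) = nrm (w - z).
Proof. by rewrite -nrmN opprB. Qed.

Lemma C_gt0 (e : C) : 0 < e -> exists2 d : R, 0 < d & e = ofR d.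
Proof.
case: e => x y; rewrite ltcE /= => /andP[/eqP -> x0]; by exists x.
Qed.

Lemma nbhsCP z (P : set C) :
  nbhs z P <-> exists2 d : R, 0 < d & forall w, nrm (w - z) < d -> P w.
Proof.
split=> [/nbhs_normP[e /= /C_gt0[d d0 ->]] H|[d d0 H]].
  exists d => // w wd; apply: H => /=; rewrite distrC normCE ltr_ofR //.
apply/nbhs_normP; exists (ofR d); first by rewrite /= ltr_ofR.
by move=> w /=; rewrite distrC normCE ltr_ofR => /H.
Qed.

Lemma dnbhsCP z (P : set C) :
  nbhs z^' P <-> exists2 d : R, 0 < d & forall w, w != z -> nrm (w - z) < d -> P w.
Proof.
split=> [/nbhsCP[d d0 H]|[d d0 H]].
  by exists d => // w wz /H; apply.
by apply/nbhsCP; exists d => // w wd wz; apply: H.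
Qed.

Lemma cvgCP (T : Type) (F : set_system T) (FF : Filter F) (f : T -> C) l :
  f x @[x --> F] --> l <-> forall e : R, 0 < e -> \forall x \near F, nrm (f x - l) < e.
Proof.
split=> [/cvgrPdist_lt H e e0|H].
  have /H : (0 : C) < ofR e by rewrite -ofR0 ltr_ofR.
  by apply: filterS => x; rewrite distrC normCE ltr_ofR.
apply/cvgrPdist_lt => e /C_gt0[d d0 ->].
by apply: filterS (H d d0) => x; rewrite distrC normCE ltr_ofR.
Qed.

(** Linear approximation is free of quotients: composition, conjugation and restriction to the real
    line become plain estimates. *)
Lemma is_deriveCP f z d : is_derive z 1 f d <->
  forall e : R, 0 < e -> exists2 r : R, 0 < r & forall w, nrm (w - z) < r ->
    nrm (f w - f z - d * (w - z)) <= e * nrm (w - z).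
Proof.
have K : ((fun h => h^-1 *: (f (h *: (1 : C) + z) - f z)) @ (0 : C)^' --> d) <->
  forall e : R, 0 < e -> exists2 r : R, 0 < r & forall w, nrm (w - z) < r ->
    nrm (f w - f z - d * (w - z)) <= e * nrm (w - z).
  have key h : h != 0 -> nrm (h^-1 *: (f (h *: (1 : C) + z) - f z) - d) * nrm h =
     nrm (f (z + h) - f z - d * h).
    move=> h0; rewrite -nrmM; congr nrm.
    have -> : h *: (1 : C) + z = z + h by rewrite addrC /GRing.scale /= mulr1.
    by rewrite /GRing.scale /= mulrBl mulrAC mulVf ?mul1r.
  rewrite cvgCP; split=> H e e0.
    have /dnbhsCP[r r0 Hr] := H e e0; exists r => // w wr.
    have [->|wz] := eqVneq w z; first by rewrite !subrr mulr0 subrr nrm0 mulr0.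
    have h0 : w - z != 0 by rewrite subr_eq0.
    have := key _ h0; rewrite (addrC z) subrK => <-.
    by apply: ler_wpM2r; [exact: nrm_ge0 | apply/ltW/Hr => //; rewrite subr0].
  have e2 : 0 < e / 2 by rewrite divr_gt0.
  have [r r0 Hr] := H _ e2; apply/dnbhsCP; exists r => // h h0; rewrite subr0 => hr.
  have := Hr (z + h); rewrite [X in X - z]addrC addrK -key // => /(_ hr).
  rewrite ler_pM2r ?nrm_gt0 // => /le_lt_trans; apply.
  by rewrite ltr_pdivrMr // ltr_pMr // ltr1n.
rewrite -K; split=> [[H <-]|H]; first exact: H.
split; first by apply/cvg_ex; exists d.
exact: cvg_lim H.
Qed.

Lemma derivableCP f z : derivable f z 1 <-> exists d : C,
  forall e : R, 0 < e -> exists2 r : R, 0 < r & forall w, nrm (w - z) < r ->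
    nrm (f w - f z - d * (w - z)) <= e * nrm (w - z).
Proof.
split=> [/derivableP df|[d /(is_deriveCP f z d).2[]] //].
by exists ('D_1 f z); exact: (is_deriveCP f z _).1 df.
Qed.

Lemma derivable_cont f z : derivable f z 1 -> {for z, continuous f}.
Proof. by move=> /derivable1_diffP/differentiable_continuous. Qed.

Lemma cvgC_unique (T : Type) (F : set_system T) {FF : ProperFilter F} (f : T -> C) (l l' : C) :
  f x @[x --> F] --> l -> f x @[x --> F] --> l' -> l = l'.
Proof.
move=> /cvgCP H /cvgCP H'; apply/eqP; rewrite -subr_eq0 -nrm_eq0 eq_le nrm_ge0 andbT.
apply/ler_addgt0Pl => e e0; rewrite addr0.
have e2 : 0 < e / 2 by rewrite divr_gt0.
have [x [H1 H2]] := filter_ex (filterI (H _ e2) (H' _ e2)).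
have -> : l - l' = (f x - l') - (f x - l) by rewrite opprB [RHS]addrC addrA subrK.
by rewrite (le_trans (nrmB _ _)) // [e]splitr lerD // ltW.
Qed.

Lemma cvgC_lim (T : Type) (F : set_system T) {FF : ProperFilter F} (f : T -> C) (l : C) :
  f x @[x --> F] --> l -> lim (f x @[x --> F]) = l.
Proof.
move=> fl; refine (@cvgC_unique T F FF f _ l _ fl).
by apply/cvg_ex; exists l.
Qed.

Lemma cvgC_near_eq (T : Type) (F : set_system T) {FF : Filter F} (f g : T -> C) (l : C) :
  (\forall x \near F, f x = g x) -> f x @[x --> F] --> l -> g x @[x --> F] --> l.
Proof.
move=> fg fl; apply: (cvgCP _ _ _).2 => e e0.
by apply: filterS2 fg ((cvgCP _ _ _).1 fl e e0) => x ->.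
Qed.

Lemma continuous_dnbhs f z : {for z, continuous f} -> f w @[w --> z^'] --> f z.
Proof.
move=> c; exact: (@cvg_within_filter _ _ f (nbhs z) _ (nbhs (f z)) _ c).
Qed.

End ComplexPlane.

(** * The complex exponential and its derivative *)

Section ComplexExponential.
Context {R : realType}.
Local Notation C := (cplx R).
Implicit Types (f g : C -> C) (a z w t : C).

Lemma mkCE z : z = mkC (reC z) (imC z). Proof. by case: z. Qed.
Lemma C_eq z w : reC z = reC w -> imC z = imC w -> z = w.
Proof. by case: z => a b; case: w => c d /= -> ->. Qed.
Lemma reCD z w : reC (z + w) = reC z + reC w. Proof. by case: z; case: w. Qed.
Lemma imCD z w : imC (z + w) = imC z + imC w. Proof. by case: z; case: w. Qed.
Lemma reCN z : reC (- z) = - reC z. Proof. by case: z. Qed.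
Lemma imCN z : imC (- z) = - imC z. Proof. by case: z. Qed.
Lemma reCB z w : reC (z - w) = reC z - reC w. Proof. by rewrite reCD reCN. Qed.
Lemma imCB z w : imC (z - w) = imC z - imC w. Proof. by rewrite imCD imCN. Qed.
Lemma reCM z w : reC (z * w) = reC z * reC w - imC z * imC w.
Proof. by case: z; case: w. Qed.
Lemma imCM z w : imC (z * w) = reC z * imC w + imC z * reC w.
Proof. by case: z => a b; case: w. Qed.
Lemma reC1 : reC (1 : C) = 1. Proof. by []. Qed.
Lemma imC1 : imC (1 : C) = 0. Proof. by []. Qed.
Definition reimE := (reCM, imCM, reCB, imCB, reCD, imCD, reCN, imCN, reC1, imC1).

Lemma ler_reC z : `|reC z| <= nrm z.
Proof. by rewrite -ler_ofR -normCE; exact: normc_ge_Re. Qed.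

Lemma ler_imC z : `|imC z| <= nrm z.
Proof.
have -> : imC z = - reC (mkC 0 1 * z).
  by rewrite reCM /= mul0r mul1r sub0r opprK.
rewrite normrN (le_trans (ler_reC _)) // nrmM.
have -> : nrm (mkC 0 1 : C) = 1 by rewrite /nrm /= expr0n add0r expr1n sqrtr1.
by rewrite mul1r.
Qed.

Lemma nrm_le_reim z : nrm z <= `|reC z| + `|imC z|.
Proof.
have -> : z = ofR (reC z) + mkC 0 1 * ofR (imC z).
  by apply: C_eq; rewrite !reimE /=; ring.
rewrite (le_trans (nrmD _ _)) // nrmM !nrm_ofR.
have -> : nrm (mkC 0 1 : C) = 1 by rewrite /nrm /= expr0n add0r expr1n sqrtr1.
by rewrite mul1r !reimE /= !(mul0r, mul1r, mulr0, subr0, addr0, add0r, subrr).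
Qed.

Lemma is_deriveRP (f : R -> R) (x d : R) : is_derive x 1 f d ->
  forall e : R, 0 < e -> exists2 r : R, 0 < r & forall y, `|y - x| < r ->
    `|f y - f x - d * (y - x)| <= e * `|y - x|.
Proof.
move=> [fx fd] e e0.
have /cvgrPdist_lt/(_ e e0) : (fun h => h^-1 *: (f (h *: (1 : R) + x) - f x)) @ (0 : R)^' --> d.
  by rewrite -fd; exact: fx.
move=> /nbhs_normP[r /= r0 H]; exists r => // y yr.
have [->|yx] := eqVneq y x; first by rewrite !subrr mulr0 subrr normr0 mulr0.
have h0 : y - x != 0 by rewrite subr_eq0.
have := H (y - x); rewrite /= sub0r normrN => /(_ yr h0).
have -> : (y - x) *: (1 : R) + x = y by rewrite /GRing.scale /= mulr1 subrK.
rewrite /GRing.scale /= distrC => /ltW.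
rewrite -(ler_pM2r (x := `|y - x|)) ?normr_gt0 // -normrM mulrBl mulrAC mulVf //.
by rewrite mul1r.
Qed.

Lemma expCD z w : expC (z + w) = expC z * expC w.
Proof.
by apply: C_eq; rewrite !reimE /= !reimE expRD ?cosD ?sinD; ring.
Qed.

Lemma expC0 : expC 0 = 1 :> C.
Proof. by apply: C_eq; rewrite /= ?cos0 ?sin0 expR0 ?mulr1 ?mulr0. Qed.

Lemma expC_neq0 z : expC z != 0.
Proof.
apply/eqP => z0; have := expCD z (- z).
rewrite subrr expC0 z0 mul0r => /eqP; exact/negP/oner_neq0.
Qed.

Lemma nrm_expC z : nrm (expC z) = expR (reC z).
Proof.
rewrite /nrm /= !exprMn -mulrDr cos2Dsin2 mulr1 sqrtr_sqr.
by rewrite ger0_norm // expR_ge0.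
Qed.

(** [expC] is given by real functions, so its derivative at 0 is assembled from those of [expR],
    [cos] and [sin]; the functional equation then carries it to every other point. *)
Lemma expC_small (e : R) : 0 < e -> exists2 r : R, 0 < r &
  forall w, nrm w < r -> nrm (expC w - 1 - w) <= e * nrm w.
Proof.
(* The error splits into terms bounded by k, 2 k, k and 2 k times [nrm w], whence the 6; the cap at
   1 keeps [expR x] at most 2. *)
move=> e0; pose k := Num.min (e / 6) 1.
have k0 : 0 < k by rewrite lt_min ltr01 divr_gt0.
have [r1 r10 H1] := is_deriveRP (is_derive_expR 0) k0.
have [r2 r20 H2] := is_deriveRP (is_derive_cos 0) k0.
have [r3 r30 H3] := is_deriveRP (is_derive_sin 0) k0.
pose r := Num.min (Num.min r1 (k / 2)) (Num.min r2 r3).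
have r0 : 0 < r by rewrite !lt_min r10 r20 r30 divr_gt0.
exists r => // w wr.
have lex := ler_reC w; have ley := ler_imC w.
move: (wr); rewrite !lt_min => /andP[/andP[wr1 wr4] /andP[wr2 wr3]].
set x := reC w in lex *; set y := imC w in ley *.
have := H1 x; have := H2 y; have := H3 y; rewrite !subr0 sin0 cos0 expR0 oppr0 !mul0r !subr0 !addr0 !mul1r.
move=> /(_ (le_lt_trans ley wr3)) S /(_ (le_lt_trans ley wr2)) B /(_ (le_lt_trans lex wr1)) A.
have k1 : k <= 1 by rewrite ge_min lexx orbT.
have k6 : k <= e / 6 by rewrite ge_min lexx.
have ex1 : `|expR x - 1| <= k.
  have -> : expR x - 1 = (expR x - 1 - x) + x by ring.
  rewrite (le_trans (ler_normD _ _)) // (le_trans (lerD A (lexx _))) //.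
  have : k * `|x| <= 1 * `|x| by rewrite ler_wpM2r.
  by lra.
have ex2 : expR x <= 2 by move: ex1; rewrite ler_norml => /andP[_ ?]; lra.
have exp0 := expR_gt0 x.
apply: (le_trans (nrm_le_reim _)); rewrite !reimE /= -/x -/y subr0.
have -> : expR x * cos y - 1 - x = (expR x - 1 - x) + expR x * (cos y - 1) by ring.
have -> : expR x * sin y - y = (expR x - 1) * y + expR x * (sin y - y) by ring.
have n0 := nrm_ge0 w.
have T1 : `|expR x * (cos y - 1)| <= 2 * (k * nrm w).
  rewrite normrM (ger0_norm (ltW exp0)); apply: ler_pM => //.
  by rewrite (le_trans B) // ler_wpM2l // ltW.
have T2 : `|expR x * (sin y - y)| <= 2 * (k * nrm w).
  rewrite normrM (ger0_norm (ltW exp0)); apply: ler_pM => //.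
  by rewrite (le_trans S) // ler_wpM2l // ltW.
have T3 : `|(expR x - 1) * y| <= k * nrm w by rewrite normrM ler_pM.
have T4 : `|expR x - 1 - x| <= k * nrm w by rewrite (le_trans A) // ler_wpM2l // ltW.
have T5 : k * nrm w <= e / 6 * nrm w by rewrite ler_wpM2r.
have := ler_normD (expR x - 1 - x) (expR x * (cos y - 1)).
have := ler_normD ((expR x - 1) * y) (expR x * (sin y - y)).
lra.
Qed.

Lemma is_derive_expC z : is_derive z 1 (@expC R) (expC z).
Proof.
apply/is_deriveCP => e e0.
have n0 : 0 < nrm (expC z) by rewrite nrm_gt0 expC_neq0.
have [r r0 H] := expC_small (divr_gt0 e0 n0).
exists r => // w wr.
have -> : expC w - expC z - expC z * (w - z) = expC z * (expC (w - z) - 1 - (w - z)).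
  have -> : expC w = expC z * expC (w - z) by rewrite -expCD addrC subrK.
  ring.
rewrite nrmM (le_trans (ler_wpM2l (ltW n0) (H _ wr))) //.
by rewrite mulrA [nrm _ * _]mulrC divfK // gt_eqF.
Qed.

Lemma derivable_expC z : derivable (@expC R) z 1.
Proof. by have [] := is_derive_expC z. Qed.

End ComplexExponential.

(** * Liouville's theorem on the sphere *)

Section Goursat.
Context {R : realType}.
Local Notation C := (cplx R).
Local Notation mu := (@lebesgue_measure R).

(** Line integrals enter only as increments of such primitives. [lo] is the base point of the
    integral that defines one, differentiable only to the right of it. *)
Definition is_primitive (lo : R) (p P : R -> C) := forall x, lo < x ->
  is_derive x 1 (reC \o P) (reC (p x)) /\ is_derive x 1 (imC \o P) (imC (p x)).

Lemma continuous_reC (T : topologicalType) (f : T -> C) x :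
  {for x, continuous f} -> {for x, continuous (reC \o f)}.
Proof.
move=> /cvgCP H; apply/cvgrPdist_lt => e e0; apply: filterS (H e e0) => y.
by rewrite distrC -reCB; apply: le_lt_trans (ler_reC _).
Qed.

Lemma continuous_imC (T : topologicalType) (f : T -> C) x :
  {for x, continuous f} -> {for x, continuous (imC \o f)}.
Proof.
move=> /cvgCP H; apply/cvgrPdist_lt => e e0; apply: filterS (H e e0) => y.
by rewrite distrC -imCB; apply: le_lt_trans (ler_imC _).
Qed.

Lemma real_primitive (lo : R) (f : R -> R) : continuous f ->
  exists F : R -> R, forall x, lo < x -> is_derive x 1 F (f x).
Proof.
move=> cf; exists (fun x => \int[mu]_(t in [set` `[lo, x]]) f t)%R => x lox.
have xu : x < x + 1 by rewrite ltrDl.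
have fi : mu.-integrable `[lo, x + 1] (EFin \o f).
  apply: continuous_compact_integrable; first exact: segment_compact.
  exact: continuous_subspaceT.
have [d dE] := continuous_FTC1_closed xu fi lox (cf x).
by rewrite -dE derive1E; apply: DeriveDef.
Qed.

Lemma ex_primitive (lo : R) (p : R -> C) : continuous p ->
  exists P, is_primitive lo p P.
Proof.
move=> cp.
have [F HF] := @real_primitive lo _ (fun x => continuous_reC (cp x)).
have [G HG] := @real_primitive lo _ (fun x => continuous_imC (cp x)).
by exists (fun x => mkC (F x) (G x)) => x lox; split; [exact: HF|exact: HG].
Qed.

Lemma real_mean_value_bound (f df : R -> R) (a b M : R) : a <= b ->
  (forall x, a <= x <= b -> is_derive x 1 f (df x)) ->
  (forall x, a <= x <= b -> `|df x| <= M) -> `|f b - f a| <= M * (b - a).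
Proof.
move=> ab fd fM.
have [||c] := @MVT_segment R f df a b ab.
- by move=> x; rewrite in_itv /= => /andP[/ltW ? /ltW ?]; apply: fd; apply/andP.
- apply: derivable_within_continuous => x; rewrite in_itv /= => xab.
  by have [] := fd x xab.
- rewrite in_itv /= => cab ->; rewrite normrM (ger0_norm (x := b - a)) ?subr_ge0 //.
  by rewrite ler_wpM2r ?subr_ge0 // fM.
Qed.

(** The mean value inequality plays the role of length times maximum; the factor 2 comes from
    treating real and imaginary parts separately. With M = 0 it shows that increments do not depend
    on the primitive chosen. *)
Lemma primitive_dist lo (p q P Q : R -> C) (a b M : R) :
  is_primitive lo p P -> is_primitive lo q Q -> lo < a -> a <= b ->
  (forall x, a <= x <= b -> nrm (p x - q x) <= M) ->
  nrm ((P b - P a) - (Q b - Q a)) <= 2 * M * (b - a).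
Proof.
move=> HP HQ loa ab HM.
have lox x : a <= x <= b -> lo < x by move=> /andP[/(lt_le_trans loa)].
have re : `|reC ((P b - P a) - (Q b - Q a))| <= M * (b - a).
  have -> : reC ((P b - P a) - (Q b - Q a)) =
     ((reC \o P) \- (reC \o Q)) b - ((reC \o P) \- (reC \o Q)) a.
    by rewrite !reimE /=; ring.
  apply: (@real_mean_value_bound _ (fun x => reC (p x) - reC (q x))) => //.
  - move=> x xab; have [? _] := HP x (lox x xab); have [? _] := HQ x (lox x xab).
    exact: is_deriveB.
  - by move=> x xab; rewrite -reCB (le_trans (ler_reC _)) // HM.
have im : `|imC ((P b - P a) - (Q b - Q a))| <= M * (b - a).
  have -> : imC ((P b - P a) - (Q b - Q a)) =
     ((imC \o P) \- (imC \o Q)) b - ((imC \o P) \- (imC \o Q)) a.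
    by rewrite !reimE /=; ring.
  apply: (@real_mean_value_bound _ (fun x => imC (p x) - imC (q x))) => //.
  - move=> x xab; have [_ ?] := HP x (lox x xab); have [_ ?] := HQ x (lox x xab).
    exact: is_deriveB.
  - by move=> x xab; rewrite -imCB (le_trans (ler_imC _)) // HM.
by rewrite (le_trans (nrm_le_reim _)) // (le_trans (lerD re im)) //; lra.
Qed.

Lemma affine_primitive lo (c d : C) :
  is_primitive lo (fun x => c + d * ofR x) (fun x => c * ofR x + d * ofR (x ^+ 2 / 2)).
Proof.
move=> x _.
have aff (a b : R) : is_derive x 1 (fun y : R => a * y + b * (y ^+ 2 / 2)) (a + b * x).
  apply: is_derive_eq; rewrite /GRing.scale /=; lra.
split.
- have -> : reC \o (fun x => c * ofR x + d * ofR (x ^+ 2 / 2)) =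
     (fun y : R => reC c * y + reC d * (y ^+ 2 / 2)).
    by apply/funext => y; rewrite /= !reimE /=; ring.
  have -> : reC (c + d * ofR x) = reC c + reC d * x by rewrite !reimE /=; ring.
  exact: aff.
- have -> : imC \o (fun x => c * ofR x + d * ofR (x ^+ 2 / 2)) =
     (fun y : R => imC c * y + imC d * (y ^+ 2 / 2)).
    by apply/funext => y; rewrite /= !reimE /=; ring.
  have -> : imC (c + d * ofR x) = imC c + imC d * x by rewrite !reimE /=; ring.
  exact: aff.
Qed.

Lemma nested_segments (x w : nat -> R) : (forall n, 0 <= w n) ->
  (forall n, x n <= x n.+1) -> (forall n, x n.+1 + w n.+1 <= x n + w n) ->
  exists s, forall n, x n <= s <= x n + w n.
Proof.
move=> w0 xi yd.
have xm m n : (m <= n)%N -> x m <= x n.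
    elim: n => [|n IH]; first by rewrite leqn0 => /eqP ->.
    rewrite leq_eqVlt => /predU1P[->//|]; rewrite ltnS => /IH /le_trans; exact.
have ym m n : (m <= n)%N -> x n + w n <= x m + w m.
  elim: n => [|n IH]; first by rewrite leqn0 => /eqP ->.
  rewrite leq_eqVlt => /predU1P[->//|]; rewrite ltnS => /IH; exact/le_trans.
have xy m n : x m <= x n + w n.
  have [mn|/ltnW nm] := leqP m n.
    by rewrite (le_trans (xm _ _ mn)) // lerDl.
  by rewrite (le_trans _ (ym _ _ nm)) // lerDl.
have E0 : range x !=set0 by exists (x 0%N), 0%N.
have ub n : ubound (range x) (x n + w n) by move=> _ [m _ <-].
exists (sup (range x)) => n; apply/andP; split.
  apply: sup_upper_bound; last by exists n.
  by split => //; exists (x 0%N + w 0%N).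
exact: ge_sup.
Qed.

End Goursat.

(** * Goursat's theorem for rectangles *)

Section Rectangle.
Context {R : realType}.
Local Notation C := (cplx R).
Local Notation i := (mkC 0 1 : C).
Variables (lo : R) (g H V : R -> R -> C).
Hypothesis HP : forall y, is_primitive lo (fun x => g x y) (H y).
Hypothesis VP : forall x, is_primitive lo (g x) (V x).

(** The integral of [g] dz, counterclockwise, along the boundary of the rectangle with lower left
    corner (x, y), width w and height l; the factor [i] is dz / dy on the vertical sides. *)
Definition circulation (x y w l : R) : C :=
  (H y (x + w) - H y x) + i * (V (x + w) (y + l) - V (x + w) y)
  - (H (y + l) (x + w) - H (y + l) x) - i * (V x (y + l) - V x y).

Lemma nrm_i : nrm (mkC 0 1 : C) = 1.
Proof. by rewrite /nrm /= expr0n add0r expr1n sqrtr1. Qed.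

Lemma circulation_split (x y w l : R) :
  circulation x y (w + w) (l + l) =
    circulation x y w l + circulation (x + w) y w l +
    circulation x (y + l) w l + circulation (x + w) (y + l) w l.
Proof. by rewrite /circulation !addrA; ring. Qed.

(** An affine function has circulation 0, so only the distance of [g] to one counts; each horizontal
    side contributes 2 e w and each vertical side 2 e l. *)
Lemma circulation_bound (x y w l s t e : R) (d : C) :
  lo < x -> lo < y -> 0 <= w -> 0 <= l ->
  (forall s' t', x <= s' <= x + w -> y <= t' <= y + l ->
    nrm (g s' t' - g s t - d * mkC (s' - s) (t' - t)) <= e) ->
  nrm (circulation x y w l) <= 4 * e * (w + l).
Proof.
move=> lox loy w0 l0 Hd.
(* On a horizontal or vertical line the affine function g s t + d (z - (s + i t)) has degree 1 in
   the moving coordinate, with constant term [ch] or [cv] and primitive [Q]. *)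
pose ch (y : R) : C := g s t - d * ofR s + d * i * ofR (y - t).
pose cv (x : R) : C := g s t + d * ofR (x - s) - d * i * ofR t.
pose Q (c d : C) (x : R) : C := c * ofR x + d * ofR (x ^+ 2 / 2).
have hside y' : y <= y' <= y + l ->
  nrm ((H y' (x + w) - H y' x) - (Q (ch y') d (x + w) - Q (ch y') d x)) <= 2 * e * w.
  move=> yy'; have wE : x + w - x = w by ring.
  rewrite -[X in _ <= _ * X]wE.
  apply: (primitive_dist (HP y') (affine_primitive (lo := lo) (ch y') d)) => //.
    by rewrite lerDl.
  move=> x' xx'; apply: le_trans (Hd x' y' xx' yy'); rewrite le_eqVlt; apply/predU1l.
  by congr nrm; rewrite /ch; apply: C_eq; rewrite !reimE /= ?reimE /=; ring.
have vside x' : x <= x' <= x + w ->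
  nrm ((V x' (y + l) - V x' y) - (Q (cv x') (d * i) (y + l) - Q (cv x') (d * i) y)) <= 2 * e * l.
  move=> xx'; have lE : y + l - y = l by ring.
  rewrite -[X in _ <= _ * X]lE.
  apply: (primitive_dist (VP x') (affine_primitive (lo := lo) (cv x') (d * i))) => //.
    by rewrite lerDl.
  move=> y' yy'; apply: le_trans (Hd x' y' xx' yy'); rewrite le_eqVlt; apply/predU1l.
  by congr nrm; rewrite /cv; apply: C_eq; rewrite !reimE /= ?reimE /=; ring.
have -> : circulation x y w l =
  ((H y (x + w) - H y x) - (Q (ch y) d (x + w) - Q (ch y) d x))
  + i * ((V (x + w) (y + l) - V (x + w) y) - (Q (cv (x + w)) (d * i) (y + l) - Q (cv (x + w)) (d * i) y))
  - ((H (y + l) (x + w) - H (y + l) x) - (Q (ch (y + l)) d (x + w) - Q (ch (y + l)) d x))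
  - i * ((V x (y + l) - V x y) - (Q (cv x) (d * i) (y + l) - Q (cv x) (d * i) y)).
  have Q0 : Q (ch y) d (x + w) - Q (ch y) d x
    + i * (Q (cv (x + w)) (d * i) (y + l) - Q (cv (x + w)) (d * i) y)
    - (Q (ch (y + l)) d (x + w) - Q (ch (y + l)) d x)
    - i * (Q (cv x) (d * i) (y + l) - Q (cv x) (d * i) y) = 0.
    pose q (v : R) : C := ofR (v ^+ 2 / 2).
    rewrite /Q /ch /cv -!/(q _); move: q => q.
    by rewrite !ofRD !ofRN; ring.
  by rewrite -[LHS]subr0 -Q0 /circulation; ring.
have e1 := hside y; have e2 := hside (y + l); have e3 := vside x; have e4 := vside (x + w).
rewrite !lexx !lerDl ?w0 ?l0 /= in e1 e2 e3 e4.
have {e1} e1 := e1 isT; have {e2} e2 := e2 isT.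
have {e3} e3 := e3 isT; have {e4} e4 := e4 isT.
rewrite (le_trans (nrmB _ _)) // nrmM nrm_i mul1r.
rewrite (le_trans (lerD (nrmB _ _) (lexx _))) //.
rewrite (le_trans (lerD (lerD (nrmD _ _) (lexx _)) (lexx _))) // nrmM nrm_i mul1r.
lra.
Qed.

(* Quadrisection, as in the usual proof for triangles: no continuity of the
   derivative is assumed. *)
Lemma goursat (x0 y0 W L : R) : lo < x0 -> lo < y0 -> 0 <= W -> 0 <= L ->
  (forall s t, x0 <= s <= x0 + W -> y0 <= t <= y0 + L -> exists d, forall e, 0 < e ->
     exists2 r : R, 0 < r & forall s' t', `|s' - s| < r -> `|t' - t| < r ->
       nrm (g s' t' - g s t - d * mkC (s' - s) (t' - t)) <= e * (`|s' - s| + `|t' - t|)) ->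
  circulation x0 y0 W L = 0.
Proof.
move=> lox loy W0 L0 cr; apply/eqP; rewrite -nrm_eq0 eq_le nrm_ge0 andbT leNgt.
apply/negP => K0; set K := nrm _ in K0.
pose w (n : nat) : R := W / 2 ^+ n; pose l (n : nat) : R := L / 2 ^+ n.
pose P (n : nat) (p : R * R) := K / 4 ^+ n <= nrm (circulation p.1 p.2 (w n) (l n)).
have half (a : R) n : a / 2 ^+ n = a / 2 ^+ n.+1 + a / 2 ^+ n.+1.
  by rewrite exprS invfM; lra.
have w0 n : 0 <= w n by rewrite divr_ge0 // exprn_ge0.
have l0 n : 0 <= l n by rewrite divr_ge0 // exprn_ge0.
have step n p : exists q : R * R, P n p ->
  [/\ P n.+1 q, p.1 <= q.1, q.1 + w n.+1 <= p.1 + w n, p.2 <= q.2 & q.2 + l n.+1 <= p.2 + l n].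
  have [Pp|] := pselect (P n p); last by exists p.
  have wE : w n = w n.+1 + w n.+1 by exact: half.
  have lE : l n = l n.+1 + l n.+1 by exact: half.
  have ww := w0 n.+1; have ll := l0 n.+1.
  have [P1|N1] := pselect (P n.+1 (p.1, p.2)).
    by exists (p.1, p.2) => _; split => //=; lra.
  have [P2|N2] := pselect (P n.+1 (p.1 + w n.+1, p.2)).
    by exists (p.1 + w n.+1, p.2) => _; split => //=; lra.
  have [P3|N3] := pselect (P n.+1 (p.1, p.2 + l n.+1)).
    by exists (p.1, p.2 + l n.+1) => _; split => //=; lra.
  have [P4|N4] := pselect (P n.+1 (p.1 + w n.+1, p.2 + l n.+1)).
    by exists (p.1 + w n.+1, p.2 + l n.+1) => _; split => //=; lra.
  exfalso; move: Pp N1 N2 N3 N4; rewrite /P wE lE circulation_split /=.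
  move=> Pp /negP; rewrite -ltNge => N1 /negP; rewrite -ltNge => N2.
  move=> /negP; rewrite -ltNge => N3 /negP; rewrite -ltNge => N4.
  have KE : K / 4 ^+ n = 4 * (K / 4 ^+ n.+1).
    by rewrite exprS invfM mulrCA mulVKf // pnatr_eq0.
  move: Pp; apply/negP; rewrite -ltNge KE.
  rewrite (le_lt_trans (nrmD _ _)) //.
  rewrite (le_lt_trans (lerD (nrmD _ _) (lexx _))) //.
  rewrite (le_lt_trans (lerD (lerD (nrmD _ _) (lexx _)) (lexx _))) //.
  lra.
have [F HF] := choice (fun np : nat * (R * R) => step np.1 np.2).
pose c := fix c n := if n is m.+1 then F (m, c m) else (x0, y0).
have cP n : P n (c n).
  elim: n => [|n IH]; first by rewrite /P /w /l /= !expr0 !divr1.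
  by have [] := HF (n, c n) IH.
have [s Hs] := @nested_segments R (fun n => (c n).1) w w0
  (fun n => let: And5 _ a _ _ _ := HF (n, c n) (cP n) in a)
  (fun n => let: And5 _ _ a _ _ := HF (n, c n) (cP n) in a).
have [t Ht] := @nested_segments R (fun n => (c n).2) l l0
  (fun n => let: And5 _ _ _ a _ := HF (n, c n) (cP n) in a)
  (fun n => let: And5 _ _ _ _ a := HF (n, c n) (cP n) in a).
have c1 n : x0 <= (c n).1.
  by elim: n => //= n IH; have [_ /(le_trans IH)] := HF (n, c n) (cP n).
have c2 n : y0 <= (c n).2.
  by elim: n => //= n IH; have [_ _ _ /(le_trans IH)] := HF (n, c n) (cP n).
have [||d Hd] := cr s t.
- by have := Hs 0%N; rewrite /= /w expr0 divr1.
- by have := Ht 0%N; rewrite /= /l expr0 divr1.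
have S0 : 0 <= W + L by rewrite addr_ge0.
(* With this [e], 4 e (W + L)^2 is below K. The n-th rectangle has circulation at least K / 4^n, but
   half-perimeter (W + L) / 2^n, so the linear approximation at the common point bounds it by 4 e (W
   + L)^2 / 4^n: a contradiction. *)
have e0 : 0 < K / (4 * (W + L + 1) ^+ 2 + 1).
  by rewrite divr_gt0 // ltr_pwDr // mulr_ge0 // exprn_ge0 // addr_ge0.
set e := K / _ in e0; have [r r0 Hr] := Hd e e0.
have [n Hn] : exists n, (W + L + 1) / 2 ^+ n < r.
  have q0 : 0 < (W + L + 1) / r by rewrite divr_gt0 // ltr_wpDl.
  have /archi_boundP := ltW q0; set m := Num.bound _ => Hm; exists m.
  have m2 : m%:R <= 2 ^+ m :> R by rewrite -natrX ler_nat ltnW // ltn_expl.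
  have p2 : 0 < 2 ^+ m :> R by rewrite exprn_gt0.
  rewrite ltr_pdivrMr // mulrC -ltr_pdivrMr // (lt_le_trans Hm) //.
have p2 : 0 < 2 ^+ n :> R by rewrite exprn_gt0.
have wl : w n + l n < r.
  by apply: le_lt_trans Hn; rewrite /w /l -mulrDl ler_pM2r ?invr_gt0 // lerDl.
have := @circulation_bound (c n).1 (c n).2 (w n) (l n) s t (e * (w n + l n)) d
  (lt_le_trans lox (c1 n)) (lt_le_trans loy (c2 n)) (w0 n) (l0 n).
have Hsn := Hs n; have Htn := Ht n; have wn := w0 n; have ln := l0 n.
have es0 := ltW e0.
have est s' t' :
   (c n).1 <= s' <= (c n).1 + w n -> (c n).2 <= t' <= (c n).2 + l n ->
   nrm (g s' t' - g s t - d * mkC (s' - s) (t' - t)) <= e * (w n + l n).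
  move=> ss' tt'.
  have s1 : `|s' - s| <= w n by rewrite ler_norml; apply/andP; split; lra.
  have t1 : `|t' - t| <= l n by rewrite ler_norml; apply/andP; split; lra.
  apply: le_trans (Hr _ _ _ _) _; rewrite ?ler_wpM2l ?lerD //.
    by apply: le_lt_trans wl; lra.
  by apply: le_lt_trans wl; lra.
move=> /(_ est) /(le_trans (cP n)).
have -> : 4 * (e * (w n + l n)) * (w n + l n) = (4 * e * (W + L) ^+ 2) / 4 ^+ n.
  have -> : (4 : R) ^+ n = 2 ^+ n * 2 ^+ n by rewrite -exprMn; congr (_ ^+ n); lra.
  by rewrite /w /l invfM; ring.
rewrite ler_pM2r ?invr_gt0 ?exprn_gt0 // leNgt => /negP; apply.
have Q0 : 0 < 4 * (W + L + 1) ^+ 2 + 1.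
  by rewrite ltr_pwDr // mulr_ge0 // exprn_ge0 // addr_ge0.
have -> : 4 * e * (W + L) ^+ 2 = K * ((4 * (W + L) ^+ 2) / (4 * (W + L + 1) ^+ 2 + 1)).
  by rewrite /e; ring.
rewrite gtr_pMr // ltr_pdivrMr // mul1r.
have : (W + L) ^+ 2 <= (W + L + 1) ^+ 2.
  by rewrite lerXn2r ?nnegrE ?addr_ge0 // lerDl.
lra.
Qed.

End Rectangle.

(** * Integrals over circles *)

Section MeanValue.
Context {R : realType}.
Local Notation C := (cplx R).
Implicit Types (F : C -> C) (a : C) (s t : R).

(** Polar coordinates about [a] with radius e^s: a holomorphic [F] becomes holomorphic in s + i t,
    and its mean over a circle is an integral in t alone. *)
Definition circle_pt a s t : C := a + expC (mkC s t).

Lemma mkCB (x y x' y' : R) : mkC x y - mkC x' y' = mkC (x - x') (y - y').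
Proof. by []. Qed.

Lemma nrm_mkC (x y : R) : nrm (mkC x y : C) <= `|x| + `|y|.
Proof. exact: nrm_le_reim. Qed.

Lemma derivable_comp (f g : C -> C) (z : C) :
  derivable f z 1 -> derivable g (f z) 1 -> derivable (g \o f) z 1.
Proof.
move=> /derivableCP[f' df] /derivableCP[g' dg].
apply/derivableCP; exists (g' * f') => e e0.
have nf := nrm_ge0 f'; have ng := nrm_ge0 g'.
have e1 : 0 < Num.min 1 (e / (2 * (nrm g' + 1))).
  by rewrite lt_min ltr01 divr_gt0 // mulr_gt0 // ltr_wpDl.
have e2 : 0 < e / (2 * (nrm f' + 1)) by rewrite divr_gt0 // mulr_gt0 // ltr_wpDl.
have [r1 r10 H1] := df _ e1; have [r2 r20 H2] := dg _ e2.
exists (Num.min r1 (r2 / (nrm f' + 1))).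
  by rewrite lt_min r10 divr_gt0 // ltr_wpDl.
move=> w; rewrite lt_min => /andP[/H1 {}H1 wr].
have fw : nrm (f w - f z) <= (nrm f' + 1) * nrm (w - z).
  have -> : f w - f z = (f w - f z - f' * (w - z)) + f' * (w - z) by rewrite subrK.
  apply: (le_trans (nrmD _ _)); rewrite nrmM mulrDl addrC lerD //.
  by apply: (le_trans H1); rewrite ler_wpM2r ?nrm_ge0 // ge_min lexx.
have {}H2 := H2 (f w); have {}H2 := H2 (le_lt_trans fw _).
have {H2} := H2 _; rewrite mulrC -ltr_pdivlMr ?ltr_wpDl // => /(_ wr) H2.
rewrite /= (_ : _ - _ = (g (f w) - g (f z) - g' * (f w - f z)) + g' * (f w - f z - f' * (w - z))); last by ring.
apply: (le_trans (nrmD _ _)); rewrite nrmM [e]splitr mulrDl lerD //.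
  apply: (le_trans H2); apply: le_trans (ler_wpM2l (ltW e2) fw) _.
  by rewrite mulrA invfM -!mulrA (mulrA _ (_ + 1)) mulVf ?mul1r // gt_eqF // ltr_wpDl.
apply: (le_trans (ler_wpM2l ng H1)); rewrite mulrA ler_wpM2r ?nrm_ge0 //.
apply: (@le_trans _ _ (nrm g' * (e / (2 * (nrm g' + 1))))).
  by rewrite ler_wpM2l // ge_min lexx orbT.
rewrite mulrCA ler_wpM2l ?(ltW e0) // ler_pdivrMr ?mulr_gt0 // ?ltr_wpDl //; lra.
Qed.

Lemma derivable_circle a (z : C) : derivable (fun z => a + expC z) z 1.
Proof. by apply: derivableD; [exact: derivable_cst|exact: derivable_expC]. Qed.

Lemma circle_pt_linearization F a s t : derivable F (circle_pt a s t) 1 ->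
  exists d, forall e, 0 < e ->
    exists2 r : R, 0 < r & forall s' t', `|s' - s| < r -> `|t' - t| < r ->
      nrm (F (circle_pt a s' t') - F (circle_pt a s t) - d * mkC (s' - s) (t' - t))
        <= e * (`|s' - s| + `|t' - t|).
Proof.
move=> dF; have /derivableCP[d H] := derivable_comp (@derivable_circle a (mkC s t)) dF.
exists d => e e0.
have [r r0 Hr] := H e e0; exists (r / 2); first by rewrite divr_gt0.
move=> s' t' ss' tt'; have st := nrm_mkC (s' - s) (t' - t).
apply: le_trans (Hr (mkC s' t') _) _; first by rewrite mkCB; lra.
by rewrite mkCB; apply: ler_wpM2l st; exact: ltW.
Qed.

Lemma continuous_circle_pt F a : continuous F ->
  continuous (fun p : R * R => F (circle_pt a p.1 p.2)).
Proof.
move=> cF p; apply: (@continuous_comp _ _ _ (fun p : R * R => circle_pt a p.1 p.2) F);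
  last exact: cF.
apply: (@continuous_comp _ _ _ (fun p : R * R => mkC p.1 p.2 : C) (fun z => a + expC z)).
  apply/cvgCP => e e0.
  have e2 : 0 < e / 2 by rewrite divr_gt0.
  near=> q; rewrite mkCB; apply: (le_lt_trans (nrm_mkC _ _)).
  rewrite (splitr e) ltrD //.
    near: q; have /cvgrPdist_lt/(_ _ e2) : q.1 @[q --> p] --> p.1 by exact: cvg_fst.
    by apply: filterS => q; rewrite distrC.
  near: q; have /cvgrPdist_lt/(_ _ e2) : q.2 @[q --> p] --> p.2 by exact: cvg_snd.
  by apply: filterS => q; rewrite distrC.
exact/derivable_cont/derivable_circle.
Unshelve. all: by end_near. Qed.

Lemma cvg_pair_cstl s t : (s, x) @[x --> t] --> nbhs (s, t).
Proof.
move=> A [[P Q] /= [Ps Qt] sub]; apply: filterS Qt => x Qx.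
by apply: sub; split => //=; exact: nbhs_singleton.
Qed.

Lemma cvg_pair_cstr s t : (x, t) @[x --> s] --> nbhs (s, t).
Proof.
move=> A [[P Q] /= [Ps Qt] sub]; apply: filterS Ps => x Px.
by apply: sub; split => //=; exact: nbhs_singleton.
Qed.

Lemma cvg_pair_swap s t : (x.2, x.1) @[x --> (s, t)] --> nbhs (t, s).
Proof.
move=> A [[P Q] /= [Pt Qs] sub]; exists (Q, P) => //= x [Qx Px].
exact: sub.
Qed.

Lemma continuous_circle_r F a s : continuous F ->
  continuous (fun t => F (circle_pt a s t)).
Proof.
move=> cF t; have := @continuous_circle_pt F a cF (s, t).
move=> K; refine (@cvg_comp _ _ _ (fun t => (s, t)) (fun q : R * R => F (circle_pt a q.1 q.2)) (nbhs t) (nbhs (s, t)) _ _ K).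
exact: cvg_pair_cstl.
Qed.

Lemma continuous_circle_l F a t : continuous F ->
  continuous (fun s => F (circle_pt a s t)).
Proof.
move=> cF s; have := @continuous_circle_pt F a cF (s, t).
move=> K; refine (@cvg_comp _ _ _ (fun s => (s, t)) (fun q : R * R => F (circle_pt a q.1 q.2)) (nbhs s) (nbhs (s, t)) _ _ K).
exact: cvg_pair_cstr.
Qed.

(* The integral over [0, 2 pi] of F (a + e^s e^(i t)) in t, as the increment of a
   primitive. *)
Definition circle_int F a s : C :=
  let P := xget (fun=> 0) [set P | is_primitive (-1) (fun t => F (circle_pt a s t)) P] in
  P (2 * pi) - P 0.

Lemma pi2_ge0 : 0 <= 2 * pi :> R. Proof. by rewrite mulr_ge0 // pi_ge0. Qed.

(** [circle_int] selects some primitive with base point -1; since neither matters, [goursat] may be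
    used with one base point for all sides. *)
Lemma circle_intE lo P F a s : continuous F -> lo < 0 ->
  is_primitive lo (fun t => F (circle_pt a s t)) P ->
  circle_int F a s = P (2 * pi) - P 0.
Proof.
move=> cF lo0 HP; rewrite /circle_int.
have /(xgetPex (fun=> 0)) := ex_primitive (-1) (@continuous_circle_r F a s cF).
set Q := xget _ _ => HQ.
have weaken l' p : l' <= Num.max lo (-1) -> is_primitive l' (fun t => F (circle_pt a s t)) p ->
  is_primitive (Num.max lo (-1)) (fun t => F (circle_pt a s t)) p.
  by move=> ll H x /(le_lt_trans ll); exact: H.
apply/eqP; rewrite -subr_eq0 -nrm_eq0 eq_le nrm_ge0 andbT.
have := @primitive_dist R (Num.max lo (-1)) _ _ Q P 0 (2 * pi) 0.
rewrite mulr0 mul0r; apply.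
- by apply: weaken HQ; rewrite le_max lexx orbT.
- by apply: weaken HP; rewrite le_max lexx.
- by rewrite gt_max lo0; lra.
- exact: pi2_ge0.
- by move=> x _; rewrite subrr nrm0.
Qed.

Lemma circle_int_dist F a s G b s' M : continuous F -> continuous G ->
  (forall t, 0 <= t <= 2 * pi ->
    nrm (F (circle_pt a s t) - G (circle_pt b s' t)) <= M) ->
  nrm (circle_int F a s - circle_int G b s') <= 2 * M * (2 * pi).
Proof.
move=> cF cG HM; rewrite -[X in _ <= _ * X]subr0.
have [P HP] := ex_primitive (-1) (@continuous_circle_r F a s cF).
have [Q HQ] := ex_primitive (-1) (@continuous_circle_r G b s' cG).
rewrite (circle_intE cF _ HP) ?(circle_intE cG _ HQ); [|lra|lra].
apply: primitive_dist HP HQ _ pi2_ge0 HM; lra.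
Qed.

Lemma circle_int_cst c a s : circle_int (fun=> c) a s = c * ofR (2 * pi).
Proof.
have := @affine_primitive R (-1) c 0.
have -> : (fun x : R => c + 0 * ofR x) = (fun x => c) by apply/funext => x; rewrite mul0r addr0.
move=> H; rewrite (@circle_intE _ _ (fun=> c) a s _ _ H).
- by rewrite !mul0r ofR0 mulr0 !addr0 subr0.
- exact: cst_continuous.
- lra.
Qed.

(* Goursat on a rectangle in the logarithmic coordinate s + i t: the two
   horizontal sides cancel because exp is 2 pi i periodic. *)
Lemma circle_int_const F a s1 s2 : continuous F -> s1 < s2 ->
  (forall s t, s1 <= s <= s2 -> 0 <= t <= 2 * pi -> derivable F (circle_pt a s t) 1) ->
  circle_int F a s1 = circle_int F a s2.
Proof.
move=> cF s12 dF; pose lo := Num.min s1 0 - 1.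
have lo1 : lo < s1.
  have : Num.min s1 0 <= s1 by rewrite ge_min lexx.
  rewrite /lo; lra.
have lo0 : lo < 0.
  have : Num.min s1 0 <= 0 :> R by rewrite ge_min lexx orbT.
  rewrite /lo; lra.
have [V HV] := choice (fun s => ex_primitive lo (@continuous_circle_r F a s cF)).
have [H HH] := choice (fun t => ex_primitive lo (@continuous_circle_l F a t cF)).
have periodic : (fun s => F (circle_pt a s (2 * pi))) = (fun s => F (circle_pt a s 0)).
  apply/funext => s; rewrite /circle_pt /expC /=.
  by rewrite mulr_natl cos2pi sin2pi cos0 sin0.
have Hper : H (2 * pi) s2 - H (2 * pi) s1 = H 0 s2 - H 0 s1.
  apply/eqP; rewrite -subr_eq0 -nrm_eq0 eq_le nrm_ge0 andbT.
  have HH2 := HH (2 * pi); rewrite periodic in HH2.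
  have := primitive_dist (M := 0) HH2 (HH 0) lo1 (ltW s12).
  by rewrite mulr0 mul0r; apply => x _; rewrite subrr nrm0.
have W0 : 0 <= s2 - s1 by rewrite subr_ge0 ltW.
have := goursat HH HV lo1 lo0 W0 pi2_ge0.
rewrite /circulation !add0r [s1 + _]addrC subrK Hper.
rewrite (circle_intE cF lo0 (HV s1)) (circle_intE cF lo0 (HV s2)) => G.
have /eqP : mkC 0 1 * ((V s2 (2 * pi) - V s2 0) - (V s1 (2 * pi) - V s1 0)) = 0 :> C.
  rewrite -[RHS]G; first by ring.
  by move=> s t ss tt; apply: circle_pt_linearization; exact: dF.
by rewrite mulf_eq0 -nrm_eq0 nrm_i oner_eq0 /= subr_eq0 => /eqP ->.
Qed.

(** The tube lemma for the compact segment of angles. *)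
Lemma circle_near s0 (P : R -> R -> Prop) :
  (forall t, \forall q \near (t, s0), P q.2 q.1) ->
  \forall s \near s0, forall t, 0 <= t <= 2 * pi -> P s t.
Proof.
move=> H.
have K := (compact_near_coveringP _).1 (@segment_compact R 0 (2 * pi))
  R (nbhs s0) P _ (fun t _ => H t).
near=> s => t t2.
have : `[0, 2 * pi] `<=` P s by near: s; exact: K.
by apply; rewrite /= in_itv.
Unshelve. all: by end_near. Qed.

Lemma circle_int_continuous F a : continuous F ->
  forall s0 e, 0 < e -> \forall s \near s0, nrm (circle_int F a s - circle_int F a s0) < e.
Proof.
move=> cF s0 e e0.
have p0 := pi2_ge0; set p := 2 * pi in p0.
have d0 : 0 < e / (2 * (p + 1)) by rewrite divr_gt0 // mulr_gt0 // ltr_wpDl.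
set d := e / _ in d0.
have H :
    forall t, \forall q \near (t, s0), nrm (F (circle_pt a q.2 q.1) - F (circle_pt a s0 q.1)) < d.
  move=> t.
  have d20 : 0 < d / 2 by rewrite divr_gt0.
  have c1 : F (circle_pt a q.2 q.1) @[q --> (t, s0)] --> F (circle_pt a s0 t).
    have := @continuous_circle_pt F a cF (s0, t).
    move=> K; refine (@cvg_comp _ _ _ (fun q : R * R => (q.2, q.1)) (fun q : R * R => F (circle_pt a q.1 q.2)) (nbhs (t, s0)) (nbhs (s0, t)) _ _ K).
    exact: cvg_pair_swap.
  have c2 : F (circle_pt a s0 q.1) @[q --> (t, s0)] --> F (circle_pt a s0 t).
    have := @continuous_circle_r F a s0 cF t.
    move=> K; refine (@cvg_comp _ _ _ (fun q : R * R => q.1) (fun t => F (circle_pt a s0 t)) (nbhs (t, s0)) (nbhs t) _ _ K).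
    exact: cvg_fst.
  move/cvgCP : c1 => /(_ _ d20) c1; move/cvgCP : c2 => /(_ _ d20) c2.
  near=> q.
  have -> : F (circle_pt a q.2 q.1) - F (circle_pt a s0 q.1) =
    (F (circle_pt a q.2 q.1) - F (circle_pt a s0 t)) - (F (circle_pt a s0 q.1) - F (circle_pt a s0 t)) by ring.
  apply: (le_lt_trans (nrmB _ _)); rewrite (splitr d) ltrD //.
    by near: q.
  by near: q.
have := @circle_near s0 (fun s t => nrm (F (circle_pt a s t) - F (circle_pt a s0 t)) < d) H.
apply: filterS => s Hs.
apply: (@le_lt_trans _ _ (2 * d * p)).
  by apply: circle_int_dist => // t /Hs/ltW.
rewrite /d -mulrA mulrCA -[ltRHS]mulr1.
rewrite [X in X < _](_ : _ = e * (p / (p + 1))); last first.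
  by rewrite invfM; field; rewrite gt_eqF // ltr_wpDl.
by rewrite ltr_pM2l // ltr_pdivrMr ?mul1r ?ltrDl // ltr_wpDl.
Unshelve. all: by end_near. Qed.

End MeanValue.

(** * Liouville's theorem across exceptional points *)

Section Liouville.
Context {R : realType}.
Local Notation C := (cplx R).
Implicit Types (F : C -> C) (a L z w : C).

Lemma nrm_circle_pt a s t : nrm (circle_pt a s t - a) = expR s :> R.
Proof. by rewrite /circle_pt addrAC subrr add0r nrm_expC. Qed.

Lemma near_dnbhs_near a (P : set C) :
  (\forall z \near a^', P z) -> \forall z \near a^', \forall z' \near z, P z'.
Proof.
move=> /dnbhsCP[d d0 H]; apply/dnbhsCP; exists d => // z za zd.
have e0 : 0 < Num.min (nrm (z - a)) (d - nrm (z - a)).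
  by rewrite lt_min nrm_gt0 subr_eq0 za subr_gt0.
apply/nbhsCP; exists (Num.min (nrm (z - a)) (d - nrm (z - a))) => // w.
rewrite lt_min => /andP[w1 w2]; apply: H.
  by apply: contraTneq w1 => ->; rewrite nrm_distC ltxx.
have -> : w - a = (w - z) + (z - a) by rewrite addrA subrK.
by apply: (le_lt_trans (nrmD _ _)); rewrite -ltrBrDr.
Qed.

Section ContinuousExtension.
Variable F : C -> C.
Hypothesis cF : continuous F.
Hypothesis dF : forall a, \forall z \near a^', derivable F z 1.

(* The circle of log-radius s0 may meet exceptional points, but by compactness
   nearby circles do not; continuity in s then bridges s0. *)
Lemma circle_int_locally_const a (s0 : R) :
  \forall s \near s0, circle_int F a s = circle_int F a s0.
Proof.
have H (t : R) : \forall q \near (t, s0), q.2 != s0 -> derivable F (circle_pt a q.2 q.1) 1.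
  have c : circle_pt a q.2 q.1 @[q --> (t, s0)] --> circle_pt a s0 t.
    refine (@cvg_comp _ _ _ (fun q : R * R => (q.2, q.1)) (fun q => circle_pt a q.1 q.2)
      (nbhs (t, s0)) (nbhs (s0, t)) _ (@cvg_pair_swap _ _ _) _).
    exact: (@continuous_circle_pt R id a (fun=> cvg_id) (s0, t)).
  have /dnbhsCP[d d0 Hd] := dF (circle_pt a s0 t).
  near=> q => qs; apply: Hd; last by near: q; exact: ((cvgCP _ _ _).1 c d d0).
  apply: contra_neq qs => qE; apply: expR_inj.
  by rewrite -(nrm_circle_pt a q.2 q.1) -(nrm_circle_pt a s0 t) qE.
have := @circle_near R s0 (fun s t => s != s0 -> derivable F (circle_pt a s t) 1) H.
move=> /nbhs_normP[d /= d0 Hd].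
have good s t : `|s0 - s| < d -> s != s0 -> 0 <= t <= 2 * pi -> derivable F (circle_pt a s t) 1.
  by move=> sd ss t2; apply: Hd.
apply/nbhs_normP; exists d => // s /= sd.
apply/eqP; rewrite -subr_eq0 -nrm_eq0 eq_le nrm_ge0 andbT; apply/ler_addgt0Pl => e e0.
rewrite addr0.
have /nbhs_normP[r /= r0 Hr] := circle_int_continuous a cF s0 e0.
have [->|ss] := eqVneq s s0; first by rewrite subrr nrm0 ltW.
have sp : 0 < `|s0 - s| by rewrite normr_gt0 subr_eq0 eq_sym.
(* The radius s0 - m or s0 + m lies strictly between s0 and s, and close enough to s0 for the
   integral to be within e of its value there. *)
pose m := Num.min r `|s0 - s| / 2.
have m0 : 0 < m by rewrite divr_gt0 // lt_min r0 sp.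
have mr : m < r by rewrite /m ltr_pdivrMr // mulr_natr gt_min mulr2n ltrDl r0.
have ms : m < `|s0 - s|.
  by rewrite /m ltr_pdivrMr // mulr_natr gt_min mulr2n [X in _ || X]ltrDl sp orbT.
have [slt|sgt] := ltP s s0.
- have sE : `|s0 - s| = s0 - s by rewrite gtr0_norm // subr_gt0.
  rewrite (@circle_int_const R F a s (s0 - m) cF).
  + by apply/ltW/Hr; rewrite /= opprB addrCA subrr addr0 gtr0_norm.
  + by rewrite sE in ms; lra.
  + move=> x t /andP[sx xs]; apply: good.
      by rewrite sE in sd; rewrite ger0_norm; lra.
    by rewrite lt_eqF //; lra.
- have {}sgt : s0 < s by rewrite lt_neqAle eq_sym ss.
  have sE : `|s0 - s| = s - s0 by rewrite distrC gtr0_norm // subr_gt0.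
  rewrite -(@circle_int_const R F a (s0 + m) s cF).
  + by apply/ltW/Hr; rewrite /= opprD addNKr normrN gtr0_norm.
  + by rewrite sE in ms; lra.
  + move=> x t /andP[sx xs]; apply: good.
      by rewrite sE in sd; rewrite distrC ger0_norm; lra.
    by rewrite gt_eqF //; lra.
Unshelve. all: by end_near. Qed.

(** A locally constant function on the line has derivative 0, hence is constant. *)
Lemma circle_int_cst_radius a (s s' : R) : circle_int F a s = circle_int F a s'.
Proof.
have K (f : R -> R) : (forall x, \forall y \near x, f y = f x) -> f s = f s'.
  move=> H; apply: is_derive_0_is_cst => x.
  refine (@near_eq_is_derive R R R (cst (f x)) f x 1 0 _ (is_derive_cst _ _ _)).
  by apply: filterS (H x) => y ->.
by apply: C_eq; [apply: (K (reC \o circle_int F a)) | apply: (K (imC \o circle_int F a))] => x;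
  apply: filterS (circle_int_locally_const a x) => y /= ->.
Qed.

(** The mean over a small circle is close to [F a] by continuity, the mean over a large one is close
    to [L], and the two means coincide. *)
Lemma liouville_continuous L :
  F w^-1 @[w --> (0 : C)^'] --> L -> forall a, F a = L.
Proof.
move=> /cvgCP FL a; apply/eqP; rewrite -subr_eq0 -nrm_eq0 eq_le nrm_ge0 andbT.
apply/ler_addgt0Pl => e' e'0; rewrite addr0.
pose e := e' / 4; have e0 : 0 < e by rewrite divr_gt0.
have [d d0 Hd] := (nbhsCP _ _).1 ((cvgCP _ _ _).1 (@cF a) e e0).
have /dnbhsCP[r r0 Hr] := FL e e0.
have p0 : 0 < 2 * pi :> R by rewrite mulr_gt0 // pi_gt0.
have B1 : nrm (circle_int F a (ln (d / 2)) - F a * ofR (2 * pi)) <= 2 * e * (2 * pi).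
  rewrite -(circle_int_cst (F a) a (ln (d / 2))).
  apply: (@circle_int_dist R F a _ (fun=> F a)); [exact: cF|exact: cst_continuous|].
  move=> t _; apply/ltW/Hd; rewrite nrm_circle_pt lnK ?posrE ?divr_gt0 //.
  by rewrite ltr_pdivrMr // ltr_pMr // ltr1n.
(* On the circle of radius rho about a, the modulus of z exceeds 1 / r, so that 1 / z falls where
   [F] is within e of [L]. *)
pose rho := nrm a + r^-1 + 1.
have rho0 : 0 < rho by rewrite ltr_wpDl // addr_ge0 ?nrm_ge0 // invr_ge0 ltW.
have B2 : nrm (circle_int F a (ln rho) - L * ofR (2 * pi)) <= 2 * e * (2 * pi).
  rewrite -(circle_int_cst L a (ln rho)).
  apply: (@circle_int_dist R F a _ (fun=> L)); [exact: cF|exact: cst_continuous|].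
  move=> t _; set z := circle_pt a (ln rho) t.
  have zr : r^-1 < nrm z.
    have : nrm (z - a) <= nrm z + nrm a by exact: nrmB.
    by rewrite nrm_circle_pt lnK ?posrE // /rho; lra.
  have z0 : z != 0 by rewrite -nrm_gt0 (lt_trans _ zr) // invr_gt0.
  apply/ltW; rewrite -[z]invrK; apply: Hr; first by rewrite invr_eq0.
  by rewrite subr0 nrmV invf_plt // posrE ?nrm_gt0.
have : nrm ((F a - L) * ofR (2 * pi)) <= e' * (2 * pi).
  rewrite (circle_int_cst_radius a _ (ln rho)) in B1.
  have -> : (F a - L) * ofR (2 * pi) = (circle_int F a (ln rho) - L * ofR (2 * pi))
     - (circle_int F a (ln rho) - F a * ofR (2 * pi)) by ring.
  apply: (le_trans (nrmB _ _)); apply: (le_trans (lerD B2 B1)); rewrite /e; lra.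
by rewrite nrmM nrm_ofR gtr0_norm // ler_pM2r.
Qed.

End ContinuousExtension.

(** Replacing [F] by its limits gives a continuous [G], which agrees with [F] around every point of
    a punctured neighbourhood of any given point and is differentiable there. *)
Lemma liouville F L :
  (forall a, cvg (F z @[z --> a^'])) ->
  (forall a, \forall z \near a^', derivable F z 1) ->
  F w^-1 @[w --> (0 : C)^'] --> L ->
  forall a, F z @[z --> a^'] --> L.
Proof.
move=> cF dF FL a.
pose G (z : C) : C := lim (F w @[w --> z^']).
have FG z : F w @[w --> z^'] --> G z by exact: cF.
have GE z : derivable F z 1 -> G z = F z.
  move=> /derivable_cont cz; exact/cvgC_lim/continuous_dnbhs.
have Gnear z : \forall w \near z^', \forall w' \near w, F w' = G w'.
  near=> w; have dw : \forall w' \near w, derivable F w' 1.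
    by near: w; exact: near_dnbhs_near (dF z).
  near=> w'; apply/esym/GE; near: w'; exact: dw.
have cG : continuous G.
  move=> z; apply: (@cvgCP _ _ (nbhs z) _ G (G z)).2 => e e0; apply: (nbhsCP z _).2.
  have /dnbhsCP[d d0 Hd] : \forall w \near z^', nrm (G w - G z) < e.
    near=> w; suff <- : F w = G w by near: w; exact: ((cvgCP _ _ _).1 (FG z) e e0).
    have : \forall w' \near w, F w' = G w' by near: w; exact: Gnear.
    by move=> /nbhs_singleton.
  exists d => // w wd; have [->|wz] := eqVneq w z; first by rewrite subrr nrm0.
  exact: Hd.
have dG z : \forall w \near z^', derivable G w 1.
  near=> w; have FGw : \forall w' \near w, F w' = G w' by near: w; exact: Gnear.
  apply: (@near_eq_derivable _ _ _ F G w 1 FGw).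
  by near: w; exact: dF.
suff <- : G a = L by exact: FG.
apply: (liouville_continuous cG dG); apply/cvgCP => e e0.
have e2 : 0 < e / 2 by rewrite divr_gt0.
(* Exceptional points may accumulate at infinity, so [G w^-1] need not be [F w^-1]; it is
   approximated by values of [F] at nearby points. *)
have HL := near_dnbhs_near ((cvgCP _ _ _).1 FL _ e2).
have n0 : \forall w \near (0 : C)^', w != 0 by apply/dnbhsCP; exists 1.
near=> w; have w0 : w != 0 by near: w; exact: n0.
have Hw : \forall z \near w, nrm (F z^-1 - L) < e / 2 by near: w; exact: HL.
have Hw' : \forall z \near w^-1^', nrm (F z - L) < e / 2.
  have c : z^-1 @[z --> w^-1] --> w.
    have /derivable_cont : derivable (fun z : C => z^-1) w^-1 1.
      by apply: (@derivableV C C id); [exact: invr_neq0|exact: derivable_id].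
    by rewrite /prop_for /continuous_at invrK.
  apply: cvg_within; near=> z; rewrite -[z]invrK; near: z; exact: (c _ Hw).
have [z [H1 H2]] := filter_ex (filterI Hw' ((cvgCP _ _ _).1 (FG w^-1) _ e2)).
have -> : G w^-1 - L = (F z - L) - (F z - G w^-1) by ring.
by apply: (le_lt_trans (nrmB _ _)); rewrite [e]splitr ltrD.
Unshelve. all: by end_near. Qed.

End Liouville.

(** * Residues on the sphere *)

Section ResidueTheorem.
Context {R : realType}.
Local Notation C := (cplx R).
Implicit Types (f g F : C -> C) (a c z w t r : C).

Lemma derC_cst c z : derivable (fun _ : C => c) z 1.
Proof. exact: derivable_cst. Qed.
Lemma derC_id z : derivable (fun x : C => x) z 1.
Proof. exact: derivable_id. Qed.
Lemma derC_D f g z : derivable f z 1 -> derivable g z 1 ->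
  derivable (fun x => f x + g x) z 1.
Proof. exact: derivableD. Qed.
Lemma derC_N f z : derivable f z 1 -> derivable (fun x => - f x) z 1.
Proof. exact: derivableN. Qed.
Lemma derC_B f g z : derivable f z 1 -> derivable g z 1 ->
  derivable (fun x => f x - g x) z 1.
Proof. exact: derivableB. Qed.
Lemma derC_M f g z : derivable f z 1 -> derivable g z 1 ->
  derivable (fun x => f x * g x) z 1.
Proof. exact: derivableM. Qed.
Lemma derC_V f z : f z != 0 -> derivable f z 1 -> derivable (fun x => (f x)^-1) z 1.
Proof. exact: derivableV. Qed.
Lemma derC_X f n z : derivable f z 1 -> derivable (fun x => f x ^+ n) z 1.
Proof.
move=> df; elim: n => [|n IH].
  have -> : (fun x => f x ^+ 0) = (fun=> 1) by apply/funext => x; rewrite expr0.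
  exact: derC_cst.
have -> : (fun x => f x ^+ n.+1) = (fun x => f x * f x ^+ n).
  by apply/funext => x; rewrite exprS.
exact: derC_M.
Qed.
Lemma derC_sum (I : Type) (s : seq I) (P : pred I) (f : I -> C -> C) z :
  (forall i, P i -> derivable (f i) z 1) ->
  derivable (fun x => \sum_(i <- s | P i) f i x) z 1.
Proof.
move=> H; elim: s => [|i s IH].
  have -> : (fun x : C => \sum_(i <- [::] | P i) f i x) = (fun=> 0).
    by apply/funext => x; rewrite big_nil.
  exact: derC_cst.
have -> : (fun x : C => \sum_(j <- i :: s | P j) f j x) =
    (fun x => (if P i then f i x else 0) + \sum_(j <- s | P j) f j x).
  by apply/funext => x; rewrite big_cons; case: ifP; rewrite ?add0r.
apply: derC_D; last exact: IH.
case Pi : (P i); first exact: H.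
exact: derC_cst.
Qed.

Lemma dnbhs_shift a (P : set C) :
  (\forall t \near (0 : C)^', P (a + t)) <-> \forall z \near a^', P z.
Proof.
split=> /(dnbhsCP _ _).1[d d0 H]; apply: (dnbhsCP _ _).2; exists d => //.
  move=> z za zd; rewrite -(subrK a z) addrC; apply: H; rewrite ?subr_eq0 //.
  by rewrite subr0.
move=> t t0; rewrite subr0 => td; apply: H; last by rewrite addrAC subrr add0r.
by rewrite -subr_eq0 addrAC subrr add0r.
Qed.

Lemma cvg_dnbhs_shift a f (l : C) :
  f (a + t) @[t --> (0 : C)^'] --> l <-> f z @[z --> a^'] --> l.
Proof.
have K e := dnbhs_shift a (fun z => nrm (f z - l) < e).
split=> /(cvgCP _ _ _).1 H; apply: (cvgCP _ _ _).2 => e e0.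
  exact: (K e).1 (H e e0).
exact: (K e).2 (H e e0).
Qed.

Lemma derivable_shift a f t : derivable f (a + t) 1 <-> derivable (fun t => f (a + t)) t 1.
Proof.
split=> H.
  apply: (@derivable_comp R (fun t => a + t) f); last exact: H.
  by apply: derC_D; [exact: derC_cst|exact: derC_id].
have -> : f = (fun t => f (a + t)) \o (fun z => z - a).
  by apply/funext => z /=; rewrite addrC subrK.
apply: derivable_comp; first by apply: derC_B; [exact: derC_id|exact: derC_cst].
by rewrite addrAC subrr add0r.
Qed.

(** The residue may be 0, so regular points are included and all points of the plane can be treated
    alike. *)
Definition simple_pole f a r := exists g, [/\ holomorphic_at g 0, g 0 = r
  & \forall t \near (0 : C)^', f (a + t) = g t / t].

Lemma dnbhs0_neq0 : \forall t \near (0 : C)^', t != 0.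
Proof. by apply/dnbhsCP; exists 1. Qed.

Lemma simple_pole_derivable f a r : simple_pole f a r ->
  \forall z \near a^', derivable f z 1.
Proof.
move=> [g [hg _ fg]]; apply: (dnbhs_shift a (fun z => derivable f z 1)).1.
have fg' := near_dnbhs_near fg.
near=> t; apply: (derivable_shift a f t).2.
have t0 : t != 0 by near: t; exact: dnbhs0_neq0.
have fgt : \forall x \near t, f (a + x) = g x / x by near: t; exact: fg'.
have dgt : derivable g t 1 by near: t; exact: cvg_within hg.
apply: (@near_eq_derivable _ _ _ (fun t => g t / t) (fun t => f (a + t)) t 1).
  by apply: filterS fgt => x ->.
apply: derC_M; first exact: dgt.
by apply: derC_V; [exact: t0|exact: derC_id].
Unshelve. all: by end_near. Qed.

(** Once the principal part is removed, the difference quotient of g at 0 remains. *)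
Lemma simple_pole_cvg f a r : simple_pole f a r ->
  cvg (f z - r / (z - a) @[z --> a^']).
Proof.
move=> [g [hg g0 fg]].
have dg : derivable g 0 1 := nbhs_singleton hg.
have gq : (fun h => h^-1 *: (g (h *: (1 : C) + 0) - g 0)) @ (0 : C)^' --> 'D_1 g 0 by exact: dg.
apply: (cvg_ex _).2; exists ('D_1 g 0).
apply: (cvg_dnbhs_shift a (fun z => f z - r / (z - a)) _).1.
apply: (cvgC_near_eq _ gq); near=> t.
have -> : f (a + t) = g t / t by near: t; exact: fg.
by rewrite [a + t - a]addrAC subrr add0r /GRing.scale /= mulr1 addr0 g0 mulrBr mulrC [_ * r]mulrC.
Unshelve. all: by end_near. Qed.

Lemma cvg_frac (e a c : C) : a != e -> c / (z - e) @[z --> a^'] --> c / (a - e).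
Proof.
move=> ae; have : derivable (fun z : C => c / (z - e)) a 1.
  apply: derC_M; first exact: derC_cst.
  by apply: derC_V; [rewrite subr_eq0|apply: derC_B; [exact: derC_id|exact: derC_cst]].
by move=> /derivable_cont/continuous_dnbhs.
Qed.

Lemma cvg_big_sum (T I : Type) (F : set_system T) {FF : Filter F} (s : seq I) (P : pred I)
  (f : I -> T -> C) (l : I -> C) :
  (forall i, P i -> f i x @[x --> F] --> l i) ->
  \sum_(i <- s | P i) f i x @[x --> F] --> \sum_(i <- s | P i) l i.
Proof.
move=> H; elim: s => [|i s IH].
  rewrite big_nil; under eq_fun do rewrite big_nil; exact: cvg_cst.
rewrite big_cons; under eq_fun do rewrite big_cons.
case Pi : (P i); last exact: IH.
by apply: cvgD; [exact: H|exact: IH].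
Qed.

(** * Partial fractions and the sum of the residues *)

Section PartialFractions.
Variables (f : C -> C) (rho : C -> C) (E : seq C).
Hypothesis uE : uniq E.
Hypothesis rhoE : forall a, a \notin E -> rho a = 0.
Hypothesis fE : forall a, simple_pole f a (rho a).

Let S z := \sum_(e <- E) rho e / (z - e).

Lemma principal_partE a z : S z - rho a / (z - a) =
  \sum_(e <- E | e != a) rho e / (z - e).
Proof.
have [aE|aE] := boolP (a \in E).
  by rewrite /S (bigD1_seq a) //= addrAC subrr add0r.
rewrite rhoE // mul0r subr0 /S big_seq [RHS]big_seq_cond; apply: eq_bigl => e.
by case: eqVneq => [->|_]; rewrite ?(negbTE aE) ?andbT.
Qed.

Lemma regular_part_cvg a : cvg (f z - S z @[z --> a^']).
Proof.
have /cvg_ex[l Hl] := simple_pole_cvg (fE a).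
apply: (cvg_ex _).2; exists (l - \sum_(e <- E | e != a) rho e / (a - e)).
have -> : (fun z => f z - S z) =
   (fun z => (f z - rho a / (z - a)) - \sum_(e <- E | e != a) rho e / (z - e)).
  by apply/funext => z; rewrite -principal_partE; ring.
apply: cvgB; first exact: Hl.
by apply: cvg_big_sum => e ea; apply: cvg_frac; rewrite eq_sym.
Qed.

Lemma derivable_principal_part z : z \notin E -> derivable S z 1.
Proof.
move=> zE; have -> : S = (fun x => \sum_(e <- E | e != z) rho e / (x - e)).
  apply/funext => x; rewrite /S big_seq [RHS]big_seq_cond; apply: eq_bigl => e.
  by case: eqVneq => [->|_]; rewrite ?(negbTE zE) ?andbT.
apply: derC_sum => e ez; apply: derC_M; first exact: derC_cst.
apply: derC_V; first by rewrite subr_eq0 eq_sym.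
by apply: derC_B; [exact: derC_id|exact: derC_cst].
Qed.

Lemma regular_part_derivable a : \forall z \near a^', derivable (fun z => f z - S z) z 1.
Proof.
near=> z; apply: derC_B; first by near: z; exact: simple_pole_derivable (fE a).
have zE : z \notin E.
  near: z; elim: (E) => [|e s IH]; first by apply: nearW.
  near=> z; rewrite in_cons negb_or; apply/andP; split; last by near: z.
  near: z; apply/dnbhsCP; have [->|ae] := eqVneq a e; first by exists 1.
  exists (nrm (e - a)); first by rewrite nrm_gt0 subr_eq0 eq_sym.
  by move=> w _; apply: contraTneq => ->; rewrite ltxx.
exact: derivable_principal_part zE.
Unshelve. all: by end_near. Qed.

(** With z = 1 / w, the term z rho_e / (z - e) is rho_e / (1 - e w), which is regular at w = 0. *)
Lemma cvg_principal_part_inv :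
  w^-1 * S w^-1 @[w --> (0 : C)^'] --> \sum_(e <- E) rho e.
Proof.
have H (e : C) : rho e * (1 - e * w)^-1 @[w --> (0 : C)^'] --> rho e.
  have d : derivable (fun w => rho e * (1 - e * w)^-1) 0 1.
    apply: derC_M; first exact: derC_cst.
    apply: derC_V; first by rewrite mulr0 subr0 oner_neq0.
    apply: derC_B; first exact: derC_cst.
    by apply: derC_M; [exact: derC_cst|exact: derC_id].
  have := continuous_dnbhs (derivable_cont d).
  by rewrite mulr0 subr0 invr1 mulr1.
have K : \sum_(e <- E) rho e * (1 - e * w)^-1 @[w --> (0 : C)^'] --> \sum_(e <- E) rho e.
  by apply: cvg_big_sum => e _; exact: H.
refine (cvgC_near_eq _ K); near=> w.
have w0 : w != 0 by near: w; exact: dnbhs0_neq0.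
rewrite /S mulr_sumr; apply: eq_bigr => e _.
have -> : 1 - e * w = w * (w^-1 - e) by rewrite mulrBr divff // [w * e]mulrC.
by rewrite invfM mulrCA mulrA.
Unshelve. all: by end_near. Qed.

(** [f - S] has a limit at every point, and tends to [c] at infinity because [S] vanishes there;
    Liouville makes it constant. *)
Lemma partial_fractions c : f w^-1 @[w --> (0 : C)^'] --> c ->
  forall a, a \notin E -> {for a, continuous f} -> f a = c + S a.
Proof.
move=> fc a aE ca.
have inf : f w^-1 - S w^-1 @[w --> (0 : C)^'] --> c.
  rewrite -[X in _ --> X]subr0; apply: cvgB; first exact: fc.
  have K : w * (w^-1 * S w^-1) @[w --> (0 : C)^'] --> 0.
    rewrite -[X in _ --> X](mul0r (\sum_(e <- E) rho e)).
    by apply: cvgM; [exact: cvg_within|exact: cvg_principal_part_inv].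
  refine (cvgC_near_eq _ K); near=> w.
  have w0 : w != 0 by near: w; exact: dnbhs0_neq0.
  by rewrite /= mulrA divff ?mul1r.
have := liouville regular_part_cvg regular_part_derivable inf a.
have dS : {for a, continuous S} by exact/derivable_cont/derivable_principal_part.
have /continuous_dnbhs : {for a, continuous (fun z => f z - S z)}.
  by apply: continuousB; [exact: ca|exact: dS].
move=> H1 H2; have /eqP : f a - S a = c by exact: (cvgC_unique H1 H2).
by rewrite subr_eq => /eqP.
Unshelve. all: by end_near. Qed.

(* The function z (f z - S z) has no poles, vanishes at 0, and tends to
   r minus the sum of the residues at infinity. *)
Lemma residue_theorem r : w^-1 * f w^-1 @[w --> (0 : C)^'] --> r ->
  \sum_(e <- E) rho e = r.
Proof.
move=> fr; pose g z := z * (f z - S z).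
have g_cvg a : cvg (g z @[z --> a^']).
  have /cvg_ex[l Hl] := @regular_part_cvg a.
  by apply: (cvg_ex _).2; exists (a * l); apply: cvgM; [exact: cvg_within|exact: Hl].
have g_der a : \forall z \near a^', derivable g z 1.
  apply: filterS (regular_part_derivable a) => z dz.
  by apply: derC_M dz; exact: derC_id.
have inf : g w^-1 @[w --> (0 : C)^'] --> r - \sum_(e <- E) rho e.
  have K : w^-1 * f w^-1 - w^-1 * S w^-1 @[w --> (0 : C)^'] --> r - \sum_(e <- E) rho e.
    by apply: cvgB; [exact: fr|exact: cvg_principal_part_inv].
  refine (cvgC_near_eq _ K); near=> w.
  by rewrite /g /= mulrBr.
have H1 := liouville g_cvg g_der inf 0.
have /cvg_ex[l Hl] := @regular_part_cvg 0.
have H2 : g z @[z --> (0 : C)^'] --> 0 * l by apply: cvgM; [exact: cvg_within|exact: Hl].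
have /eqP : r - \sum_(e <- E) rho e = 0 * l by exact: (cvgC_unique H1 H2).
by rewrite mul0r subr_eq0 => /eqP ->.
Unshelve. all: by end_near. Qed.

End PartialFractions.

End ResidueTheorem.

(** * The involutions *)

Section SphereMaps.
Context {R : realType}.
Local Notation C := (cplx R).
Local Notation CP1 := (CP1 R).

Lemma derivable_shift0 (f : C -> C) (a c : C) :
  derivable (fun t => f (a + t) - c) 0 1 -> derivable f a 1.
Proof.
move=> H; have : derivable f (a + 0) 1.
  apply: (derivable_shift a f 0).2.
  have -> : (fun t => f (a + t)) = (fun t => (f (a + t) - c) + c).
    by apply/funext => t; rewrite subrK.
  by apply: derC_D; [exact: H|exact: derC_cst].
by rewrite addr0.
Qed.

Lemma entire_cst (f : C -> C) (L : C) : (forall z, derivable f z 1) ->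
  (\forall w \near (0 : C)^', f w^-1 = L) -> forall z, f z = L.
Proof.
move=> df fL; apply: liouville_continuous.
- by move=> z; exact: derivable_cont.
- by move=> a; near=> z; exact: df.
- have K : L @[w --> (0 : C)^'] --> L by exact: cvg_cst.
  by refine (cvgC_near_eq _ K); apply: filterS fL => w ->.
Unshelve. all: by end_near. Qed.

(** By injectivity no finite point goes to infinity, so the affine coordinate of [F] is entire; its
    difference with k z vanishes near infinity, hence everywhere. *)
Lemma sphere_map_scale (F : CP1 -> CP1) (k : C) :
  (forall p, holomorphic_at (fun t => loc (F p) (F (par p t))) 0) ->
  injective F -> F pt_inf = pt_inf ->
  (\forall w \near (0 : C)^', F (pt_fin w^-1) = pt_fin (k * w^-1)) ->
  forall z, F (pt_fin z) = pt_fin (k * z).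
Proof.
move=> hF iF F0 Fk; pose f z := Defs.coord (F (pt_fin z)).
have FE z : F (pt_fin z) = pt_fin (f z).
  rewrite /f; case E : (F (pt_fin z)) => [w|] //.
  by have := iF (pt_fin z) pt_inf; rewrite E F0 => /(_ erefl).
have df z : derivable f z 1.
  apply: (@derivable_shift0 _ _ (f z)).
  have := nbhs_singleton (hF (pt_fin z)); rewrite FE /=.
  by under eq_fun do rewrite -/(pt_fin _) FE /=.
have H : forall z, f z - k * z = 0.
  apply: (@entire_cst (fun z => f z - k * z)).
    move=> z; apply: derC_B; first exact: df.
    by apply: derC_M; [exact: derC_cst|exact: derC_id].
  by apply: filterS Fk => w; rewrite /f => ->; rewrite /= subrr.
by move=> z; rewrite FE; congr pt_fin; apply/eqP; rewrite -subr_eq0 H.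
Qed.

Lemma cconjK : involutive (@cconj R).
Proof. exact: conjcK. Qed.
Lemma cconjV (z : C) : cconj z^-1 = (cconj z)^-1.
Proof. exact: conjc_inv. Qed.

Context {n : nat}.
Local Notation point := (curve_point R n).
Variable f : point -> point.
Hypothesis fK : involutive f.
Hypothesis f_comp : exists s : 'I_n -> 'I_n, forall x, (f x).1 = s x.1.
Hypothesis f_P : forall j, f (Ppt j) = Ppt j.

Lemma component_fixed j p : (f (j, p)).1 = j.
Proof. by case: f_comp => s H; have := H (Ppt j); rewrite f_P H /= => <-. Qed.

Lemma component_map_inj j : injective (component_map f j).
Proof.
move=> p q pq; have : f (j, p) = f (j, q).
  by apply/pair_eqP; rewrite /pair_eq !component_fixed eqxx -/(component_map f j p) pq /=.
by move=> /(congr1 f); rewrite !fK => -[].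
Qed.

Lemma component_mapE j p : f (j, p) = (j, component_map f j p).
Proof. have := component_fixed j p; rewrite /component_map; case: (f (j, p)) => a b /= ->.
by [].
Qed.

End SphereMaps.

Section Involutions.
Context {R : realType} {n : nat}.
Local Notation C := (cplx R).
Variable S : spectral_data R n.

Lemma sigmaE sigma : sigma_data S sigma ->
  forall j z, sigma (j, pt_fin z) = (j, pt_fin (- z)).
Proof.
move=> [[sK scomp _] shol sP _ sk] j z.
have E := component_mapE scomp sP; rewrite E -mulN1r; congr pair.
apply: (sphere_map_scale (k := -1)).
- exact: (shol j).2.
- exact: component_map_inj.
- by rewrite /component_map -/(Ppt j) sP.
- by apply: filterS (sk j) => w; rewrite /component_map mulN1r => ->.
Qed.

Lemma tauE omega tau : tau_data S omega tau ->
  forall j z, tau (j, pt_fin z) = (j, pt_fin (cconj z)).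
Proof.
move=> [[tK tcomp _] thol tP _ tk _ _ _ _ _] j z.
have E := component_mapE tcomp tP; rewrite E; congr pair.
have conjK : involutive (@conjCP1 R) by move=> [w|] //=; rewrite /conjCP1 /= cconjK.
(* The conjugate of tau is a holomorphic map, and the condition on tau at P_j makes it the identity
   near infinity. *)
have H : (@conjCP1 R \o component_map tau j) (pt_fin z) = pt_fin (1 * z).
  apply: (sphere_map_scale (k := 1)).
  - exact: (thol j).2.
  - exact: inj_comp (inv_inj conjK) (component_map_inj tK tcomp tP (j := j)).
  - by rewrite /= /component_map -/(Ppt j) tP.
  - by apply: filterS (tk j) => w; rewrite /= /component_map mul1r => -> /=; rewrite cconjV cconjK.
by rewrite -[LHS]conjK [conjCP1 (component_map _ _ _)]H mul1r.
Qed.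

End Involutions.

(** * The Baker-Akhiezer section *)

Section SpectralData.
Context {R : realType} {n : nat}.
Local Notation C := (cplx R).
Local Notation point := (curve_point R n).
Variable S : spectral_data R n.

Lemma marked_fin j z : ((j, pt_fin z) \in codom (Ppt (R := R)) ++ codom (gam S)) =
  ((j, pt_fin z) \in codom (gam S)).
Proof. by rewrite mem_cat; case: codomP => // -[i []]. Qed.

Lemma gam_inj : injective (gam S).
Proof.
have := points_distinct S; rewrite !cat_uniq => /and5P[_ _ _ _].
by case/and3P=> _ _ /injectiveP.
Qed.

Lemma gam_notP m j : gam S m <> Ppt j.
Proof.
move=> E; have := points_distinct S; rewrite cat_uniq => /and3P[_ /hasPn H _].
have := H (gam S m); rewrite !mem_cat codom_f !orbT => /(_ isT).
by rewrite /= E codom_f.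
Qed.

Lemma gam_fin m : gam S m = ((gam S m).1, pt_fin (Defs.coord (gam S m).2)).
Proof.
by have := @gam_notP m (gam S m).1; case: (gam S m) => j [z|].
Qed.

Lemma Qpt_notin_gam j : Qpt j \notin codom (gam S).
Proof.
have := points_distinct S; rewrite cat_uniq => /and3P[_ _].
rewrite cat_uniq => /and3P[_ /hasPn H _].
by apply/negP => /[dup] Hg; have := H (Qpt j); rewrite mem_cat Hg orbT codom_f => /(_ isT).
Qed.

Lemma Qpt_notin_R j : Qpt j \notin codom (Rpt S).
Proof.
have := points_distinct S; rewrite cat_uniq => /and3P[_ _].
rewrite cat_uniq => /and3P[_ /hasPn H _].
by apply/negP => /[dup] Hg; have := H (Qpt j); rewrite mem_cat Hg codom_f => /(_ isT).
Qed.

Lemma Rpt_notin_gam i : Rpt S i \notin codom (gam S).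
Proof.
have := points_distinct S; rewrite cat_uniq => /and3P[_ _].
rewrite cat_uniq => /and3P[_ _]; rewrite cat_uniq => /and3P[_ /hasPn H _].
by apply/negP => /H; rewrite /= codom_f.
Qed.

Lemma singular_fin x : singular (node S) x -> x = (x.1, pt_fin (Defs.coord x.2)).
Proof.
case: x => j [z|] // H; suff : ~~ singular (node S) (j, None) by rewrite H.
by apply: points_nonsingular; rewrite mem_cat (codom_f _ j).
Qed.

Lemma expCNK (x : C) : expC x * expC (- x) = 1.
Proof. by rewrite -expCD subrr expC0. Qed.

Lemma lpar_fin j a t : lpar (j, pt_fin a) t = (j, pt_fin (a + t)) :> point.
Proof. by []. Qed.

Section Form.
Variables (u : 'rV[R]_n) (phi : point -> C) (c : 'I_n -> C).
Hypothesis phiBA : is_BA S u phi c.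

Let f j (z : C) := expC (- (ofR (u 0 j) * z)) * phi (j, pt_fin z).

Lemma derivable_expC_lin (k a z : C) : derivable (fun t => expC (- (k * (a + t)))) z 1.
Proof.
apply: (@derivable_comp R (fun t => - (k * (a + t))) (@expC R)); last exact: derivable_expC.
apply: derC_N; apply: derC_M; first exact: derC_cst.
by apply: derC_D; [exact: derC_cst|exact: derC_id].
Qed.

Lemma BA_simple_pole j a : exists r, simple_pole (f j) a r /\
  ((j, pt_fin a) \notin codom (gam S) -> r = 0).
Proof.
have [gam_a|gam_a] := boolP ((j, pt_fin a) \in codom (gam S)).
  have [g hg fg] := BA_pole phiBA gam_a.
  exists (expC (- (ofR (u 0 j) * (a + 0))) * g 0); split; last by [].
  exists (fun t => expC (- (ofR (u 0 j) * (a + t))) * g t); split; [|by []|].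
    near=> t; apply: derC_M; first exact: derivable_expC_lin.
    by near: t; exact: hg.
  by apply: filterS fg => t /= ft; rewrite /f -lpar_fin ft mulrA.
exists 0; split; last by [].
have hg := @BA_regular _ _ _ _ _ _ phiBA (j, pt_fin a).
have {}hg : holomorphic_at (phi \o lpar (j, pt_fin a)) 0.
  by apply: hg; rewrite marked_fin.
exists (fun t => t * (expC (- (ofR (u 0 j) * (a + t))) * phi (j, pt_fin (a + t)))).
split.
- near=> t; apply: derC_M; first exact: derC_id.
  apply: derC_M; first exact: derivable_expC_lin.
  by near: t; exact: hg.
- by rewrite mul0r.
- by apply: filterS dnbhs0_neq0 => t t0; rewrite /f [t * _]mulrC mulfK.
Unshelve. all: by end_near. Qed.

Lemma BA_regular_derivable j z : (j, pt_fin z) \notin codom (gam S) ->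
  derivable (fun z => phi (j, pt_fin z)) z 1.
Proof.
move=> zg; have hg := @BA_regular _ _ _ _ _ _ phiBA (j, pt_fin z).
have {}hg : holomorphic_at (phi \o lpar (j, pt_fin z)) 0.
  by apply: hg; rewrite marked_fin.
apply: (@derivable_shift0 _ _ _ 0).
have := nbhs_singleton hg.
have -> // : (phi \o lpar (j, pt_fin z)) = (fun t : C => phi (j, pt_fin (z + t)) - 0).
by apply/funext => t; rewrite subr0.
Qed.

(** The factor e^(-u_j z) removes the essential singularity at P_j: the product has only simple
    poles, at gamma, and tends to [c j] at infinity. *)
Lemma BA_form : exists r : 'I_(nb_gam S) -> C, forall j z, (j, pt_fin z) \notin codom (gam S) ->
  phi (j, pt_fin z) = expC (ofR (u 0 j) * z) *
    (c j + \sum_(m | (gam S m).1 == j) r m / (z - Defs.coord (gam S m).2)).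
Proof.
have [rho Hrho] := choice (fun ja : 'I_n * C => BA_simple_pole ja.1 ja.2).
exists (fun m => rho ((gam S m).1, Defs.coord (gam S m).2)) => j z zg.
pose E := [seq Defs.coord (gam S m).2 | m <- enum 'I_(nb_gam S) & (gam S m).1 == j].
have uE : uniq E.
  rewrite map_inj_in_uniq; first by rewrite filter_uniq // enum_uniq.
  move=> m1 m2; rewrite !mem_filter => /andP[/eqP m1j _] /andP[/eqP m2j _] mm.
  by apply: gam_inj; rewrite gam_fin [RHS]gam_fin m1j m2j mm.
have rhoE a : a \notin E -> rho (j, a) = 0.
  move=> aE; apply: (Hrho (j, a)).2; apply: contra aE => /codomP[m mE].
  apply/mapP; exists m; last by rewrite -mE.
  by rewrite mem_filter -mE eqxx mem_enum.
have zE : z \notin E.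
  apply: contra zg => /mapP[m]; rewrite mem_filter => /andP[/eqP mj _] ->.
  by apply/codomP; exists m; rewrite [RHS]gam_fin mj.
have finf : f j w^-1 @[w --> (0 : C)^'] --> c j.
  have [g g0 [hg fg]] := BA_essential phiBA j.
  have := continuous_dnbhs (derivable_cont (nbhs_singleton hg)).
  rewrite g0 => K; refine (cvgC_near_eq _ K); apply: filterS fg => w <-.
  by rewrite /normalized /f mulNr.
have cz : {for z, continuous (f j)}.
  apply: derivable_cont; apply: derC_M; last exact: BA_regular_derivable.
  have := @derivable_expC_lin (ofR (u 0 j)) 0 z.
  by under eq_fun do rewrite add0r.
have := partial_fractions uE rhoE (fun a => (Hrho (j, a)).1) finf zE cz.
rewrite big_map big_filter big_enum_cond /= => fE.
have -> : phi (j, pt_fin z) = expC (ofR (u 0 j) * z) * f j z.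
  by rewrite /f mulrA expCNK mul1r.
rewrite fE; congr (_ * (_ + _)); apply: eq_big => [m|m /eqP <- //].
by [].
Qed.

End Form.

(** * Complex conjugation and reality *)

Section Reality.
Variables (omega : point -> C) (tau : point -> point).
Hypothesis tauS : tau_data S omega tau.

Lemma cconjD (z w : C) : cconj (z + w) = cconj z + cconj w.
Proof. exact: rmorphD. Qed.
Lemma cconjB (z w : C) : cconj (z - w) = cconj z - cconj w.
Proof. exact: rmorphB. Qed.
Lemma cconjM (z w : C) : cconj (z * w) = cconj z * cconj w.
Proof. exact: rmorphM. Qed.
Lemma cconj0 : cconj 0 = 0 :> C.
Proof. exact: rmorph0. Qed.
Lemma cconj_ofR x : cconj (ofR x) = ofR x :> C.
Proof. by apply: C_eq; rewrite /= ?oppr0. Qed.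
Lemma cconj_expC (z : C) : cconj (expC z) = expC (cconj z).
Proof. by case: z => x y; apply: C_eq; rewrite /= ?cosN ?sinN ?mulrN. Qed.
Lemma nrm_cconj (z : C) : nrm (cconj z) = nrm z.
Proof. by case: z => x y; rewrite /nrm /= sqrrN. Qed.

Lemma near_cconj (P : set C) : (\forall t \near (0 : C), P t) -> \forall t \near (0 : C), P (cconj t).
Proof.
move=> /(nbhsCP _ _).1[d d0 H]; apply: (nbhsCP _ _).2; exists d => // t.
by rewrite subr0 => td; apply: H; rewrite subr0 nrm_cconj.
Qed.

Lemma dnear_cconj (P : set C) :
  (\forall t \near (0 : C)^', P t) -> \forall t \near (0 : C)^', P (cconj t).
Proof.
move=> /(dnbhsCP _ _).1[d d0 H]; apply: (dnbhsCP _ _).2; exists d => // t t0.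
rewrite subr0 => td; apply: H; rewrite ?subr0 ?nrm_cconj //.
by apply: contra_neq t0 => /(congr1 (@cconj R)); rewrite cconjK cconj0.
Qed.

Lemma derivable_cconj (g : C -> C) z : derivable g (cconj z) 1 ->
  derivable (fun t => cconj (g (cconj t))) z 1.
Proof.
move=> /derivableCP[d H]; apply: (derivableCP _ _).2; exists (cconj d) => e e0.
have [r r0 Hr] := H e e0; exists r => // w wr.
have E : nrm (w - z) = nrm (cconj w - cconj z) by rewrite -cconjB nrm_cconj.
have -> : cconj (g (cconj w)) - cconj (g (cconj z)) - cconj d * (w - z) =
    cconj (g (cconj w) - g (cconj z) - d * (cconj w - cconj z)).
  by rewrite !cconjB cconjM cconjB !cconjK.
by rewrite nrm_cconj E; apply: Hr; rewrite -E.
Qed.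

Lemma holomorphic_cconj (g : C -> C) : holomorphic_at g 0 ->
  holomorphic_at (fun t => cconj (g (cconj t))) 0.
Proof. by move=> /near_cconj; apply: filterS => t; exact: derivable_cconj. Qed.

Lemma tau_mem_gam x : x \in codom (gam S) -> tau x \in codom (gam S).
Proof.
move=> /codomP[m ->]; rewrite -(perm_mem (tau_gam tauS)).
by apply/codomP; exists m.
Qed.

Lemma tau_lpar j a t : tau (lpar (j, pt_fin a) t) = lpar (tau (j, pt_fin a)) (cconj t).
Proof. by rewrite lpar_fin !(tauE tauS) lpar_fin cconjD. Qed.

(** Each condition on tau transfers one defining property of [phi]: tau gamma = gamma the poles, tau
    R = R and conj d the normalization, conj lambda the gluing. The exponential is preserved because
    u is real. *)
Lemma BA_conj u phi c : is_BA S u phi c ->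
  is_BA S u (fun x => cconj (phi (tau x))) (fun j => cconj (c j)).
Proof.
move=> H; split.
- move=> j; have [g g0 [hg fg]] := BA_essential H j.
  exists (fun t => cconj (g (cconj t))); first by rewrite cconj0 g0.
  split; first exact: holomorphic_cconj.
  apply: filterS (dnear_cconj fg) => t <-.
  rewrite /normalized (tauE tauS) cconjM cconj_expC; congr (expC _ * cconj (phi (j, pt_fin _))).
    by rewrite cconjM cconjV cconjK -ofRN cconj_ofR.
  by rewrite cconjV.
- move=> x xg; have [g hg fg] := BA_pole H (tau_mem_gam xg).
  exists (fun t => cconj (g (cconj t))); first exact: holomorphic_cconj.
  apply: filterS (dnear_cconj fg) => t /=.
  case/codomP: xg => m ->; rewrite gam_fin tau_lpar => ->.
  by rewrite cconjM cconjV cconjK.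
- move=> [j [z|]]; last by rewrite mem_cat (codom_f _ j).
  rewrite -/(pt_fin z) marked_fin => xg.
  have tg : tau (j, pt_fin z) \notin codom (gam S).
    by apply: contra xg => /tau_mem_gam; rewrite (inv_involutive (tau_involution tauS)).
  have hg := @BA_regular _ _ _ _ _ _ H (tau (j, pt_fin z)).
  rewrite (tauE tauS) in tg hg; rewrite marked_fin in hg.
  have := holomorphic_cconj (hg tg).
  have -> // : (fun t => cconj ((phi \o lpar (j, pt_fin (cconj z))) (cconj t))) =
     (fun x => cconj (phi (tau x))) \o lpar (j, pt_fin z).
  by apply/funext => t /=; rewrite tau_lpar (tauE tauS).
- move=> i; have : tau (Rpt S i) \in codom (Rpt S).
    by rewrite -(perm_mem (tau_R tauS)); apply/codomP; exists i.
  move=> /codomP[k E]; rewrite E (BA_normalization H) -(tau_d tauS E).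
  exact: cconjK.
- move=> a b ab; rewrite (BA_gluing H (inv_glued (tau_involution tauS) ab)).
  by rewrite cconjM -(tau_lam tauS ab) cconjK.
Qed.

Variables (D : set 'rV[R]_n) (psi : 'rV[R]_n -> point -> C) (h : 'rV[R]_n -> 'I_n -> C).
Hypothesis psiBA : BA_family S D psi h.

Lemma psi_Q_real u k : D u -> cconj (psi u (Qpt k)) = psi u (Qpt k).
Proof.
move=> Du; have := BAF_unique psiBA Du (BA_conj (BAF_section psiBA Du)) (x := Qpt k).
by rewrite (tau_Q tauS) marked_fin => ->//; exact: Qpt_notin_gam.
Qed.

Lemma leading_coefE u phi c j : is_BA S u phi c ->
  normalized u phi j w @[w --> (0 : C)^'] --> c j.
Proof.
move=> H; have [g g0 [hg fg]] := BA_essential H j.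
have := continuous_dnbhs (derivable_cont (nbhs_singleton hg)).
by rewrite g0 => K; refine (cvgC_near_eq _ K); apply: filterS fg => w <-.
Qed.

Lemma finite_notin_near_inf j :
  \forall w \near (0 : C)^', (j, pt_fin w^-1) \notin codom (gam S).
Proof.
have H m : \forall w \near (0 : C)^', gam S m != (j, pt_fin w^-1).
  rewrite gam_fin; set c := Defs.coord _; apply: (dnbhsCP _ _).2.
  exists (1 + nrm c)^-1; first by rewrite invr_gt0 ltr_pwDl // nrm_ge0.
  move=> w w0; rewrite subr0 => wc; apply/eqP => -[_ cE].
  move: wc; rewrite -[w]invrK -cE nrmV ltf_pV2 ?posrE ?nrm_gt0 ?cE ?invr_eq0 //.
    by rewrite -cE; have := nrm_ge0 c; lra.
  by rewrite ltr_pwDl // nrm_ge0.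
have : \forall w \near (0 : C)^', forall m, gam S m != (j, pt_fin w^-1) by exact: filter_forall.
by apply: filterS => w Hw; apply/codomP => -[m E]; have := Hw m; rewrite -E eqxx.
Qed.

(** Uniqueness compares values only off P and gamma, so the leading coefficients are compared as
    limits at infinity, near which there are no points of gamma. *)
Lemma h_real u j : D u -> cconj (h u j) = h u j.
Proof.
move=> Du; have H := BAF_section psiBA Du.
have K := leading_coefE (j := j) (BA_conj H).
apply: (cvgC_unique K); refine (cvgC_near_eq _ (leading_coefE (j := j) H)).
apply: filterS (finite_notin_near_inf j) => w wg.
rewrite /normalized; congr (_ * _).
by rewrite (BAF_unique psiBA Du (BA_conj H)) // marked_fin.
Qed.

End Reality.

End SpectralData.

(** * Differentiation with respect to u *)

Section PartialDerivatives.
Context {R : realType} {n : nat}.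
Local Notation C := (cplx R).
Local Notation V := ('rV[R]_n).
Implicit Types (F G : V -> C) (d : C) (u v : V) (i : 'I_n).

(** [partialC] has a value even where no derivative exists; this predicate also asserts
    existence. *)
Definition has_pd i u F d := is_derive u (basis_vec i) (reC \o F) (reC d) /\
  is_derive u (basis_vec i) (imC \o F) (imC d).

Definition pdiff i u F := derivable (reC \o F) u (basis_vec i) /\
  derivable (imC \o F) u (basis_vec i).

Lemma has_pdE i u F d : has_pd i u F d -> partialC i F u = d.
Proof. by move=> [H1 H2]; apply: C_eq; rewrite /= /partial; apply: derive_val. Qed.

Lemma pdiff_has_pd i u F : pdiff i u F -> has_pd i u F (partialC i F u).
Proof. by move=> [H1 H2]; split; apply: DeriveDef. Qed.

Lemma has_pd_pdiff i u F d : has_pd i u F d -> pdiff i u F.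
Proof. by move=> [[H1 _] [H2 _]]. Qed.

Lemma has_pd_near i u F G d : (\forall v \near u, F v = G v) ->
  has_pd i u F d -> has_pd i u G d.
Proof.
move=> FG [H1 H2]; split.
  apply: (@near_eq_is_derive _ _ _ (reC \o F) (reC \o G) u _ _ _ H1).
  by apply: filterS FG => v /= ->.
apply: (@near_eq_is_derive _ _ _ (imC \o F) (imC \o G) u _ _ _ H2).
by apply: filterS FG => v /= ->.
Qed.

Lemma pdiff_near i u F G : (\forall v \near u, F v = G v) ->
  pdiff i u F -> pdiff i u G.
Proof. by move=> FG /pdiff_has_pd /(has_pd_near FG) /has_pd_pdiff. Qed.

Lemma has_pd_cst i u d : has_pd i u (fun=> d) 0.
Proof. by split; exact: is_derive_cst. Qed.

Lemma has_pdD i u F G d e : has_pd i u F d -> has_pd i u G e ->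
  has_pd i u (fun v => F v + G v) (d + e).
Proof.
move=> [H1 H2] [K1 K2]; split; rewrite !reimE.
  have -> : reC \o (fun v => F v + G v) = (reC \o F) + (reC \o G).
    by apply/funext => v /=; rewrite !reimE.
  exact: is_deriveD.
have -> : imC \o (fun v => F v + G v) = (imC \o F) + (imC \o G).
  by apply/funext => v /=; rewrite !reimE.
exact: is_deriveD.
Qed.

Lemma has_pdM i u F G d e : has_pd i u F d -> has_pd i u G e ->
  has_pd i u (fun v => F v * G v) (d * G u + F u * e).
Proof.
move=> [H1 H2] [K1 K2]; split.
  have -> : reC \o (fun v => F v * G v) = (reC \o F) * (reC \o G) - (imC \o F) * (imC \o G).
    by apply/funext => v /=; rewrite !reimE.
  apply: (@is_derive_eq _ _ _ _ _ _ _ _ (is_deriveB (is_deriveM H1 K1) (is_deriveM H2 K2))).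
  by rewrite !reimE /GRing.scale /=; ring.
have -> : imC \o (fun v => F v * G v) = (reC \o F) * (imC \o G) + (imC \o F) * (reC \o G).
  by apply/funext => v /=; rewrite !reimE.
apply: (@is_derive_eq _ _ _ _ _ _ _ _ (is_deriveD (is_deriveM H1 K2) (is_deriveM H2 K1))).
by rewrite !reimE /GRing.scale /=; ring.
Qed.

Lemma has_pdZ i u F c d : has_pd i u F d -> has_pd i u (fun v => c * F v) (c * d).
Proof. by move=> H; have := has_pdM (has_pd_cst i u c) H; rewrite mul0r add0r. Qed.

Lemma has_pdB i u F G d e : has_pd i u F d -> has_pd i u G e ->
  has_pd i u (fun v => F v - G v) (d - e).
Proof.
move=> H K; have := has_pdD H (has_pdZ (-1) K); rewrite mulN1r.
by under eq_fun do rewrite mulN1r.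
Qed.

Lemma has_pd_sum (I : Type) i u (s : seq I) (P : pred I) (F : I -> V -> C) (d : I -> C) :
  (forall m, P m -> has_pd i u (F m) (d m)) ->
  has_pd i u (fun v => \sum_(m <- s | P m) F m v) (\sum_(m <- s | P m) d m).
Proof.
move=> H; elim: s => [|m s IH].
  rewrite big_nil; under eq_fun do rewrite big_nil; exact: has_pd_cst.
rewrite big_cons; under eq_fun do rewrite big_cons.
case Pm : (P m); last exact: IH.
by apply: has_pdD; [exact: H|exact: IH].
Qed.

Lemma pdiffD i u F G : pdiff i u F -> pdiff i u G -> pdiff i u (fun v => F v + G v).
Proof. by move=> /pdiff_has_pd H /pdiff_has_pd K; exact: has_pd_pdiff (has_pdD H K). Qed.
Lemma pdiffB i u F G : pdiff i u F -> pdiff i u G -> pdiff i u (fun v => F v - G v).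
Proof. by move=> /pdiff_has_pd H /pdiff_has_pd K; exact: has_pd_pdiff (has_pdB H K). Qed.
Lemma pdiffM i u F G : pdiff i u F -> pdiff i u G -> pdiff i u (fun v => F v * G v).
Proof. by move=> /pdiff_has_pd H /pdiff_has_pd K; exact: has_pd_pdiff (has_pdM H K). Qed.
Lemma pdiffZ i u F c : pdiff i u F -> pdiff i u (fun v => c * F v).
Proof. by move=> /pdiff_has_pd H; exact: has_pd_pdiff (has_pdZ c H). Qed.
Lemma pdiff_big_sum (I : Type) i u (s : seq I) (P : pred I) (F : I -> V -> C) :
  (forall m, P m -> pdiff i u (F m)) -> pdiff i u (fun v => \sum_(m <- s | P m) F m v).
Proof.
move=> H; have K m : P m -> has_pd i u (F m) (partialC i (F m) u).
  by move=> /H /pdiff_has_pd.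
exact: has_pd_pdiff (has_pd_sum s K).
Qed.

Lemma is_derive_linearization (f : R -> R) (x d : R) :
  (forall e : R, 0 < e -> exists2 r : R, 0 < r & forall y, `|y - x| < r ->
    `|f y - f x - d * (y - x)| <= e * `|y - x|) -> is_derive x 1 f d.
Proof.
move=> H; have K : (fun h => h^-1 *: (f (h *: (1 : R) + x) - f x)) @ (0 : R)^' --> d.
  apply/cvgrPdist_lt => e e0.
  have e2 : 0 < e / 2 by rewrite divr_gt0.
  have [r r0 Hr] := H _ e2.
  near=> h; have h0 : h != 0 by near: h; exact: nbhs_dnbhs_neq.
  have hr : `|h| < r by near: h; exact: dnbhs0_lt.
  have -> : d - h^-1 *: (f (h *: (1 : R) + x) - f x) =
      - (h^-1 * (f (h + x) - f x - d * (h + x - x))).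
    by rewrite addrK /GRing.scale /= mulr1; field.
  have := Hr (h + x); rewrite addrK => /(_ hr) Hh.
  rewrite normrN normrM normfV ltr_pdivrMl ?normr_gt0 //.
  apply: (le_lt_trans Hh); rewrite mulrC ltr_pM2l ?normr_gt0 //.
  by rewrite ltr_pdivrMr // ltr_pMr // ltr1n.
split; first by apply/cvg_ex; exists d.
exact: (@cvg_lim R _ R _ _ _ d K).
Unshelve. all: by end_near. Qed.

Lemma is_derive_real_line (G : C -> C) (x : R) (d : C) : is_derive (ofR x) 1 G d ->
  is_derive x 1 (fun y => reC (G (ofR y))) (reC d) /\
  is_derive x 1 (fun y => imC (G (ofR y))) (imC d).
Proof.
move=> /(is_deriveCP G (ofR x) d).1 H.
have E y : (ofR y : C) - ofR x = ofR (y - x) by rewrite ofRD ofRN.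
split; apply: is_derive_linearization => e e0; have [r r0 Hr] := H e e0;
  exists r => // y yr; have := Hr (ofR y); rewrite E nrm_ofR => /(_ yr);
  apply: le_trans.
- apply: le_trans (ler_reC _); rewrite !reimE /=.
  by rewrite le_eqVlt; apply/predU1l; congr `|_|; ring.
- apply: le_trans (ler_imC _); rewrite !reimE /=.
  by rewrite le_eqVlt; apply/predU1l; congr `|_|; ring.
Qed.

Lemma is_derive_expC_scale (z w : C) :
  is_derive w 1 (fun w => expC (w * z)) (z * expC (w * z)).
Proof.
apply: (is_deriveCP _ w _).2 => e e0.
have n0 := nrm_ge0 z.
have e1 : 0 < e / (nrm z + 1) by rewrite divr_gt0 // ltr_wpDl.
have [r r0 Hr] := (is_deriveCP _ _ _).1 (is_derive_expC (w * z)) _ e1.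
exists (r / (nrm z + 1)); first by rewrite divr_gt0 // ltr_wpDl.
move=> w' ww; have E : w' * z - w * z = z * (w' - w) by ring.
have := Hr (w' * z); rewrite E nrmM.
have le1 : nrm z * nrm (w' - w) <= (nrm z + 1) * nrm (w' - w).
  by rewrite ler_wpM2r ?nrm_ge0 // lerDl.
move: ww; rewrite ltr_pdivlMr ?ltr_wpDl // mulrC => ww.
move=> /(_ (le_lt_trans le1 ww)).
rewrite mulrCA mulrA => /le_trans; apply.
have e1' := ltW e1; apply: (le_trans (ler_wpM2l e1' le1)).
by rewrite mulrA divfK // gt_eqF // ltr_wpDl.
Qed.

Lemma is_derive_coord i j u (g : R -> R) (d : R) : is_derive (u 0 j) 1 g d ->
  is_derive u (basis_vec i) (fun v : V => g (v 0 j)) ((i == j)%:R * d).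
Proof.
move=> gd; have [->|ij] := eqVneq i j.
  rewrite mul1r.
  have E : (fun h : R => h^-1 *: (((fun v : V => g (v 0 j)) \o shift u) (h *: basis_vec j)
      - (fun v : V => g (v 0 j)) u)) =
    (fun h : R => h^-1 *: ((g \o shift (u 0 j)) (h *: (1 : R)) - g (u 0 j))).
    by apply/funext => h /=; rewrite !mxE !eqxx.
  case: gd => d1 d2; split; first by rewrite /derivable E.
  by rewrite /derive E.
rewrite mul0r.
have E : (fun h : R => h^-1 *: (((fun v : V => g (v 0 j)) \o shift u) (h *: basis_vec i)
      - (fun v : V => g (v 0 j)) u)) = (fun=> 0).
  apply/funext => h /=; rewrite !mxE eqxx /= eq_sym (negbTE ij).
  by rewrite /GRing.scale /= mulr0 add0r subrr mulr0.
split; first by rewrite /derivable E; exact: is_cvg_cst.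
by rewrite /derive E; exact: lim_cst.
Qed.

Lemma has_pd_expC i j u (z : C) :
  has_pd i u (fun v => expC (ofR (v 0 j) * z)) ((i == j)%:R * z * expC (ofR (u 0 j) * z)).
Proof.
have N : (i == j)%:R = ofR (i == j)%:R :> C by case: (i == j).
have [H1 H2] := is_derive_real_line (is_derive_expC_scale z (ofR (u 0 j))).
split.
  have -> : reC ((i == j)%:R * z * expC (ofR (u 0 j) * z)) =
    (i == j)%:R * reC (z * expC (ofR (u 0 j) * z)).
    by rewrite N -mulrA [LHS]reCM /= mul0r subr0.
  exact: (@is_derive_coord i j u (fun x => reC (expC (ofR x * z)))).
have -> : imC ((i == j)%:R * z * expC (ofR (u 0 j) * z)) =
  (i == j)%:R * imC (z * expC (ofR (u 0 j) * z)).
  by rewrite N -mulrA [LHS]imCM /= mul0r addr0.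
exact: (@is_derive_coord i j u (fun x => imC (expC (ofR x * z)))).
Qed.

Lemma ex_notin (E : seq C) : exists z, z \notin E.
Proof.
pose s : seq C := [seq k%:R | k <- iota 0 (size E).+1].
have us : uniq s.
  by rewrite map_inj_uniq ?iota_uniq // => x y /eqP; rewrite eqr_nat => /eqP.
apply/not_existsP => H.
have sE : {subset s <= E} by move=> z _; apply: contrapT => /negP; exact: H.
by have := uniq_leq_size us sE; rewrite size_map size_iota ltnn.
Qed.

(* For two points z, z' the combination
   ((z - a m) F(z) - (z' - a m) F(z')) / (z - z') is again a sum of partial
   fractions, without the pole a m. *)
Lemma pdiff_partial_fractions (I : eqType) i u (s : seq I) (a : I -> C) (E : seq C)
    (F : V -> C -> C) (c : V -> C) (r : I -> V -> C) :
  {in s &, injective a} -> uniq s -> {in s, forall m, a m \in E} ->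
  (forall z, z \notin E -> pdiff i u (fun v => F v z)) ->
  (\forall v \near u, forall z, z \notin E -> F v z = c v + \sum_(m <- s) r m v / (z - a m)) ->
  {in s, forall m, pdiff i u (r m)}.
Proof.
(* The induction carries the constant term [c] along: with no pole left, [F v z'] is [c v], so [c]
   is differentiable, and the coefficients follow on the way back. *)
suff : {in s &, injective a} -> uniq s -> {in s, forall m, a m \in E} ->
  (forall z, z \notin E -> pdiff i u (fun v => F v z)) ->
  (\forall v \near u, forall z, z \notin E -> F v z = c v + \sum_(m <- s) r m v / (z - a m)) ->
  pdiff i u c /\ {in s, forall m, pdiff i u (r m)}.
  by move=> H h1 h2 h3 h4 h5; case: (H h1 h2 h3 h4 h5).
elim: s E F r => [|m s IH] E F r ainj us aE Fd FE; have [z' z'E] := ex_notin E.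
  split=> //; apply: pdiff_near (Fd z' z'E).
  by apply: filterS FE => v /(_ _ z'E) ->; rewrite big_nil addr0.
have [ms {}us] : m \notin s /\ uniq s by apply/andP.
have am k : k \in s -> a m != a k.
  move=> ks; apply: contraNneq ms => /ainj ->//; rewrite in_cons ?eqxx ?ks ?orbT //.
have z'a k : k \in m :: s -> z' - a k != 0.
  by move=> ks; rewrite subr_eq0; apply: contraNneq z'E => ->; exact: aE.
pose F' v z := (z - z')^-1 * ((z - a m) * F v z - (z' - a m) * F v z').
(* Since (z - a_m) / (z - a_k) = 1 + (a_k - a_m) / (z - a_k), the difference of its values at z and
   z', divided by z - z', is (a_m - a_k) / ((z - a_k) (z' - a_k)). The constant term is
   unchanged. *)
pose r' k v := (a m - a k) / (z' - a k) * r k v.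
have [||z||cd rd] := IH (z' :: E) F' r' _ us _ _ _.
- by move=> k l ks ls; apply: ainj; rewrite in_cons ?ks ?ls orbT.
- by move=> k ks; rewrite in_cons aE ?orbT // in_cons ks orbT.
- rewrite in_cons negb_or => /andP[zz' zE].
  by apply: pdiffZ; apply: pdiffB; apply: pdiffZ; exact: Fd.
- apply: filterS FE => v Fv z; rewrite in_cons negb_or => /andP[zz' zE].
  have za k : k \in m :: s -> z - a k != 0.
    by move=> ks; rewrite subr_eq0; apply: contraNneq zE => ->; exact: aE.
  rewrite /F' !Fv // !big_cons.
  have zm := za m (mem_head _ _); have zm' := z'a m (mem_head _ _).
  have zz : z - z' != 0 by rewrite subr_eq0.
  have -> : \sum_(k <- s) r' k v / (z - a k) = (z - z')^-1 *
     ((z - a m) * (\sum_(k <- s) r k v / (z - a k)) -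
      (z' - a m) * (\sum_(k <- s) r k v / (z' - a k))).
    rewrite !mulr_sumr -sumrB mulr_sumr big_seq [RHS]big_seq; apply: eq_bigr => k ks.
    have zk := za k; have zk' := z'a k; rewrite !in_cons ks orbT in zk zk'.
    by rewrite /r'; field; rewrite zz zk // zk'.
  by field; rewrite zz zm zm'.
have rd' k : k \in s -> pdiff i u (r k).
  move=> ks; have amk := am k ks; have z'k := z'a k; rewrite in_cons ks orbT in z'k.
  have -> : r k = (fun v => ((z' - a k) / (a m - a k)) * r' k v).
    by apply/funext => v; rewrite /r'; field; rewrite z'k // subr_eq0 amk.
  by apply: pdiffZ; exact: rd.
split; first exact: cd.
move=> k; rewrite in_cons => /predU1P[->|]; last exact: rd'.
have zm' := z'a m (mem_head _ _).
(* All other coefficients being known, that of the pole a_m is solved for in the value at z'. *)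
have H : pdiff i u (fun v => (z' - a m) * (F v z' - (c v + \sum_(k <- s | k \in s) (z' - a k)^-1 * r k v))).
  apply: pdiffZ; apply: pdiffB; first exact: Fd.
  apply: pdiffD; first exact: cd.
  by apply: pdiff_big_sum => l ls; apply: pdiffZ; exact: rd'.
apply: pdiff_near H; apply: filterS FE => v /(_ _ z'E) ->.
rewrite big_cons -big_seq.
have -> : \sum_(k <- s) r k v / (z' - a k) = \sum_(k <- s) (z' - a k)^-1 * r k v.
  by apply: eq_bigr => l _; rewrite mulrC.
by field.
Qed.

End PartialDerivatives.

(** * Joint smoothness restricted to a fixed point of the curve *)

Section Restriction.
Context {R : realType} {n : nat}.
Local Notation C := (cplx R).
Local Notation V := ('rV[R]_n).
Implicit Types (G : 'rV[R]_(n + 2) -> R) (w : 'rV[R]_2) (u : V) (i : 'I_n).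

Lemma basis_vec_lshift i : basis_vec (lshift 2 i) = row_mx (basis_vec i) 0 :> 'rV[R]_(n + 2).
Proof.
apply/rowP => k; rewrite !mxE; case: splitP => l kl; rewrite !mxE //=.
  by rewrite -val_eqE /= kl.
by rewrite -val_eqE /= kl; case: eqP => // E; have := ltn_ord i; rewrite -E ltnNge leq_addr.
Qed.

Lemma restr_quotient G w u i :
  (fun t : R => t^-1 *: (((fun u : V => G (row_mx u w)) \o shift u) (t *: basis_vec i)
      - (fun u : V => G (row_mx u w)) u)) =
  (fun t : R => t^-1 *: ((G \o shift (row_mx u w)) (t *: basis_vec (lshift 2 i)) - G (row_mx u w))).
Proof.
apply/funext => t /=; congr (_ *: (G _ - _)).
by rewrite basis_vec_lshift scale_row_mx add_row_mx scaler0 add0r.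
Qed.

Lemma derivable_restr G w u i : derivable G (row_mx u w) (basis_vec (lshift 2 i)) ->
  derivable (fun u => G (row_mx u w)) u (basis_vec i).
Proof. by rewrite /derivable restr_quotient. Qed.

Lemma partial_restr G w i : partial i (fun u => G (row_mx u w)) =
  (fun u => partial (lshift 2 i) G (row_mx u w)).
Proof. by apply/funext => u; rewrite /partial /derive restr_quotient. Qed.

Lemma continuous_row_mx w u : {for u, continuous (fun u : V => row_mx u w)}.
Proof.
move=> A /nbhs_ballP[e /= e0 HA]; apply/nbhs_ballP; exists e => // v [_ vu].
apply: HA; split=> // i j; rewrite !mxE; case: splitP => k _; first exact: vu.
exact: ballxx.
Qed.

(** Fixing the last two coordinates commutes with derivatives in the first n directions, so the list
    of directions is only reindexed by [lshift]. *)
Lemma smooth_restr (A : set 'rV[R]_(n + 2)) (U : set V) G w :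
  smooth_on A G -> (forall u, U u -> A (row_mx u w)) ->
  smooth_on U (fun u => G (row_mx u w)).
Proof.
move=> GA UA s u Uu.
have -> : foldr (@partial R n) (fun u => G (row_mx u w)) s =
   (fun u => foldr (@partial R _) G (map (lshift 2) s) (row_mx u w)).
  by elim: s => //= i s ->; rewrite partial_restr.
have [cG dG] := GA (map (lshift 2) s) _ (UA u Uu); split.
  apply: (@continuous_comp _ _ _ (fun u : V => row_mx u w)); last exact: cG.
  exact: continuous_row_mx.
by move=> i; apply: derivable_restr; exact: dG.
Qed.

Definition zvec (z : C) : 'rV[R]_2 := \row_k (if k == ord0 then reC z else imC z).

Lemma joint_row_mx (F : V -> C -> C) z u : joint F (row_mx u (zvec z)) = F u z.
Proof.
rewrite /joint /upart /zpart row_mxKl !row_mxEr !mxE /=.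
by congr F; rewrite -mkCE.
Qed.

Lemma zpart_row_mx u z : zpart (row_mx u (zvec z)) = z.
Proof. by rewrite /zpart !row_mxEr !mxE /= -mkCE. Qed.

Lemma zvec0 : zvec 0 = 0.
Proof. by apply/rowP => k; rewrite !mxE; case: ifP. Qed.

Lemma smooth_pdiff (U : set V) (F : V -> C) : smoothC_on U F ->
  forall u i, U u -> pdiff i u F.
Proof. by move=> [sr si] u i Uu; split; [exact: (sr [::] u Uu).2|exact: (si [::] u Uu).2]. Qed.

(** Iterated derivatives are linear only where they exist: the equality holds on [U] alone and
    passes to the next derivative because [U] is open. *)
Lemma smooth_scale (U : set V) (f : V -> R) (c : R) : open U ->
  smooth_on U f -> smooth_on U (fun u => c * f u).
Proof.
move=> oU sf.
have E s u : U u -> foldr (@partial R n) (fun u => c * f u) s u =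
    c * foldr (@partial R n) f s u.
  elim: s u => //= i s IH u Uu.
  rewrite /partial (@near_eq_derive _ _ _ _ (c \*: foldr (@partial R n) f s)).
    by rewrite deriveZ //; exact: (sf s u Uu).2.
  by near=> v; apply: IH; near: v; exact: open_nbhs_nbhs.
move=> s u Uu; have [cf df] := sf s u Uu.
have nE : \forall v \near u, (c \*: foldr (@partial R n) f s) v =
   foldr (@partial R n) (fun u => c * f u) s v.
  by near=> v; rewrite E //; near: v; exact: open_nbhs_nbhs.
split; last by move=> i; apply: (near_eq_derivable nE); apply: derivableZ; exact: df.
rewrite /prop_for /continuous_at E //.
have K : {for u, continuous (cst c \* foldr (@partial R n) f s)}.
  by apply: continuousM; [exact: cst_continuous|exact: cf].
exact: (cvg_trans (near_eq_cvg nE) K).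
Unshelve. all: by end_near. Qed.

End Restriction.

(** * Dependence of the Baker-Akhiezer section on u *)

Section BAFamily.
Context {R : realType} {n : nat}.
Local Notation C := (cplx R).
Local Notation point := (curve_point R n).
Variables (S : spectral_data R n) (D : set 'rV[R]_n).
Variables (psi : 'rV[R]_n -> point -> C) (h : 'rV[R]_n -> 'I_n -> C).
Hypothesis oD : open D.
Hypothesis psiBA : BA_family S D psi h.

Lemma psi_smooth j z : (j, pt_fin z) \notin codom (gam S) ->
  smoothC_on D (fun u => psi u (j, pt_fin z)).
Proof.
move=> zg; have [sr si] := BAF_smooth psiBA j.
pose F u z := psi u (j, pt_fin z).
have DA u : D u -> [set v | D (upart v) /\ (j, pt_fin (zpart v)) \notin codom (gam S)]
    (row_mx u (zvec z)).
  by move=> Du; rewrite /= zpart_row_mx /upart row_mxKl.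
have E (f : C -> R) : f \o (fun u => psi u (j, pt_fin z)) =
  (fun u => (f \o joint F) (row_mx u (zvec z))).
  by apply/funext => u; rewrite /= joint_row_mx.
by split; rewrite E; [exact: smooth_restr sr DA|exact: smooth_restr si DA].
Qed.

Lemma h_smooth j : smoothC_on D (fun u => h u j).
Proof.
have [U [oU DU] [sr si]] := BAF_smooth_P psiBA j.
pose F u w := if w == 0 then h u j else normalized u (psi u) j w.
have DA u : D u -> U (row_mx u (zvec 0)) by rewrite zvec0; exact: DU.
have E (f : C -> R) : f \o (fun u => h u j) = (fun u => (f \o joint F) (row_mx u (zvec 0))).
  by apply/funext => u; rewrite /= joint_row_mx /F eqxx.
by split; rewrite E; [exact: smooth_restr sr DA|exact: smooth_restr si DA].
Qed.

Lemma near_D u : D u -> \forall v \near u, D v.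
Proof. by move=> Du; exact: open_nbhs_nbhs. Qed.

Definition pole m := Defs.coord (gam S m).2.

Definition frac_sum (r : 'I_(nb_gam S) -> C) (j : 'I_n) (c z : C) : C :=
  c + \sum_(m | (gam S m).1 == j) r m / (z - pole m).

Lemma psi_form : exists r : 'I_(nb_gam S) -> 'rV[R]_n -> C,
  (forall u j z, D u -> (j, pt_fin z) \notin codom (gam S) ->
    psi u (j, pt_fin z) = expC (ofR (u 0 j) * z) * frac_sum (r^~ u) j (h u j) z) /\
  forall u i m, D u -> pdiff i u (r m).
Proof.
have H u : exists r : 'I_(nb_gam S) -> C, D u -> forall j z, (j, pt_fin z) \notin codom (gam S) ->
    psi u (j, pt_fin z) = expC (ofR (u 0 j) * z) * frac_sum r j (h u j) z.
  (* Outside [D] there is no section to expand; the coefficients get the default 0. *)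
  have [Du|] := pselect (D u); last by exists (fun=> 0).
  by have [r Hr] := BA_form (BAF_section psiBA Du); exists r.
have [r Hr] := choice H; exists (fun m u => r u m); split.
  by move=> u j z Du zg; exact: Hr.
move=> u i m0 Du; set j := (gam S m0).1.
pose s := [seq m <- enum 'I_(nb_gam S) | (gam S m).1 == j].
pose E := [seq pole m | m <- s].
have notE z : z \notin E -> (j, pt_fin z) \notin codom (gam S).
  apply: contra => /codomP[m mE]; apply/mapP; exists m; last by rewrite /pole -mE.
  by rewrite mem_filter -mE eqxx mem_enum.
have m0s : m0 \in s by rewrite mem_filter eqxx mem_enum.
suff K : {in s, forall m, pdiff i u ((fun m v => r v m) m)} by exact: (K m0 m0s).
(* Applied to e^(-u_j z) psi_j, whose values off gamma are differentiable in u. *)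
apply: (@pdiff_partial_fractions R n _ i u s pole E
  (fun v z => expC (ofR (v 0 j) * - z) * psi v (j, pt_fin z)) (fun v => h v j)).
- move=> m1 m2; rewrite !mem_filter => /andP[/eqP m1j _] /andP[/eqP m2j _] mm.
  by apply: gam_inj; rewrite gam_fin [RHS]gam_fin m1j m2j -/(pole _) mm.
- by rewrite filter_uniq // enum_uniq.
- by move=> m ms; exact: map_f.
- move=> z /notE zg; apply: pdiffM; first exact: has_pd_pdiff (has_pd_expC _ _ _ _).
  exact: (smooth_pdiff (psi_smooth zg)).
- near=> v => z /notE zg.
  have Dv : D v by near: v; exact: near_D.
  rewrite (Hr v Dv) // mulrN mulrA [expC (- _) * _]mulrC expCNK mul1r /frac_sum.
  by rewrite big_filter big_enum_cond.
Unshelve. all: by end_near. Qed.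

(** The exponential contributes the term with z, present only for i = j: only on its own component
    does d_i psi, stripped of the exponential, grow like z. The index i of [r] is a dummy that gives
    both coefficient families one shape. *)
Lemma psi_derivative : exists r dr : 'rV[R]_n -> 'I_n -> 'I_(nb_gam S) -> C,
  forall u (i j : 'I_n) z, D u -> (j, pt_fin z) \notin codom (gam S) ->
   has_pd i u (fun v => psi v (j, pt_fin z)) (expC (ofR (u 0 j) * z) *
     ((i == j)%:R * z * frac_sum (r u i) j (h u j) z
      + frac_sum (dr u i) j (partialC i (h^~ j) u) z)).
Proof.
have [r [Hr dr]] := psi_form.
exists (fun u _ m => r m u), (fun u i m => partialC i (r m) u) => u i j z Du zg.
have dh : has_pd i u (h^~ j) (partialC i (h^~ j) u).
  by apply: pdiff_has_pd; exact: smooth_pdiff (h_smooth j) _ _ Du.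
have dfrac : has_pd i u (fun v => frac_sum (r^~ v) j (h v j) z)
    (frac_sum (fun m => partialC i (r m) u) j (partialC i (h^~ j) u) z).
  apply: has_pdD; first exact: dh.
  apply: has_pd_sum => m _.
  have := has_pdZ (z - pole m)^-1 (pdiff_has_pd (dr u i m Du)).
  by rewrite mulrC; under eq_fun do rewrite mulrC.
have := has_pdM (has_pd_expC i j u z) dfrac.
set e := expC _.
have -> : (i == j)%:R * z * e * frac_sum (r^~ u) j (h u j) z +
   e * frac_sum (fun m => partialC i (r m) u) j (partialC i (h^~ j) u) z =
   e * ((i == j)%:R * z * frac_sum (r^~ u) j (h u j) z
      + frac_sum (fun m => partialC i (r m) u) j (partialC i (h^~ j) u) z) by ring.
apply: has_pd_near; near=> v; rewrite Hr //.
by near: v; exact: near_D.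
Unshelve. all: by end_near. Qed.

End BAFamily.

(** * The form Omega *)

Section Residues.
Context {R : realType}.
Local Notation C := (cplx R).
Implicit Types (f g p q phi om : C -> C) (a z t w r : C).

Lemma cvg_derivable f z : derivable f z 1 -> f w @[w --> z^'] --> f z.
Proof. by move=> /derivable_cont/continuous_dnbhs. Qed.

(** [is_residue] allows a principal part of any length. Multiplying by t^(m+2) and letting t tend to
    0 shows that the top coefficient [c m] vanishes, which shortens it by one. *)
Lemma is_residue_unique phi r g : is_residue phi r -> derivable g 0 1 ->
  (\forall t \near (0 : C)^', phi t = g t / t) -> r = g 0.
Proof.
move=> [m [c [g' [/nbhs_singleton hg' H1]]]] hg H2.
have {H1 H2} : \forall t \near (0 : C)^', r / t + \sum_(k < m) c k / t ^+ k.+2 + g' t = g t / t.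
  by near=> t; transitivity (phi t); [apply/esym; near: t; exact: H1|near: t; exact: H2].
elim: m => [|m IH] H.
  have K1 : r + t * g' t @[t --> (0 : C)^'] --> r + 0 * g' 0.
    apply: (@cvg_derivable (fun t => r + t * g' t)).
    by apply: derC_D; [exact: derC_cst|apply: derC_M; [exact: derC_id|exact: hg']].
  have K2 : r + t * g' t @[t --> (0 : C)^'] --> g 0.
    refine (cvgC_near_eq _ (cvg_derivable hg)); near=> t.
    have t0 : t != 0 by near: t; exact: dnbhs0_neq0.
    have : r / t + \sum_(k < 0) c k / t ^+ k.+2 + g' t = g t / t by near: t.
    rewrite big_ord0 addr0 => E; apply: (mulIf (invr_neq0 t0)).
    by rewrite -E mulrDl mulrAC divff // mul1r.
  have : r + 0 * g' 0 = g 0 by exact: (cvgC_unique K1 K2).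
  by rewrite mul0r addr0.
apply: IH.
(* Off 0 this expression equals [c m]; at 0 it vanishes, every term carrying a positive power of
   t. *)
pose K t := t ^+ m.+1 * g t - (r * t ^+ m.+1 + \sum_(k < m) c k * t ^+ (m - k) + t ^+ m.+2 * g' t).
have dX (b : C) k : derivable (fun t => b * t ^+ k) 0 1.
  by apply: derC_M; [exact: derC_cst|apply: derC_X; exact: derC_id].
have dX1 k : derivable (fun t : C => t ^+ k) 0 1 by apply: derC_X; exact: derC_id.
have dK : derivable K 0 1.
  apply: derC_B; first by apply: derC_M; [exact: dX1|exact: hg].
  apply: derC_D; last by apply: derC_M; [exact: dX1|exact: hg'].
  by apply: derC_D; [exact: dX|apply: derC_sum => k _; exact: dX].
have K0 : K 0 = 0.
  rewrite /K !expr0n /= !mul0r mulr0 big1 ?addr0 ?subr0 // => k _.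
  by rewrite expr0n subn_eq0 leqNgt ltn_ord mulr0.
have cm : c m = 0.
  have K1 : c m @[t --> (0 : C)^'] --> c m by exact: cvg_cst.
  have K2 : c m @[t --> (0 : C)^'] --> K 0.
    refine (cvgC_near_eq _ (cvg_derivable dK)); near=> t.
    have t0 : t != 0 by near: t; exact: dnbhs0_neq0.
    have : r / t + \sum_(k < m.+1) c k / t ^+ k.+2 + g' t = g t / t by near: t.
    rewrite big_ord_recr /= => E; rewrite /K.
    have tm : t ^+ m.+2 != 0 by rewrite expf_neq0.
    have -> : t ^+ m.+1 * g t = t ^+ m.+2 * (g t / t).
      by rewrite [t ^+ m.+2]exprS; field.
    rewrite -E !mulrDr.
    have -> : t ^+ m.+2 * (r / t) = r * t ^+ m.+1 by rewrite [t ^+ m.+2]exprS; field.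
    have -> : t ^+ m.+2 * (c m / t ^+ m.+2) = c m by field.
    have -> : t ^+ m.+2 * (\sum_(k < m) c k / t ^+ k.+2) = \sum_(k < m) c k * t ^+ (m - k).
      rewrite mulr_sumr; apply: eq_bigr => k _.
      have {1}-> : m.+2 = (k.+2 + (m - k))%N by rewrite !addSn subnKC // ltnW.
      by rewrite exprD; field; rewrite expf_neq0.
    by ring.
  by rewrite -K0; exact: (cvgC_unique K1 K2).
near=> t; have : r / t + \sum_(k < m.+1) c k / t ^+ k.+2 + g' t = g t / t by near: t.
by rewrite big_ord_recr /= cm mul0r addr0.
Unshelve. all: by end_near. Qed.

(* For rational [p] this gives the holomorphic extension of the difference
   quotient at 0, which for a general [p] would need Riemann's theorem. *)
Definition taylor1 p := holomorphic_at p 0 /\ exists q, holomorphic_at q 0 /\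
  \forall t \near (0 : C), p t = p 0 + t * q t.

Lemma holomorphic_cst c : holomorphic_at (fun _ : C => c) 0.
Proof. by near=> t; exact: derC_cst. Unshelve. all: by end_near. Qed.

Lemma holomorphic_id : holomorphic_at (fun t : C => t) 0.
Proof. by near=> t; exact: derC_id. Unshelve. all: by end_near. Qed.

Lemma holomorphicD f g : holomorphic_at f 0 -> holomorphic_at g 0 ->
  holomorphic_at (fun t => f t + g t) 0.
Proof. by move=> hf hg; apply: filterS2 hf hg => t; exact: derC_D. Qed.

Lemma holomorphicM f g : holomorphic_at f 0 -> holomorphic_at g 0 ->
  holomorphic_at (fun t => f t * g t) 0.
Proof. by move=> hf hg; apply: filterS2 hf hg => t; exact: derC_M. Qed.

Lemma near_neq0 f : derivable f 0 1 -> f 0 != 0 -> \forall t \near (0 : C), f t != 0.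
Proof.
move=> /derivable_cont cf f0.
have e0 : 0 < nrm (f 0) by rewrite nrm_gt0.
near=> t; have : nrm (f t - f 0) < nrm (f 0).
  by near: t; exact: ((cvgCP _ _ _).1 cf _ e0).
by apply: contraTneq => ->; rewrite sub0r nrmN ltxx.
Unshelve. all: by end_near. Qed.

Lemma holomorphicV f : holomorphic_at f 0 -> f 0 != 0 ->
  holomorphic_at (fun t => (f t)^-1) 0.
Proof.
move=> hf f0; have N := near_neq0 (nbhs_singleton hf) f0.
by apply: filterS2 N hf => t; exact: derC_V.
Qed.

Lemma taylor1_cst c : taylor1 (fun=> c).
Proof.
split; first exact: holomorphic_cst.
exists (fun=> 0); split; first exact: holomorphic_cst.
by near=> t; rewrite mulr0 addr0.
Unshelve. all: by end_near. Qed.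

Lemma taylor1_shift a : taylor1 (fun t => a + t).
Proof.
split; first by apply: holomorphicD; [exact: holomorphic_cst|exact: holomorphic_id].
exists (fun=> 1); split; first exact: holomorphic_cst.
by near=> t; rewrite mulr1 addr0.
Unshelve. all: by end_near. Qed.

Lemma taylor1M p1 p2 : taylor1 p1 -> taylor1 p2 -> taylor1 (fun t => p1 t * p2 t).
Proof.
move=> [h1 [q1 [hq1 E1]]] [h2 [q2 [hq2 E2]]]; split; first exact: (holomorphicM h1 h2).
exists (fun t => q1 t * p2 t + p1 0 * q2 t); split.
  apply: holomorphicD; apply: holomorphicM; [exact: hq1|exact: h2| |exact: hq2].
  exact: holomorphic_cst.
near=> t.
have -> : p1 t = p1 0 + t * q1 t by near: t.
have -> : p2 t = p2 0 + t * q2 t by near: t.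
ring.
Unshelve. all: by end_near. Qed.

Lemma taylor1V p : taylor1 p -> p 0 != 0 -> taylor1 (fun t => (p t)^-1).
Proof.
move=> [h1 [q [hq E]]] p0; split; first exact: (holomorphicV h1 p0).
exists (fun t => - (p 0)^-1 * (q t * (p t)^-1)); split.
  apply: holomorphicM; first exact: holomorphic_cst.
  by apply: holomorphicM; [exact: hq|exact: holomorphicV h1 p0].
have N := near_neq0 (nbhs_singleton h1) p0.
near=> t; have pt0 : p t != 0 by near: t.
have Et : p t = p 0 + t * q t by near: t.
have -> : t * (- (p 0)^-1 * (q t / p t)) = - (p 0)^-1 * (t * q t / p t) by ring.
have -> : t * q t = p t - p 0 by rewrite Et addrAC subrr add0r.
by field; rewrite p0 pt0.
Unshelve. all: by end_near. Qed.

Lemma taylor1X p n : taylor1 p -> taylor1 (fun t => p t ^+ n).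
Proof.
move=> tp; elim: n => [|n IH].
  have -> : (fun t => p t ^+ 0) = (fun=> 1) by apply/funext => t; rewrite expr0.
  exact: taylor1_cst.
have -> : (fun t => p t ^+ n.+1) = (fun t => p t * p t ^+ n).
  by apply/funext => t; rewrite exprS.
exact: taylor1M.
Qed.

Lemma taylor1_exprz p (k : int) : taylor1 p -> p 0 != 0 -> taylor1 (fun t => p t ^ k).
Proof.
move=> tp p0; case: k => n; first exact: (taylor1X n tp).
by apply: (@taylor1V (fun t => p t ^+ n.+1)); [exact: taylor1X|rewrite expf_neq0].
Qed.

Lemma taylor1_prod (I : Type) (s : seq I) (P : pred I) (f : I -> C -> C) :
  (forall i, P i -> taylor1 (f i)) -> taylor1 (fun t => \prod_(i <- s | P i) f i t).
Proof.
move=> H; elim: s => [|i s IH].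
  have -> : (fun t : C => \prod_(i <- [::] | P i) f i t) = (fun=> 1).
    by apply/funext => t; rewrite big_nil.
  exact: taylor1_cst.
have -> : (fun t : C => \prod_(j <- i :: s | P j) f j t) =
    (fun t => (if P i then f i t else 1) * \prod_(j <- s | P j) f j t).
  by apply/funext => t; rewrite big_cons; case: ifP; rewrite ?mul1r.
apply: taylor1M; last exact: IH.
by case Pi : (P i); [exact: H|exact: taylor1_cst].
Qed.

End Residues.

(** * Functions with prescribed orders are rational *)

Section RationalForms.
Context {R : realType}.
Local Notation C := (cplx R).
Implicit Types (f g p q om G : C -> C) (a z t w r : C).

Lemma nbhs_dnbhsC a (P : set C) : (\forall z \near a, P z) -> \forall z \near a^', P z.
Proof. by move=> H; exact: (@cvg_within _ (nbhs a) _ _ _ H). Qed.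

(** The values of [f] at its singular points are arbitrary, so constancy is asserted on punctured
    neighbourhoods. It is the partial fraction expansion over an empty list of poles. *)
Lemma removable_cst f l : (forall a, exists G, holomorphic_at G 0 /\
    \forall t \near (0 : C)^', f (a + t) = G t) ->
  f w^-1 @[w --> (0 : C)^'] --> l ->
  forall a, \forall t \near (0 : C)^', f (a + t) = l.
Proof.
move=> fG fl a.
have sp b : simple_pole f b ((fun=> 0) b).
  have [G [hG E]] := fG b; exists (fun t => t * G t); split.
  - by apply: holomorphicM; [exact: holomorphic_id|exact: hG].
  - by rewrite mul0r.
  - apply: filterS2 dnbhs0_neq0 E => t t0 ->.
    by rewrite mulrAC divff // mul1r.
apply: (dnbhs_shift a (fun z => f z = l)).2.
apply: filterS (simple_pole_derivable (sp a)) => z /derivable_cont cz.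
have := @partial_fractions R f (fun=> 0) [::] isT (fun _ _ => erefl) sp l fl z isT cz.
by rewrite big_nil addr0.
Qed.

(** Only the sign of m counts. For m >= 0, [f] has a limit at infinity; for m < 0 its inverse tends
    to 0 there, hence would vanish, which is absurd. *)
Lemma nowhere_zero_cst f (m : int) :
  (forall a, exists G, [/\ holomorphic_at G 0, G 0 != 0
     & \forall t \near (0 : C)^', f (a + t) = G t]) ->
  has_order (fun w => f w^-1) m ->
  exists l, forall a, \forall t \near (0 : C)^', f (a + t) = l.
Proof.
move=> fG [G [hG G0] E].
have [m0|m0] := leP 0 m.
  exists (G 0 * 0 ^ m); apply: removable_cst.
    by move=> a; have [G' [h _ E']] := fG a; exists G'.
  have K : G t * t ^ m @[t --> (0 : C)^'] --> G 0 * 0 ^ m.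
    apply: (@cvg_derivable R (fun t => G t * t ^ m)).
    apply: derC_M; first exact: nbhs_singleton hG.
    by case: m m0 {E} => // k _; apply: derC_X; exact: derC_id.
  by refine (cvgC_near_eq _ K); apply: filterS E => w ->.
exfalso; case: m m0 E => // k _ E.
have inf : (f w^-1)^-1 @[w --> (0 : C)^'] --> 0.
  have K : (G t)^-1 * t ^+ k.+1 @[t --> (0 : C)^'] --> (G 0)^-1 * 0 ^+ k.+1.
    apply: (@cvg_derivable R (fun t => (G t)^-1 * t ^+ k.+1)).
    apply: derC_M; last by apply: derC_X; exact: derC_id.
    by apply: derC_V; [exact: G0|exact: nbhs_singleton hG].
  rewrite expr0n mulr0 in K; refine (cvgC_near_eq _ K).
  by apply: filterS E => w ->; rewrite invfM NegzE -exprnN invrK.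
have [G' [hG' G'0 E']] := fG 0.
have H : \forall t \near (0 : C)^', (f (0 + t))^-1 = 0.
  apply: (@removable_cst (fun z => (f z)^-1)); last exact: inf.
  move=> a; have [G1 [h1 n1 E1]] := fG a; exists (fun t => (G1 t)^-1); split.
    exact: holomorphicV.
  by apply: filterS E1 => t ->.
have N := nbhs_dnbhsC (near_neq0 (nbhs_singleton hG') G'0).
have [t []] := filter_ex (filterI H (filterI E' N)).
move=> /eqP; rewrite invr_eq0 => /eqP f0 [E0 nz].
by move: nz; rewrite -E0 f0 eqxx.
Qed.

Lemma prod_expz_shift (K : fieldType) (k : K -> int) (L : seq K) (a t : K) : uniq L ->
  (forall a : K, a \notin L -> k a = 0) ->
  \prod_(e <- L) (a + t - e) ^ k e = t ^ k a * \prod_(e <- L | e != a) ((a - e) + t) ^ k e.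
Proof.
move=> uL kL; have [aL|aL] := boolP (a \in L).
  rewrite (bigD1_seq a aL uL) /= [a + t - a]addrAC subrr add0r; congr (_ * _).
  by apply: eq_bigr => e _; rewrite addrAC.
rewrite (kL a aL) expr0z mul1r big_seq [RHS]big_seq_cond; apply: eq_big => e.
  by case: eqVneq => [->|_]; rewrite ?(negbTE aL) ?andbT.
by rewrite addrAC.
Qed.

Lemma prod_expz_inv (K : fieldType) (k : K -> int) (L : seq K) (w : K) : w != 0 ->
  \prod_(e <- L) (w^-1 - e) ^ k e =
    w ^ (- \sum_(e <- L) k e) * \prod_(e <- L) (1 + (- e * w)) ^ k e.
Proof.
move=> w0; elim: L => [|e s IH]; first by rewrite !big_nil oppr0 expr0z mulr1.
rewrite !big_cons IH opprD (expfzDr _ _ w0) mulrACA; congr (_ * _).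
rewrite -exprz_inv -expfzMl; congr (_ ^ _).
by rewrite mulrDr mulr1 mulrCA (mulVf w0) mulr1.
Qed.

(* Liouville, applied to the quotient of om by the rational function with the
   same divisor (or to its inverse). *)
Lemma rational_germ om (k : C -> int) (L : seq C) (m : int) : uniq L ->
  (forall a, a \notin L -> k a = 0) ->
  (forall a, has_order (fun t => om (a + t)) (k a)) ->
  has_order (fun w => om w^-1) m ->
  forall a, exists p, taylor1 p /\ \forall t \near (0 : C)^', om (a + t) = p t * t ^ k a.
Proof.
move=> uL kL ord ordinf.
pose Pi z := \prod_(e <- L) (z - e) ^ k e.
pose P a t := \prod_(e <- L | e != a) ((a - e) + t) ^ k e.
have P_taylor a : taylor1 (P a).
  apply: taylor1_prod => e ea; apply: taylor1_exprz; first exact: taylor1_shift.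
  by rewrite addr0 subr_eq0 eq_sym.
have P0 a : P a 0 != 0.
  rewrite /P prodf_seq_neq0; apply/allP => e _; apply/implyP => ea.
  by rewrite expfz_neq0 // addr0 subr_eq0 eq_sym.
have PiE a t : Pi (a + t) = t ^ k a * P a t.
  exact: prod_expz_shift.
have [l Hl] : exists l, forall a, \forall t \near (0 : C)^', om (a + t) / Pi (a + t) = l.
  apply: (@nowhere_zero_cst (fun z => om z / Pi z) (m + \sum_(e <- L) k e)).
    move=> a; have [g [hg g0] E] := ord a.
    exists (fun t => g t * (P a t)^-1); split.
    - apply: holomorphicM; first exact: hg.
      by apply: holomorphicV; [exact: (P_taylor a).1|exact: P0].
    - by rewrite mulf_neq0 // invr_neq0.
    - apply: filterS2 dnbhs0_neq0 E => t t0 ->; rewrite PiE invfM mulrA mulfK; last by rewrite expfz_neq0.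
      by [].
  have [g [hg g0] E] := ordinf.
  pose Q w := \prod_(e <- L) (1 + (- e * w)) ^ k e.
  have Q_taylor : taylor1 Q.
    apply: taylor1_prod => e _; apply: taylor1_exprz; last by rewrite mulr0 addr0 oner_neq0.
    have -> : (fun w => 1 + - e * w) = (fun w => 1 + - e * (0 + w)).
      by apply/funext => w; rewrite add0r.
    split.
      by apply: holomorphicD; [exact: holomorphic_cst|exact: (taylor1M (taylor1_cst (- e)) (taylor1_shift 0)).1].
    exists (fun=> - e); split; first exact: holomorphic_cst.
    by near=> w; rewrite addr0 mulr0 addr0 add0r mulrC.
  have Q0 : Q 0 != 0.
    rewrite /Q prodf_seq_neq0; apply/allP => e _; apply/implyP => _.
    by rewrite expfz_neq0 // mulr0 addr0 oner_neq0.
  exists (fun w => g w * (Q w)^-1).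
    split; last by rewrite mulf_neq0 // invr_neq0.
    apply: holomorphicM; first exact: hg.
    by apply: holomorphicV; [exact: Q_taylor.1|exact: Q0].
  apply: filterS2 dnbhs0_neq0 E => w w0 ->.
  rewrite [Pi _]prod_expz_inv // -/(Q w) (invfM (w ^ _)) -invr_expz invrK expfzDr //.
  by rewrite -!mulrA; congr (_ * _); rewrite [RHS]mulrC -!mulrA.
move=> a; exists (fun t => l * P a t); split.
  by apply: taylor1M; [exact: taylor1_cst|exact: P_taylor].
have N := nbhs_dnbhsC (near_neq0 (nbhs_singleton (P_taylor a).1) (P0 a)).
apply: filterS3 dnbhs0_neq0 N (Hl a) => t t0 Pt <-.
by rewrite PiE -mulrA [_ * t ^ _]mulrC divfK // mulf_neq0 ?expfz_neq0.
Unshelve. all: by end_near. Qed.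

(** [residue] is a choice, so some residue is exhibited and uniqueness identifies it with the value
    of t om at 0. When k = -1, the holomorphic remainder is the quotient supplied by [taylor1]. *)
Lemma simple_pole_residue om a (k : int) p : taylor1 p -> -1 <= k ->
  (\forall t \near (0 : C)^', om (a + t) = p t * t ^ k) ->
  simple_pole om a (residue (fun t => om (a + t))).
Proof.
move=> [hp [q [hq pq]]] k1 E.
have hX j : holomorphic_at (fun t : C => t ^+ j) 0.
  have -> : (fun t : C => t ^+ j) = (fun t => (0 + t) ^+ j).
    by apply/funext => t; rewrite add0r.
  exact: (taylor1X j (taylor1_shift 0)).1.
have [r Hr] : exists r, is_residue (fun t => om (a + t)) r.
  case: k k1 E => [k|[|//]] _ E.
    exists 0, 0%N, (fun=> 0), (fun t => p t * t ^+ k); split.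
      apply: holomorphicM; [exact: hp|exact: hX].
    by apply: filterS E => t ->; rewrite big_ord0 mul0r !add0r.
  exists (p 0), 0%N, (fun=> 0), q; split; first exact: hq.
  have pq' := nbhs_dnbhsC pq.
  apply: filterS3 dnbhs0_neq0 pq' E => t t0 pt ->.
  by rewrite big_ord0 addr0 pt mulrDl [t * _]mulrC mulfK.
have {Hr} := xgetPex 0 (ex_intro _ r Hr); rewrite -/(residue _) => Hr.
exists (fun t => p t * t ^ (k + 1)).
have E2 : \forall t \near (0 : C)^', om (a + t) = p t * t ^ (k + 1) / t.
  by apply: filterS2 dnbhs0_neq0 E => t t0 ->; rewrite expfzDr // expr1z mulrA mulfK.
have h2 : holomorphic_at (fun t => p t * t ^ (k + 1)) 0.
  apply: holomorphicM; first exact: hp.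
  have k0 : 0 <= k + 1 by rewrite -lerBlDr sub0r.
  by rewrite -(gez0_abs k0); exact: hX.
split; [exact: h2|apply/esym|exact: E2].
exact: is_residue_unique Hr (nbhs_singleton h2) E2.
Qed.

End RationalForms.

(** * Local expansions of Omega *)

Section Form.
Context {R : realType} {n : nat}.
Local Notation C := (cplx R).
Local Notation point := (curve_point R n).
Variables (S : spectral_data R n) (sigma : point -> point) (omega : point -> C).
Hypothesis sigmaS : sigma_data S sigma.
Hypothesis omegaS : Omega_data S sigma omega.

Let nodes := codom (fst \o node S) ++ codom (snd \o node S).

Lemma singularE x : singular (node S) x = (x \in nodes).
Proof.
rewrite mem_cat; apply/existsP/orP => [[s /orP[/eqP->|/eqP->]]|].
- by left; apply/codomP; exists s.
- by right; apply/codomP; exists s.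
by case=> /codomP[s ->]; exists s; rewrite /= eqxx ?orbT.
Qed.

(** The order of Omega can be nonzero only at points of the two divisors and at nodes; being
    finitely many, they make Omega rational on each component. *)
Lemma omega_germ : exists k : point -> int, forall x,
  [/\ Num.max (k x) 0 = (count_mem x (zero_divisor S sigma))%:Z,
      ~~ singular (node S) x ->
        Num.max (- k x) 0 = (count_mem x (pole_divisor S sigma))%:Z,
      singular (node S) x -> -1 <= k x
    & forall j a, x = (j, pt_fin a) -> exists p, taylor1 p /\
      \forall t \near (0 : C)^', omega (j, pt_fin (a + t)) = p t * t ^ k x].
Proof.
have H x : exists k : int, has_order (form_at omega x) k /\
   [/\ Num.max k 0 = (count_mem x (zero_divisor S sigma))%:Z,
          ~~ singular (node S) x ->
            Num.max (- k) 0 = (count_mem x (pole_divisor S sigma))%:Z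
        & singular (node S) x -> -1 <= k].
  by have [k ? ?] := Omega_order omegaS x; exists k.
have [k Hk] := choice H; exists k => x; have [_ [k1 k2 k3]] := Hk x.
split; [exact: k1|exact: k2|exact: k3|move=> j a xE].
pose L := undup [seq Defs.coord y.2 | y <- zero_divisor S sigma ++ pole_divisor S sigma ++ nodes].
(* The 2 comes from dz = - dt / t^2 at infinity. [L] merges the coordinates from all components,
   which is harmless: the order may be 0 at a member of [L]. *)
rewrite xE; apply: (@rational_germ R (fun z => omega (j, pt_fin z)) (fun z => k (j, pt_fin z)) L
   (k (Ppt j) + 2)).
- exact: undup_uniq.
- move=> b bL; have [_ [b1 b2 _]] := Hk (j, pt_fin b).
  have bn : (j, pt_fin b) \notin zero_divisor S sigma ++ pole_divisor S sigma ++ nodes.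
    by apply: contra bL => bin; rewrite mem_undup; apply/mapP; exists (j, pt_fin b).
  rewrite !mem_cat !negb_or -!andbA in bn.
  have nz : (j, pt_fin b) \notin zero_divisor S sigma.
    by rewrite !mem_cat !negb_or; case/and5P: bn => -> -> ->.
  have np : (j, pt_fin b) \notin pole_divisor S sigma.
    rewrite !mem_cat !negb_or; case/and5P: bn => _ _ _ -> /and3P[-> -> _] //.
  have ns : ~~ singular (node S) (j, pt_fin b).
    by rewrite singularE mem_cat negb_or; case/and5P: bn => _ _ _ _ /and4P[_ _ -> ->].
  move: b1 (b2 ns); rewrite (count_memPn nz) (count_memPn np).
  move=> /max_idPr k_le0 /max_idPr k_ge0; apply/eqP; rewrite eq_le k_le0 /=.
  by rewrite -oppr_le0.
- by move=> b; exact: (Hk (j, pt_fin b)).1.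
- have [g [hg g0] E] := (Hk (Ppt j)).1; exists (fun w => - g w).
    split; last by rewrite oppr_eq0.
    by apply: filterS hg => w; exact: derC_N.
  apply: filterS2 dnbhs0_neq0 E => w w0; rewrite /form_at /= => E.
  rewrite (expfzDr _ _ w0) mulrA mulNr -E -[w ^ 2]/(w ^+ 2).
  by rewrite mulNr divfK ?opprK // expf_neq0.
Qed.

Lemma simple_pole_Res (k : point -> int) j a :
  -1 <= k (j, pt_fin a) ->
  (exists p, taylor1 p /\ \forall t \near (0 : C)^',
     omega (j, pt_fin (a + t)) = p t * t ^ k (j, pt_fin a)) ->
  simple_pole (fun z => omega (j, pt_fin z)) a (Res omega (j, pt_fin a)).
Proof. by move=> k1 [p [tp E]]; exact: (simple_pole_residue tp k1 E). Qed.

(** With z = 1 / w, the form eps_j^2 w dw is -eps_j^2 z^-3 dz. *)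
Lemma form_at_P_limit eps j : Omega_expansion omega eps ->
  w^-1 ^+ 3 * omega (j, pt_fin w^-1) @[w --> (0 : C)^'] --> - eps j ^+ 2.
Proof.
move=> /(_ j)/eqO_exP[k k0 H].
have [b b0 kE] := C_gt0 k0.
apply: (cvgCP _ _ _).2 => e e0.
have d0 : 0 < e / (b + 1) by rewrite divr_gt0 // addr_gt0.
have small : \forall w \near (0 : C)^', nrm w < e / (b + 1).
  by apply: (dnbhsCP _ _).2; exists (e / (b + 1)) => // w _; rewrite subr0.
apply: filterS3 dnbhs0_neq0 H small => w w0; rewrite kE !normCE -ofRM ler_ofR => Hw ws.
rewrite /form_at /= in Hw.
have -> : w^-1 ^+ 3 * omega (j, pt_fin w^-1) - - eps j ^+ 2 =
   - (w^-1 * (- omega (j, pt_fin w^-1) / w ^+ 2 - eps j ^+ 2 * w)).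
  by field.
have nw : 0 < nrm w by rewrite nrm_gt0.
rewrite nrmN nrmM nrmV ltr_pdivrMl //; apply: (le_lt_trans Hw).
rewrite expr2 nrmM mulrCA ltr_pM2l //.
rewrite ltr_pdivlMr ?addr_gt0 // in ws; apply: le_lt_trans ws.
by rewrite mulrC ler_wpM2l ?nrm_ge0 // lerDl.
Qed.

End Form.

(** * The bilinear residue identity *)

Section Amplitudes.
Context {R : realType} {n : nat}.
Local Notation C := (cplx R).
Local Notation point := (curve_point R n).
Variable S : spectral_data R n.
Implicit Types (r : 'I_(nb_gam S) -> C) (j : 'I_n) (a c z w t : C).

Lemma taylor1D (p1 p2 : C -> C) : taylor1 p1 -> taylor1 p2 -> taylor1 (fun t => p1 t + p2 t).
Proof.
move=> [h1 [q1 [hq1 E1]]] [h2 [q2 [hq2 E2]]]; split; first exact: (holomorphicD h1 h2).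
exists (fun t => q1 t + q2 t); split; first exact: (holomorphicD hq1 hq2).
by apply: filterS2 E1 E2 => t -> ->; ring.
Qed.

Lemma taylor1_sum (I : Type) (s : seq I) (P : pred I) (f : I -> C -> C) :
  (forall i, P i -> taylor1 (f i)) -> taylor1 (fun t => \sum_(i <- s | P i) f i t).
Proof.
move=> H; elim: s => [|i s IH].
  have -> : (fun t : C => \sum_(i <- [::] | P i) f i t) = (fun=> 0).
    by apply/funext => t; rewrite big_nil.
  exact: taylor1_cst.
have -> : (fun t : C => \sum_(j <- i :: s | P j) f j t) =
    (fun t => (if P i then f i t else 0) + \sum_(j <- s | P j) f j t).
  by apply/funext => t; rewrite big_cons; case: ifP; rewrite ?add0r.
apply: taylor1D; last exact: IH.
by case Pi : (P i); [exact: H|exact: taylor1_cst].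
Qed.

Lemma taylor1_frac (c a e : C) : a != e -> taylor1 (fun t => c / (a + t - e)).
Proof.
move=> ae; have -> : (fun t => c / (a + t - e)) = (fun t => c * ((a - e) + t)^-1).
  by apply/funext => t; rewrite addrAC.
apply: taylor1M; first exact: taylor1_cst.
by apply: taylor1V; [exact: taylor1_shift|rewrite addr0 subr_eq0].
Qed.

Lemma frac_sum_taylor1 r j c a : (j, pt_fin a) \notin codom (gam S) ->
  taylor1 (fun t => frac_sum r j c (a + t)).
Proof.
move=> ag; apply: taylor1D; first exact: taylor1_cst.
apply: taylor1_sum => m /eqP mj; apply: taylor1_frac.
by apply: contraNneq ag => ->; apply/codomP; exists m; rewrite gam_fin mj.
Qed.

Lemma frac_sum_pole r j c a : (j, pt_fin a) \in codom (gam S) ->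
  exists g, taylor1 g /\ forall t, t != 0 -> frac_sum r j c (a + t) = g t / t.
Proof.
move=> /codomP[m0 m0E].
exists (fun t => t * (c + \sum_(m | ((gam S m).1 == j) && (m != m0)) r m / (a + t - pole m)) + r m0).
have jm : (gam S m0).1 == j by rewrite -m0E.
have am : a = pole m0 by rewrite /pole -m0E.
split.
  apply: taylor1D; last exact: taylor1_cst.
  apply: taylor1M.
    have -> : (fun t : C => t) = (fun t => 0 + t) by apply/funext => t; rewrite add0r.
    exact: taylor1_shift.
  apply: taylor1D; first exact: taylor1_cst.
  apply: taylor1_sum => m /andP[/eqP mj mm]; apply: taylor1_frac.
  apply: contra_neq mm => E; apply: gam_inj; rewrite -m0E gam_fin mj.
  by rewrite E.
move=> t t0; rewrite /frac_sum (bigD1 m0 jm) /= -am.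
have -> : a + t - a = t by ring.
by field.
Qed.

(** The values k = 1 and k = -1 serve for the arguments z and sigma z = -z. *)
Lemma frac_sum_inf r j c k : k != 0 ->
  frac_sum r j c (k * w^-1) @[w --> (0 : C)^'] --> c.
Proof.
move=> k0.
pose G w := c + \sum_(m | (gam S m).1 == j) r m * (w * (k - w * pole m)^-1).
have dG : derivable G 0 1.
  apply: derC_D; first exact: derC_cst.
  apply: derC_sum => m _; apply: derC_M; first exact: derC_cst.
  apply: derC_M; first exact: derC_id.
  apply: derC_V; first by rewrite mul0r subr0.
  apply: derC_B; first exact: derC_cst.
  by apply: derC_M; [exact: derC_id|exact: derC_cst].
have G0 : G 0 = c by rewrite /G big1 ?addr0 // => m _; rewrite mul0r mulr0.
have := cvg_derivable dG; rewrite G0 => K; refine (cvgC_near_eq _ K).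
have kw (m : 'I_(nb_gam S)) : \forall w \near (0 : C)^', k - w * pole m != 0.
  apply: nbhs_dnbhsC; apply: (@near_neq0 R (fun w => k - w * pole m)).
    apply: derC_B; first exact: derC_cst.
    by apply: derC_M; [exact: derC_id|exact: derC_cst].
  by rewrite mul0r subr0.
have kwall : \forall w \near (0 : C)^', forall m : 'I_(nb_gam S), k - w * pole m != 0.
  exact: filter_forall.
apply: filterS2 dnbhs0_neq0 kwall => w w0 kwm; rewrite /G /frac_sum; congr (_ + _).
apply: eq_bigr => m _; congr (_ * _).
have -> : k * w^-1 - pole m = (k - w * pole m) / w by field.
by rewrite invfM invrK mulrC.
Qed.

(** The shape of the rational factor of d_i psi_j beside the exponential; [d] stands for the
    Kronecker symbol delta_ij. *)
Definition amplitude (d : C) r1 c1 r2 c2 j z : C :=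
  d * z * frac_sum r1 j c1 z + frac_sum r2 j c2 z.

Lemma amplitude_taylor1 d r1 c1 r2 c2 j a : (j, pt_fin a) \notin codom (gam S) ->
  taylor1 (fun t => amplitude d r1 c1 r2 c2 j (a + t)).
Proof.
move=> ag; apply: taylor1D; last exact: frac_sum_taylor1.
apply: taylor1M; last exact: frac_sum_taylor1.
by apply: taylor1M; [exact: taylor1_cst|exact: taylor1_shift].
Qed.

Lemma amplitude_pole d r1 c1 r2 c2 j a : (j, pt_fin a) \in codom (gam S) ->
  exists g, taylor1 g /\ forall t, t != 0 -> amplitude d r1 c1 r2 c2 j (a + t) = g t / t.
Proof.
move=> ag; have [g1 [h1 E1]] := frac_sum_pole r1 c1 ag.
have [g2 [h2 E2]] := frac_sum_pole r2 c2 ag.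
exists (fun t => d * (a + t) * g1 t + g2 t); split.
  apply: taylor1D; last exact: h2.
  apply: taylor1M; last exact: h1.
  by apply: taylor1M; [exact: taylor1_cst|exact: taylor1_shift].
by move=> t t0; rewrite /amplitude E1 // E2 // mulrA -mulrDl.
Qed.

(* The exponents are arranged so that, multiplied by the order of Omega, they
   cancel at every point that is neither a node nor a point of Q. *)
Lemma amplitude_order d r1 c1 r2 c2 j a :
  ((j, pt_fin a) \in codom (Rpt S) -> amplitude d r1 c1 r2 c2 j a = 0) ->
  exists g, holomorphic_at g 0 /\ \forall t \near (0 : C)^',
    amplitude d r1 c1 r2 c2 j (a + t) = g t *
      t ^ (Posz ((j, pt_fin a) \in codom (Rpt S)) - Posz ((j, pt_fin a) \in codom (gam S))).
Proof.
move=> AR; have [ag|ag] := boolP ((j, pt_fin a) \in codom (gam S)).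
  have -> : ((j, pt_fin a) \in codom (Rpt S)) = false.
    apply/negP => /codomP[m mE]; move: ag; rewrite mE; exact/negP/Rpt_notin_gam.
  have [g [hg E]] := amplitude_pole d r1 c1 r2 c2 ag.
  exists g; split; first exact: hg.1.
  by apply: filterS dnbhs0_neq0 => t t0; rewrite E.
have [hA [q [hq Aq]]] := amplitude_taylor1 d r1 c1 r2 c2 ag.
move: AR; case: (_ \in codom (Rpt S)) => [/(_ isT) A0|_].
  exists q; split; first exact: hq.
  apply: filterS (nbhs_dnbhsC Aq) => t ->.
  by rewrite addr0 A0 add0r subr0 expr1z mulrC.
exists (fun t => amplitude d r1 c1 r2 c2 j (a + t)); split; first exact: hA.
by apply: nearW => t; rewrite subrr expr0z mulr1.
Qed.

Lemma amplitude_inf d r1 c1 r2 c2 j k : k != 0 ->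
  w * amplitude d r1 c1 r2 c2 j (k * w^-1) @[w --> (0 : C)^'] --> k * d * c1.
Proof.
move=> k0; have H : k * d * frac_sum r1 j c1 (k * w^-1) + w * frac_sum r2 j c2 (k * w^-1)
    @[w --> (0 : C)^'] --> k * d * c1 + 0 * c2.
  apply: cvgD; apply: cvgM.
  - exact: cvg_cst.
  - exact: frac_sum_inf.
  - exact: cvg_within.
  - exact: frac_sum_inf.
rewrite mul0r addr0 in H; refine (cvgC_near_eq _ H).
by apply: filterS dnbhs0_neq0 => w w0; rewrite /amplitude; field.
Qed.

Lemma amplitude_inf0 r1 c1 r2 c2 j k : k != 0 ->
  amplitude 0 r1 c1 r2 c2 j (k * w^-1) @[w --> (0 : C)^'] --> c2.
Proof.
move=> k0; refine (cvgC_near_eq _ (@frac_sum_inf r2 j c2 k k0)).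
by apply: nearW => w; rewrite /amplitude !mul0r add0r.
Qed.

End Amplitudes.

(** * Local residues of the bilinear form *)

Section LocalResidue.
Context {R : realType} {n : nat}.
Local Notation C := (cplx R).
Local Notation point := (curve_point R n).
Variables (S : spectral_data R n) (sigma : point -> point) (omega : point -> C).
Hypothesis sigmaS : sigma_data S sigma.
Hypothesis omegaS : Omega_data S sigma omega.

Lemma near_opp (P : set C) : (\forall t \near (0 : C)^', P t) -> \forall t \near (0 : C)^', P (- t).
Proof.
move=> /(dnbhsCP _ _).1[d d0 H]; apply: (dnbhsCP _ _).2; exists d => // t t0.
by rewrite subr0 => td; apply: H; rewrite ?oppr_eq0 // subr0 nrmN.
Qed.

Lemma holomorphic_opp (g : C -> C) : holomorphic_at g 0 -> holomorphic_at (fun t => g (- t)) 0.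
Proof.
move=> hg; have [d d0 H] := (nbhsCP 0 (fun z => derivable g z 1)).1 hg.
apply: (nbhsCP 0 (fun t => derivable (fun t => g (- t)) t 1)).2.
exists d; first exact: d0.
move=> t; rewrite subr0 => td; apply: (@derivable_comp R (fun t => - t) g).
  by apply: derC_N; exact: derC_id.
by apply: H; rewrite subr0 nrmN.
Qed.

Lemma taylor1_opp (g : C -> C) : taylor1 g -> taylor1 (fun t => g (- t)).
Proof.
move=> [hg [q [hq E]]]; split; first exact: holomorphic_opp.
exists (fun t => - q (- t)); split.
  by apply: filterS (holomorphic_opp hq) => t; exact: derC_N.
move/(nbhsCP _ _).1 : E => [d d0 H]; apply: (nbhsCP _ _).2; exists d => // t.
rewrite subr0 => td; rewrite oppr0 mulrN -mulNr; apply: H.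
by rewrite subr0 nrmN.
Qed.

Lemma simple_poleM (f P : C -> C) a r : simple_pole f a r ->
  holomorphic_at (fun t => P (a + t)) 0 ->
  simple_pole (fun z => P z * f z) a (P a * r).
Proof.
move=> [g [hg g0 E]] hP; exists (fun t => P (a + t) * g t); split.
- by apply: holomorphicM; [exact: hP|exact: hg].
- by rewrite addr0 g0.
- by apply: filterS E => t ->; rewrite mulrA.
Qed.

Lemma sigma_glued_singular x : singular (node S) x -> singular (node S) (sigma x).
Proof.
have sglue := inv_glued (sigma_involution sigmaS).
move=> /existsP[m /orP[/eqP xE|/eqP xE]].
  have /sglue/existsP[k] : glued (node S) (node S m).1 (node S m).2.
    by apply/existsP; exists m; rewrite -surjective_pairing eqxx.
  by rewrite -xE => /orP[/eqP E|/eqP E]; apply/existsP; exists k; rewrite E eqxx ?orbT.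
have /sglue/existsP[k] : glued (node S) (node S m).2 (node S m).1.
  by apply/existsP; exists m; rewrite -surjective_pairing eqxx orbT.
by rewrite -xE => /orP[/eqP E|/eqP E]; apply/existsP; exists k; rewrite E eqxx ?orbT.
Qed.

Lemma sigma_codom (I : finType) (f : I -> point) x :
  (x \in codom (sigma \o f)) = (sigma x \in codom f).
Proof.
have sK := inv_involutive (sigma_involution sigmaS).
apply/codomP/codomP => -[m E]; exists m; first by rewrite E /= sK.
by rewrite /= -E sK.
Qed.

Lemma count_codom_inj (I : finType) (f : I -> point) x : injective f ->
  count_mem x (codom f) = (x \in codom f).
Proof. by move=> fI; rewrite count_uniq_mem //; exact/injectiveP. Qed.

Lemma Rpt_inj : injective (Rpt S).
Proof.
have := points_distinct S; rewrite !cat_uniq => /and5P[_ _ _ _].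
by case/and3P=> /injectiveP.
Qed.

Lemma Qpt_inj : injective (@Qpt R n).
Proof. by move=> i j []. Qed.

Let sigma_inj : injective sigma := inv_inj (inv_involutive (sigma_involution sigmaS)).

Lemma count_zero j a : count_mem (j, pt_fin a) (zero_divisor S sigma) =
  (((j, pt_fin a) \in codom (gam S)) + (sigma (j, pt_fin a) \in codom (gam S)))%N.
Proof.
rewrite !count_cat (count_codom_inj _ (@gam_inj R n S)).
rewrite (count_codom_inj _ (inj_comp sigma_inj (@gam_inj R n S))) sigma_codom.
by rewrite (count_memPn _) //; apply/codomP => -[].
Qed.

Lemma count_pole x : count_mem x (pole_divisor S sigma) =
  ((x \in codom (@Qpt R n)) + ((x \in codom (Rpt S)) + (sigma x \in codom (Rpt S))))%N.
Proof.
rewrite !count_cat (count_codom_inj _ Qpt_inj) (count_codom_inj _ Rpt_inj).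
by rewrite (count_codom_inj _ (inj_comp sigma_inj Rpt_inj)) sigma_codom.
Qed.

Lemma max0_split (k : int) (p q : nat) : Num.max k 0 = p%:Z -> Num.max (- k) 0 = q%:Z ->
  k = p%:Z - q%:Z.
Proof.
have [k0|k0] := leP k 0.
  by rewrite max_l ?oppr_ge0 // => <- <-; rewrite sub0r opprK.
by rewrite max_r ?oppr_le0 ?ltW // => -> <-; rewrite subr0.
Qed.

Variables (j : 'I_n) (s : nat) (d d' : C) (r1 r2 r1' r2' : 'I_(nb_gam S) -> C) (c1 c2 c1' c2' : C).
Let A := amplitude d r1 c1 r2 c2 j.
Let B := amplitude d' r1' c1' r2' c2' j.
Hypothesis AR : forall z, (j, pt_fin z) \in codom (Rpt S) -> A z = 0.
Hypothesis BR : forall z, (j, pt_fin z) \in codom (Rpt S) -> B z = 0.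

(** The exponentials at z and at sigma z = -z multiply to 1, so only the rational factors appear. *)
Definition bilinear_form z := z ^+ s * (A z * B (- z)) * omega (j, pt_fin z).

Definition residue_term z := if singular (node S) (j, pt_fin z) || (z == 0)
  then z ^+ s * (A z * B (- z)) * Res omega (j, pt_fin z) else 0.

(** At a node or at Q_j both amplitudes are regular and Omega has at most a simple pole. Elsewhere
    each point of gamma, R or their images under sigma counted in the order of an amplitude is
    counted with the opposite sign in the order of Omega. *)
Lemma bilinear_form_pole a : simple_pole bilinear_form a (residue_term a).
Proof.
have [k Hk] := omega_germ omegaS.
have [k1 k2 k3 /(_ j a erefl) k4] := Hk (j, pt_fin a).
rewrite count_zero in k1; rewrite count_pole in k2.
have sE : sigma (j, pt_fin a) = (j, pt_fin (- a)) := sigmaE sigmaS j a.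
have hX : holomorphic_at (fun t => (a + t) ^+ s) 0 := (taylor1X s (taylor1_shift a)).1.
rewrite /residue_term; case: ifP => special.
  have [kge ag sag] : [/\ -1 <= k (j, pt_fin a), (j, pt_fin a) \notin codom (gam S)
      & (j, pt_fin (- a)) \notin codom (gam S)].
    have gam_ns y : y \in codom (gam S) -> ~~ singular (node S) y.
      by move=> yg; apply: points_nonsingular; rewrite !mem_cat yg !orbT.
    have [sing|nsing] := boolP (singular (node S) (j, pt_fin a)).
      split; first exact: k3.
        by apply: contraL sing => /gam_ns.
      by rewrite -sE; apply: contraL (sigma_glued_singular sing) => /gam_ns.
    move: special; rewrite (negbTE nsing) /= => /eqP a0.
    rewrite a0 oppr0 -/(Qpt j); split; [|exact: Qpt_notin_gam|exact: Qpt_notin_gam].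
    move: (k2 nsing); rewrite sE a0 oppr0 -/(Qpt j) codom_f (negbTE (Qpt_notin_R _ _)) => K.
    have : - k (Qpt j) <= 1 by rewrite -[leRHS]/(Posz (true + (false + false))%N) -K le_max lexx.
    by rewrite lerNl.
  apply: (@simple_poleM (fun z => omega (j, pt_fin z)) (fun z => z ^+ s * (A z * B (- z)))).
    exact: (simple_pole_Res kge k4).
  apply: holomorphicM; first exact: hX.
  apply: holomorphicM; first exact: (amplitude_taylor1 d r1 c1 r2 c2 ag).1.
  have := (taylor1_opp (amplitude_taylor1 d' r1' c1' r2' c2' sag)).1.
  by under eq_fun do rewrite -opprD.
move/negbT: special; rewrite negb_or => /andP[nsing a0].
have {}k2 := k2 nsing.
have Qa : ((j, pt_fin a) \in codom (@Qpt R n)) = false.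
  by apply/negP => /codomP[i [_ E]]; rewrite E eqxx in a0.
rewrite Qa sE /= in k2; rewrite sE in k1.
have kE := max0_split k1 k2.
have [gA [hA EA]] := amplitude_order (@AR a).
have [gB [hB EB]] := amplitude_order (@BR (- a)).
have [p [[hp _] Ep]] := k4.
set x := (j, pt_fin a) in kE k1 k2 k3 k4 EA Ep Hk nsing Qa sE *.
set y := (j, pt_fin (- a)) in kE k1 k2 EB sE *.
set eB := Posz (y \in codom (Rpt S)) - Posz (y \in codom (gam S)) in EB.
pose G t := (a + t) ^+ s * (gA t * ((-1) ^ eB * gB (- t))) * p t.
exists (fun t => t * G t); split.
- apply: holomorphicM; first exact: holomorphic_id.
  apply: holomorphicM; last exact: hp.
  apply: holomorphicM; first exact: hX.
  apply: holomorphicM; first exact: hA.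
  by apply: holomorphicM; [exact: holomorphic_cst|exact: holomorphic_opp].
- by rewrite mul0r.
have {}EB : \forall t \near (0 : C)^', B (- a + - t) = gB (- t) * (- t) ^ eB.
  exact: (near_opp EB).
near=> t.
have t0 : t != 0 by near: t; exact: dnbhs0_neq0.
have tA : A (a + t) = gA t * t ^ (Posz (x \in codom (Rpt S)) - Posz (x \in codom (gam S))).
  by near: t; exact: EA.
have tB : B (- a + - t) = gB (- t) * (- t) ^ eB by near: t; exact: EB.
have tp : omega (j, pt_fin (a + t)) = p t * t ^ k x by near: t; exact: Ep.
have -> : t * G t / t = G t by rewrite mulrAC (divff t0) mul1r.
rewrite /bilinear_form opprD tA tB tp /G.
have -> : (- t) ^ eB = (-1) ^ eB * t ^ eB by rewrite -expfzMl mulN1r.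
(* The three exponents sum to 0; the sign from (-t)^eB has been put into [G]. *)
have tE : t ^ (Posz (x \in codom (Rpt S)) - Posz (x \in codom (gam S))) * t ^ eB * t ^ k x = 1.
  rewrite -!(expfzDr _ _ t0) kE /eB.
  rewrite [X in t ^ X](_ : _ = 0) ?expr0z //.
  by rewrite !PoszD; ring.
by rewrite -[RHS]mulr1 -tE; ring.
Unshelve. all: by end_near. Qed.

End LocalResidue.

(** * Summation over the components *)

Section BilinearIdentity.
Context {R : realType} {n : nat}.
Local Notation C := (cplx R).
Local Notation point := (curve_point R n).
Variables (S : spectral_data R n) (sigma : point -> point) (omega : point -> C).
Variables (D : set 'rV[R]_n) (psi : 'rV[R]_n -> point -> C) (h : 'rV[R]_n -> 'I_n -> C).
Hypothesis sigmaS : sigma_data S sigma.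
Hypothesis omegaS : Omega_data S sigma omega.
Hypothesis sameS : same_coordinates S.
Hypothesis oD : open D.
Hypothesis psiBA : BA_family S D psi h.
Variables (r dr : 'rV[R]_n -> 'I_n -> 'I_(nb_gam S) -> C).
Hypothesis psi_pd : forall u (i j : 'I_n) z, D u -> (j, pt_fin z) \notin codom (gam S) ->
   has_pd i u (fun v => psi v (j, pt_fin z)) (expC (ofR (u 0 j) * z) *
     ((i == j)%:R * z * frac_sum (r u i) j (h u j) z
      + frac_sum (dr u i) j (partialC i (h^~ j) u) z)).
Variable u : 'rV[R]_n.
Hypothesis Du : D u.

Let nodes := codom (fst \o node S) ++ codom (snd \o node S).

Implicit Types (j : 'I_n).

Definition dpsi (i : 'I_n) x : C := partialC i (fun v => psi v x) u.

Definition ampl (i : 'I_n) j : C -> C :=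
  amplitude (i == j)%:R (r u i) (h u j) (dr u i) (partialC i (h^~ j) u) j.

Lemma dpsi_pd i j z : (j, pt_fin z) \notin codom (gam S) ->
  has_pd i u (fun v => psi v (j, pt_fin z)) (dpsi i (j, pt_fin z)).
Proof. by move=> zg; exact/pdiff_has_pd/has_pd_pdiff/(psi_pd i Du zg). Qed.

Lemma dpsiE i j z : (j, pt_fin z) \notin codom (gam S) ->
  dpsi i (j, pt_fin z) = expC (ofR (u 0 j) * z) * ampl i j z.
Proof. by move=> zg; exact: has_pdE (psi_pd i Du zg). Qed.

(** At R the section takes a value independent of u, so its derivative vanishes there, and the
    exponential factor is nonzero. *)
Lemma ampl_R (i : 'I_n) j z : (j, pt_fin z) \in codom (Rpt S) -> ampl i j z = 0.
Proof.
move=> /codomP[m mE]; have zg : (j, pt_fin z) \notin codom (gam S).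
  by rewrite mE Rpt_notin_gam.
have : dpsi i (j, pt_fin z) = 0.
  rewrite /dpsi; apply: has_pdE; apply: (has_pd_near _ (has_pd_cst i u (Defs.dcst S m))).
  near=> v; have Dv : D v by near: v; exact: near_D.
  by rewrite mE (BA_normalization (BAF_section psiBA Dv)).
rewrite (dpsiE i zg) => /eqP; rewrite mulf_eq0 (negbTE (expC_neq0 _)) /=.
by move/eqP.
Unshelve. all: by end_near. Qed.

Lemma singular_notin_gam x : singular (node S) x -> x \notin codom (gam S).
Proof.
apply: contraL => xg; apply: points_nonsingular.
by rewrite !mem_cat xg !orbT.
Qed.

Lemma glued_singular a b : glued (node S) a b ->
  singular (node S) a /\ singular (node S) b.
Proof.
by move=> /existsP[m /orP[]/eqP E]; split; apply/existsP; exists m; rewrite E /= eqxx ?orbT.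
Qed.

(** The gluing constants do not depend on u, so the gluing condition can be differentiated. *)
Lemma dpsi_glued i a b : glued (node S) a b -> dpsi i a = lam S a b * dpsi i b.
Proof.
move=> ab; have [_ sb] := glued_singular ab.
have bg := singular_notin_gam sb; rewrite (singular_fin sb) in bg.
have := has_pdZ (lam S a b) (dpsi_pd i bg); rewrite -(singular_fin sb) => K.
rewrite {1}/dpsi; apply: has_pdE; apply: (has_pd_near _ K); near=> v.
have Dv : D v by near: v; exact: near_D.
by rewrite (BA_gluing (BAF_section psiBA Dv) ab).
Unshelve. all: by end_near. Qed.

Variables (s : nat) (i k : 'I_n).

Let T x := Defs.coord x.2 ^+ s * (dpsi i x * dpsi k (sigma x)) * Res omega x.

Lemma T_node m : T (node S m).1 + T (node S m).2 = 0.
Proof.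
set a := (node S m).1; set b := (node S m).2.
have ab : glued (node S) a b.
  by apply/existsP; exists m; rewrite -surjective_pairing eqxx.
have sab := inv_glued (sigma_involution sigmaS) ab.
have [res _] := Omega_residue omegaS ab.
rewrite /T (sameS ab) (dpsi_glued i ab) (dpsi_glued k sab).
have -> : Defs.coord b.2 ^+ s * (lam S a b * dpsi i b *
     (lam S (sigma a) (sigma b) * dpsi k (sigma b))) * Res omega a +
   Defs.coord b.2 ^+ s * (dpsi i b * dpsi k (sigma b)) * Res omega b =
   Defs.coord b.2 ^+ s * (dpsi i b * dpsi k (sigma b)) *
   (lam S a b * lam S (sigma a) (sigma b) * Res omega a + Res omega b) by ring.
by rewrite res mulr0.
Qed.

Lemma sum_T_nodes : \sum_(x <- nodes) T x = 0.
Proof.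
rewrite /nodes big_cat /= /codom !big_image /= -big_split /=.
by apply: big1 => m _; exact: T_node.
Qed.

Let rho j := residue_term omega j s (i == j)%:R (k == j)%:R
  (r u i) (dr u i) (r u k) (dr u k) (h u j) (partialC i (h^~ j) u)
  (h u j) (partialC k (h^~ j) u).

Lemma rhoE j z : (j, pt_fin z) \notin codom (gam S) -> (j, pt_fin (- z)) \notin codom (gam S) ->
  singular (node S) (j, pt_fin z) || (z == 0) -> rho j z = T (j, pt_fin z).
Proof.
move=> zg szg H; rewrite /rho /residue_term H /T (sigmaE sigmaS) dpsiE // dpsiE //=.
rewrite -[amplitude _ _ _ _ _ _ z]/(ampl i j z) -[amplitude _ _ _ _ _ _ (- z)]/(ampl k j (- z)).
have E : expC (ofR (u 0 j) * z) * expC (ofR (u 0 j) * - z) = 1 by rewrite mulrN expCNK.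
congr (_ * _ * _); rewrite mulrACA E mul1r //.
Qed.

(** Summed over all components, the residues at the two points of each node cancel. What remains at
    Q_j carries the factor 0^s: the Gram matrix of the gradients of the x^j for s = 0, nothing for s
    = 1. *)
Lemma residue_sum (rinf : 'I_n -> C) :
  (forall j, w^-1 * (w^-1 ^+ s * (ampl i j w^-1 * ampl k j (- w^-1)) * omega (j, pt_fin w^-1))
     @[w --> (0 : C)^'] --> rinf j) ->
  \sum_j rinf j = 0 ^+ s * \sum_j dpsi i (Qpt j) * dpsi k (Qpt j).
Proof.
move=> inf.
(* The entry 0 is the coordinate of Q_j; it is not repeated among the node coordinates because Q_j
   is nonsingular. *)
pose E j := 0 :: [seq Defs.coord x.2 | x <- nodes & x.1 == j].
have nodeP x : x \in nodes -> singular (node S) x by rewrite singularE.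
have uE j : uniq (E j).
  rewrite /= map_inj_in_uniq.
    rewrite filter_uniq ?node_double // andbT; apply/mapP => -[x].
    rewrite mem_filter => /andP[/eqP xj /nodeP xs] x0.
    have := @points_nonsingular R n S (Qpt j).
    rewrite !mem_cat codom_f orbT => /(_ isT); apply/negP; rewrite negbK.
    by rewrite /Qpt x0 -xj -(singular_fin xs).
  move=> x y; rewrite !mem_filter => /andP[/eqP xj /nodeP xs] /andP[/eqP yj /nodeP ys] xy.
  by rewrite (singular_fin xs) (singular_fin ys) xj yj xy.
have rho0 j a : a \notin E j -> rho j a = 0.
  rewrite in_cons negb_or => /andP[a0 aE]; rewrite /rho /residue_term.
  case: ifP => // /orP[|/eqP E0]; last by rewrite E0 eqxx in a0.
  rewrite singularE => an; case/negP: aE; apply/mapP; exists (j, pt_fin a) => //.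
  by rewrite mem_filter /= eqxx.
have res j : \sum_(e <- E j) rho j e = rinf j.
  apply: (@residue_theorem R (bilinear_form omega j s (i == j)%:R (k == j)%:R
    (r u i) (dr u i) (r u k) (dr u k) (h u j) (partialC i (h^~ j) u)
    (h u j) (partialC k (h^~ j) u)) (rho j) (E j) (uE j) (rho0 j)).
    move=> a; apply: (bilinear_form_pole sigmaS omegaS) => z zR; exact: ampl_R.
  exact: inf.
have rhoQ j : rho j 0 = 0 ^+ s * (dpsi i (Qpt j) * dpsi k (Qpt j)).
  rewrite rhoE ?eqxx ?orbT ?oppr0 ?Qpt_notin_gam // /T -/(Qpt j) (sigma_Q sigmaS).
  by rewrite (Omega_residue_Q omegaS) mulr1.
have rho_nodes j : \sum_(e <- E j) rho j e = rho j 0 + \sum_(x <- nodes | x.1 == j) T x.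
  rewrite big_cons big_map big_filter; congr (_ + _).
  rewrite big_seq_cond [RHS]big_seq_cond; apply: eq_bigr => x /andP[/nodeP xs /eqP xj].
  have xE := singular_fin xs; rewrite xj in xE.
  have xs' := xs; rewrite xE in xs'.
  rewrite rhoE ?xs' //; first by rewrite -xE.
    exact: singular_notin_gam.
  rewrite -(sigmaE sigmaS); apply: singular_notin_gam.
  exact: (sigma_glued_singular sigmaS xs').
rewrite (eq_bigr (fun j => rho j 0 + \sum_(x <- nodes | x.1 == j) T x)); last first.
  by move=> j _; rewrite -res rho_nodes.
(* Each point of a node lies on exactly one component, so the double sum is the sum over all nodes,
   which vanishes. *)
rewrite big_split /= (exchange_big_dep predT) //= [X in _ + X](_ : _ = 0) ?addr0; last first.
  rewrite -[RHS]sum_T_nodes; apply: eq_bigr => x _.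
  by rewrite (eq_bigl (pred1 x.1)) ?big_pred1_eq // => j /=; rewrite eq_sym.
by rewrite mulr_sumr; apply: eq_bigr => j _; exact: rhoQ.
Qed.

End BilinearIdentity.

(** * The metric *)

Section InverseCube.
Variables (K : fieldType) (w a b c : K).
Hypothesis w0 : w != 0.

(** Omega takes w^-3, and each amplitude growing like z takes one w. Two growing amplitudes match s
    = 0 and one matches s = 1; with none and s = 1 a factor w is left over, and the limit is 0. *)
Lemma inv_cube0 : w * a * (w * b) * (w^-1 ^+ 3 * c) = w^-1 * (w^-1 ^+ 0 * (a * b) * c).
Proof. by field. Qed.
Lemma inv_cube1l : w * a * b * (w^-1 ^+ 3 * c) = w^-1 * (w^-1 ^+ 1 * (a * b) * c).
Proof. by field. Qed.
Lemma inv_cube1r : a * (w * b) * (w^-1 ^+ 3 * c) = w^-1 * (w^-1 ^+ 1 * (a * b) * c).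
Proof. by field. Qed.
Lemma inv_cube1 : w * (a * b * (w^-1 ^+ 3 * c)) = w^-1 * (w^-1 ^+ 1 * (a * b) * c).
Proof. by field. Qed.
End InverseCube.

(** * Contributions at infinity *)

Section Asymptotics.
Context {R : realType} {n : nat}.
Local Notation C := (cplx R).
Local Notation point := (curve_point R n).
Variables (S : spectral_data R n) (sigma : point -> point) (omega : point -> C).
Variables (eps : 'I_n -> C).
Hypothesis sigmaS : sigma_data S sigma.
Hypothesis omegaS : Omega_data S sigma omega.
Hypothesis omega_eps : Omega_expansion omega eps.

(** P_j is a simple zero of Omega, being distinct from the points of gamma and sigma gamma, and
    eps_j^2 is the leading coefficient there. *)
Lemma eps_neq0 j : eps j != 0.
Proof.
have [k [[g [hg g0] E] [k1 _ _]]] : exists k : int, has_order (form_at omega (Ppt j)) k /\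
   [/\ Num.max k 0 = (count_mem (Ppt j) (zero_divisor S sigma))%:Z,
          ~~ singular (node S) (Ppt j) ->
            Num.max (- k) 0 = (count_mem (Ppt j) (pole_divisor S sigma))%:Z
        & singular (node S) (Ppt j) -> -1 <= k].
  by have [k ? ?] := Omega_order omegaS (Ppt j); exists k.
have Pinj : injective (@Ppt R n) by move=> a b [].
have Pgam : Ppt j \notin codom (gam S).
  by apply/codomP => -[m /esym]; exact: gam_notP.
have Psgam : Ppt j \notin codom (sigma \o gam S).
  by rewrite (sigma_codom sigmaS) (sigma_P sigmaS).
have k1E : k = 1.
  move: k1; rewrite !count_cat (count_codom_inj _ Pinj) codom_f.
  rewrite (count_memPn Pgam) (count_memPn Psgam) !addn0 /=.
  by have [k0 //|k0 ->] := leP k 0.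
have K : - g w @[w --> (0 : C)^'] --> - g 0.
  by apply: cvgN; exact: cvg_derivable (nbhs_singleton hg).
have K2 : - g w @[w --> (0 : C)^'] --> - eps j ^+ 2.
  refine (cvgC_near_eq _ (form_at_P_limit (j := j) omega_eps)).
  apply: filterS2 dnbhs0_neq0 E => w w0; rewrite k1E /form_at /= expr1z => Ew.
  by apply: (mulIf w0); rewrite mulNr -Ew; field.
have E2 : - g 0 = - eps j ^+ 2 by exact: (cvgC_unique K K2).
apply: contraNneq g0 => e0; move/oppr_inj: E2 => ->.
by rewrite e0 expr0n.
Qed.

Variables (u : 'rV[R]_n) (h : 'rV[R]_n -> 'I_n -> C)
  (r dr : 'rV[R]_n -> 'I_n -> 'I_(nb_gam S) -> C).
Local Notation A := (ampl h r dr u).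
Local Notation dh i j := (partialC i (h^~ j) u).
Implicit Types (i j k : 'I_n).

Lemma ampl_inf i j : w * A i j w^-1 @[w --> (0 : C)^'] --> (i == j)%:R * h u j.
Proof.
have := @amplitude_inf R n S (i == j)%:R (r u i) (h u j) (dr u i) (dh i j) j 1 (oner_neq0 _).
by rewrite mul1r; under eq_fun do rewrite mul1r.
Qed.

Lemma ampl_infN i j : w * A i j (- w^-1) @[w --> (0 : C)^'] --> - ((i == j)%:R * h u j).
Proof.
have N1 : -1 != 0 :> C by rewrite oppr_eq0 oner_neq0.
have := @amplitude_inf R n S (i == j)%:R (r u i) (h u j) (dr u i) (dh i j) j (-1) N1.
by rewrite mulN1r mulNr; under eq_fun do rewrite mulN1r.
Qed.

Lemma ampl_inf0 i j : i != j -> A i j w^-1 @[w --> (0 : C)^'] --> dh i j.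
Proof.
move=> ij; have := @amplitude_inf0 R n S (r u i) (h u j) (dr u i) (dh i j) j 1 (oner_neq0 _).
by rewrite /ampl (negbTE ij); under eq_fun do rewrite mul1r.
Qed.

Lemma ampl_inf0N i j : i != j -> A i j (- w^-1) @[w --> (0 : C)^'] --> dh i j.
Proof.
have N1 : -1 != 0 :> C by rewrite oppr_eq0 oner_neq0.
move=> ij; have := @amplitude_inf0 R n S (r u i) (h u j) (dr u i) (dh i j) j (-1) N1.
by rewrite /ampl (negbTE ij); under eq_fun do rewrite mulN1r.
Qed.

(** Two signs cancel: one from evaluating the second factor at -z, one from dz = - dt / t^2. *)
Lemma metric_residue_inf i k j :
  w^-1 * (w^-1 ^+ 0 * (A i j w^-1 * A k j (- w^-1)) * omega (j, pt_fin w^-1))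
     @[w --> (0 : C)^'] --> (i == j)%:R * (k == j)%:R * (eps j * h u j) ^+ 2.
Proof.
have K : w * A i j w^-1 * (w * A k j (- w^-1)) * (w^-1 ^+ 3 * omega (j, pt_fin w^-1))
    @[w --> (0 : C)^'] --> (i == j)%:R * h u j * - ((k == j)%:R * h u j) * - eps j ^+ 2.
  apply: cvgM; last exact: form_at_P_limit.
  by apply: cvgM; [exact: ampl_inf|exact: ampl_infN].
have E : (i == j)%:R * h u j * - ((k == j)%:R * h u j) * - eps j ^+ 2 =
   (i == j)%:R * (k == j)%:R * (eps j * h u j) ^+ 2 by ring.
rewrite E in K; refine (cvgC_near_eq _ K).
by apply: filterS dnbhs0_neq0 => w w0; exact: inv_cube0.
Qed.

(** For i <> k at most one amplitude grows on the component, and the extra z compensates for the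
    other. The two terms have opposite signs because only the second amplitude is evaluated at
    -z. *)
Lemma egorov_residue_inf i k j : i != k ->
  w^-1 * (w^-1 ^+ 1 * (A i j w^-1 * A k j (- w^-1)) * omega (j, pt_fin w^-1))
     @[w --> (0 : C)^'] -->
  (k == j)%:R * (eps j ^+ 2 * h u j * dh i j) - (i == j)%:R * (eps j ^+ 2 * h u j * dh k j).
Proof.
move=> ik; have P := form_at_P_limit (j := j) omega_eps.
have b1 (b : bool) : b -> b%:R = 1 :> C by case: b.
have b0 (b : bool) : ~~ b -> b%:R = 0 :> C by case: b.
have [/eqP ij|/eqP ij] := pselect (i = j); [|have [/eqP kj|/eqP kj] := pselect (k = j)].
- have kj : k != j by rewrite -(eqP ij) eq_sym.
  have K : w * A i j w^-1 * A k j (- w^-1) * (w^-1 ^+ 3 * omega (j, pt_fin w^-1))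
      @[w --> (0 : C)^'] --> (i == j)%:R * h u j * dh k j * - eps j ^+ 2.
    apply: cvgM; last exact: P.
    by apply: cvgM; [exact: ampl_inf|exact: ampl_inf0N].
  have E : (i == j)%:R * h u j * dh k j * - eps j ^+ 2 =
      (k == j)%:R * (eps j ^+ 2 * h u j * dh i j) - (i == j)%:R * (eps j ^+ 2 * h u j * dh k j).
    by rewrite (b1 _ ij) (b0 _ kj); ring.
  rewrite E in K; refine (cvgC_near_eq _ K).
  by apply: filterS dnbhs0_neq0 => w w0; exact: inv_cube1l.
- have K : A i j w^-1 * (w * A k j (- w^-1)) * (w^-1 ^+ 3 * omega (j, pt_fin w^-1))
      @[w --> (0 : C)^'] --> dh i j * - ((k == j)%:R * h u j) * - eps j ^+ 2.
    apply: cvgM; last exact: P.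
    by apply: cvgM; [exact: ampl_inf0|exact: ampl_infN].
  have E : dh i j * - ((k == j)%:R * h u j) * - eps j ^+ 2 =
      (k == j)%:R * (eps j ^+ 2 * h u j * dh i j) - (i == j)%:R * (eps j ^+ 2 * h u j * dh k j).
    by rewrite (b1 _ kj) (b0 _ ij); ring.
  rewrite E in K; refine (cvgC_near_eq _ K).
  by apply: filterS dnbhs0_neq0 => w w0; exact: inv_cube1r.
- have K : w * (A i j w^-1 * A k j (- w^-1) * (w^-1 ^+ 3 * omega (j, pt_fin w^-1)))
      @[w --> (0 : C)^'] --> 0 * (dh i j * dh k j * - eps j ^+ 2).
    apply: cvgM; first exact: cvg_within.
    apply: cvgM; last exact: P.
    by apply: cvgM; [exact: ampl_inf0|exact: ampl_inf0N].
  have E : 0 * (dh i j * dh k j * - eps j ^+ 2) =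
      (k == j)%:R * (eps j ^+ 2 * h u j * dh i j) - (i == j)%:R * (eps j ^+ 2 * h u j * dh k j).
    by rewrite (b0 _ kj) (b0 _ ij); ring.
  rewrite E in K; refine (cvgC_near_eq _ K).
  by apply: filterS dnbhs0_neq0 => w w0; exact: inv_cube1.
Qed.

End Asymptotics.

(** * Real quantities and the Egorov property *)

Lemma cconj_real (R : realType) (z : cplx R) : cconj z = z -> z = ofR (reC z).
Proof.
case: z => a b [] /eqP; rewrite eq_sym -subr_eq0 opprK -mulr2n mulrn_eq0 /= => /eqP ->.
by [].
Qed.

Lemma square_nonneg_real (R : realType) (z : cplx R) (q : R) : 0 <= q ->
  z ^+ 2 = ofR q -> z = ofR (reC z).
Proof.
case: z => a b q0; rewrite expr2 => E.
have E1 : a * a - b * b = q := congr1 (@reC R) E.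
have E2 : a * b + b * a = 0 := congr1 (@imC R) E.
have ab : a * b = 0 by lra.
have b0 : b = 0.
  apply/eqP; move/eqP: ab; rewrite mulf_eq0 => /orP[/eqP a0|//].
  move: E1; rewrite a0 mul0r sub0r => bq.
  have : b * b <= 0 by lra.
  by rewrite -expr2 exprn_even_le0.
by rewrite b0.
Qed.

Lemma partialC_real (R : realType) (n : nat) (D : set 'rV[R]_n) (F : 'rV[R]_n -> cplx R)
    (u : 'rV[R]_n) (i : 'I_n) : open D -> D u -> (forall v, D v -> cconj (F v) = F v) ->
  partialC i F u = ofR (partial i (reC \o F) u).
Proof.
move=> oD Du Freal; apply: C_eq; rewrite //= /partial.
rewrite (@near_eq_derive _ _ _ _ (cst 0)); first exact: derive_cst.
near=> v; rewrite /= (cconj_real (Freal v _)) //.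
by near: v; exact: open_nbhs_nbhs.
Unshelve. all: by end_near. Qed.

Lemma sum_delta (K : pzRingType) (n : nat) (i : 'I_n) (f : 'I_n -> K) :
  \sum_j (i == j)%:R * f j = f i.
Proof.
rewrite (bigD1 i) //= big1 => [|j ji]; last by rewrite eq_sym (negbTE ji) mul0r.
by rewrite eqxx mul1r addr0.
Qed.

Theorem theorem3 (R : realType) (n : nat) (S : spectral_data R n)
    (sigma tau : curve_point R n -> curve_point R n) (omega : curve_point R n -> cplx R)
    (eps : 'I_n -> cplx R) (D : set 'rV[R]_n)
    (psi : 'rV[R]_n -> curve_point R n -> cplx R) (h : 'rV[R]_n -> 'I_n -> cplx R) :
  sigma_data S sigma ->
  Omega_data S sigma omega ->
  tau_data S omega tau ->
  domain D ->
  BA_family S D psi h ->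
  Omega_expansion omega eps ->
  same_coordinates S ->
  exists x H : 'I_n -> 'rV[R]_n -> R,
    [/\ forall u k, D u -> psi u (Qpt k) = ofR (x k u),
        forall u j, D u -> eps j * h u j = ofR (H j u)
      & Darboux_Egorov D x H].
Proof.
move=> sigmaS omegaS tauS [[u0 Du0] oD _] psiBA omega_eps sameS.
pose x k u := reC (psi u (Qpt k)).
pose hr j u := reC (h u j).
(* The real part is all of [eps j], which is known only once the metric identity gives eps_j^2 >=
   0. *)
pose H j u := reC (eps j) * hr j u.
have psiQ u k : D u -> psi u (Qpt k) = ofR (x k u).
  by move=> Du; apply: cconj_real; exact: (psi_Q_real tauS psiBA).
have hE u j : D u -> h u j = ofR (hr j u).
  by move=> Du; apply: cconj_real; exact: (h_real tauS psiBA).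
have dpsiQ u i k : D u -> dpsi psi u i (Qpt k) = ofR (partial i (x k) u).
  move=> Du; refine (@partialC_real R n D (fun v => psi v (Qpt k)) u i oD Du _) => v Dv.
  exact: (psi_Q_real tauS psiBA).
have dhE u i j : D u -> partialC i (h^~ j) u = ofR (partial i (hr j) u).
  move=> Du; refine (@partialC_real R n D (h^~ j) u i oD Du _) => v Dv.
  exact: (h_real tauS psiBA).
have [r [dr psi_pd]] := psi_derivative oD psiBA.
have metric u i k : D u ->
    (i == k)%:R * (eps i * h u i) ^+ 2 = ofR (\sum_j partial i (x j) u * partial k (x j) u).
  move=> Du.
  have := residue_sum sigmaS omegaS sameS oD psiBA psi_pd Du
    (fun j => @metric_residue_inf R n S omega eps omega_eps u h r dr i k j).
  under eq_bigr do rewrite -mulrA.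
  rewrite sum_delta expr0 mul1r eq_sym => ->.
  rewrite (big_morph (@ofR R) (@ofRD R) (@ofR0 R)); apply: eq_bigr => j _.
  by rewrite !dpsiQ // ofRM.
have egorov u i k : D u -> i != k ->
    eps k ^+ 2 * h u k * partialC i (h^~ k) u = eps i ^+ 2 * h u i * partialC k (h^~ i) u.
  move=> Du ik.
  have := residue_sum sigmaS omegaS sameS oD psiBA psi_pd Du
    (fun j => @egorov_residue_inf R n S omega eps omega_eps u h r dr i k j ik).
  rewrite expr1 mul0r sumrB.
  rewrite (sum_delta k) (sum_delta i) => E; apply/eqP; rewrite -subr_eq0; exact/eqP.
have h0 u j : D u -> hr j u != 0.
  move=> Du; have := BAF_h_neq0 psiBA j Du; rewrite hE //.
  by apply: contra_neq => ->.
(* Since [eps j] is constant, the diagonal metric identity at the single point u0 is enough: it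
   exhibits eps_j^2 as a sum of squares divided by the nonzero square of h_j. *)
have epsE j : eps j = ofR (reC (eps j)).
  pose q := \sum_k partial j (x k) u0 * partial j (x k) u0.
  apply: (@square_nonneg_real _ _ (q / hr j u0 ^+ 2)).
    by rewrite divr_ge0 ?sqr_ge0 // sumr_ge0 // => k _; rewrite -expr2 sqr_ge0.
  have := metric u0 j j Du0; rewrite eqxx mul1r hE // exprMn -/q => E.
  have hn : ofR (hr j u0) != 0 :> cplx R.
    by apply: contra_neq (h0 u0 j Du0) => E0; apply: (@ofR_inj R).
  have n2 : ofR (hr j u0) ^+ 2 != 0 :> cplx R by rewrite expf_neq0.
  apply: (mulIf n2); rewrite E.
  have -> : ofR (hr j u0) ^+ 2 = ofR (hr j u0 ^+ 2) by rewrite !expr2 ofRM.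
  rewrite -ofRM divfK //.
  by rewrite expf_neq0 // h0.
have epsh u j : D u -> eps j * h u j = ofR (H j u).
  by move=> Du; rewrite hE // {1}epsE -ofRM.
have er0 j : reC (eps j) != 0.
  by have := eps_neq0 sigmaS omegaS omega_eps j; rewrite {1}epsE; apply: contra_neq => ->.
have H0 u j : D u -> H j u != 0 by move=> Du; rewrite mulf_neq0 ?er0 ?h0.
have hs j : smooth_on D (hr j) := (h_smooth psiBA j).1.
exists x, H; split; [exact: psiQ|exact: epsh|split].
  split.
  - by move=> k; exact: (psi_smooth psiBA (Qpt_notin_gam S k)).1.
  - by move=> j; exact: smooth_scale.
  - exact: H0.
  - move=> u i j Du; apply: (@ofR_inj R); rewrite -metric // epsh // expr2 -ofRM -expr2.
    by case: eqP => _; [rewrite mul1r|rewrite mul0r].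
move=> u i j Du ij.
have dH k l : partial k (H l) u = reC (eps l) * partial k (hr l) u.
  by rewrite /partial [LHS](deriveZ (reC (eps l)) ((hs l [::] u Du).2 k)).
(* The symmetry of the rotation coefficients cleared of denominators; in terms of h it is the
   identity for s = 1. *)
have E : H j u * partial i (H j) u = H i u * partial j (H i) u.
  rewrite !dH; apply: (@ofR_inj R).
  have conv (e a p : R) : ofR (e * a * (e * p)) = ofR e ^+ 2 * ofR a * ofR p :> cplx R.
    by rewrite !ofRM; ring.
  rewrite !conv -(epsE j) -(epsE i) -(hE u j Du) -(hE u i Du) -(dhE u i j Du) -(dhE u j i Du).
  exact: egorov.
by rewrite /rotation_coef; apply/eqP; rewrite eqr_div ?H0 // mulrC E mulrC.
Qed.
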